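(* Let $V\subseteq\mathbb{G}^n$ be an absolutely irreducible simple variety. Then $\check V\subseteq\mathbb{G}^{2n}$ is an absolutely free, absolutely irreducible rotund variety. Moreover, if $\dim M\cdot\check V=\mathrm{rank}\,M$ for some integer matrix $M\in\mathcal{M}_{p,2n}(\mathbb{Z})$ of rank $p>0$, then $V$ is perfectly rotund, and one of the following holds: (1) $\mathrm{rank}\,M=2n$; (2) $\mathrm{rank}\,M=n$ and $M=(N\,|\,P)$ where $N,P\in\mathcal{M}_{n,n}(\mathbb{Z})$ are square matrices of maximum rank.
   Context: $K$ is an algebraically closed field of characteristic $0$ with an automorphism $\sigma$ of order two; $R=K^\sigma$ (a real closed field), $i\in K$ with $i^2=-1$, so $K=R(i)$. For $z\in K$: $\Re(z)=(z+\sigma(z))/2$, $\Im(z)=(z-\sigma(z))/(2i)$; for $w\in K^\times$: $|w|=\sqrt{w\sigma(w)}\in R_{>0}$, $\Theta(w)=w/|w|$, lying in $\mathbb{S}^1=\{z:|z|=1\}$. $\mathbb{G}=\mathbb{G}_a\times\mathbb{G}_m$ with $\mathbb{G}_a(K)=(K,+)$, $\mathbb{G}_m(K)=(K^\times,\cdot)$; $\langle\bar z;\bar w\rangle=((z_1,w_1),\dots,(z_n,w_n))\in\mathbb{G}^n$. An integer matrix $M=(m_{ij})\in\mathcal{M}_{k,n}(\mathbb{Z})$ acts $\mathbb{G}^n\to\mathbb{G}^k$ by $M\cdot\langle\bar z;\bar w\rangle=\langle(\sum_jm_{ij}z_j)_i;(\prod_jw_j^{m_{ij}})_i\rangle$;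 $M\cdot V$ denotes the Zariski closure of the image of $V$. An irreducible $V\subseteq\mathbb{G}^n$ is rotund if $\dim M\cdot V\geq\mathrm{rank}\,M$ for all $M\in\mathcal{M}_{n,n}(\mathbb{Z})$; absolutely free if for every nonzero $M\in\mathcal{M}_{1,n}(\mathbb{Z})$ the projections of $M\cdot V$ to $\mathbb{G}_a$ and to $\mathbb{G}_m$ have dimension $1$; simple if absolutely free, rotund, and $\dim M\cdot V>\mathrm{rank}\,M$ whenever $0<\mathrm{rank}\,M<n$; perfectly rotund if simple and $\dim V=n$. The realisation map $r:\mathbb{G}^n(K)\to\mathbb{G}^{2n}(K)$ is $r(\langle\bar z;\bar w\rangle)=\langle\Re(\bar z);|\bar w|\rangle\times\langle i\Im(\bar z);\Theta(\bar w)\rangle$ (componentwise; the first $n$ coordinates carry real parts and moduli, the last $n$ carry $i$ times imaginary parts and phases). For $V\subseteq\mathbb{G}^n$, $r(V)=\{r(P):P\in V(K)\}$ and the $\mathbb{G}$-restriction of scalars $\check V$ is the Zariski closure of $r(V)$ in $\mathbb{G}^{2n}$. *)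

(* Defs.v *)
From HB Require Import structures.
From mathcomp Require Import all_boot all_order all_algebra.
From mathcomp Require Import mpoly.
Set Implicit Arguments. Unset Strict Implicit. Unset Printing Implicit Defensive.
Import Order.TTheory GRing.Theory Num.Theory.
Local Open Scope ring_scope.

Section Zariski.
Variable K : fieldType.

Definition pset (d : nat) := ('I_d -> K) -> Prop.

Definition psubset d (A B : pset d) := forall x, A x -> B x.

Definition zclosed d (U A : pset d) :=
  exists P : {mpoly K[d]} -> Prop,
    forall x, A x <-> (U x /\ forall p, P p -> p.@[x] = 0).

Definition zclosure d (U S : pset d) : pset d := fun x =>
  U x /\ forall p : {mpoly K[d]},
    (forall y, S y -> U y -> p.@[y] = 0) -> p.@[x] = 0.

Definition zirred d (U A : pset d) :=
  [/\ zclosed U A, exists x, A x &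
      forall B C, zclosed U B -> zclosed U C ->
        psubset A (fun x => B x \/ C x) -> psubset A B \/ psubset A C].

Definition dim_ge d (U A : pset d) (k : nat) :=
  exists C : nat -> pset d,
    (forall j, (j <= k)%N -> zirred U (C j) /\ psubset (C j) A) /\
    (forall j, (j < k)%N -> psubset (C j) (C j.+1) /\ ~ psubset (C j.+1) (C j)).

Definition dim_eq d (U A : pset d) (k : nat) := dim_ge U A k /\ ~ dim_ge U A k.+1.

Definition Ga_univ : pset 1 := fun _ => True.
Definition Gm_univ : pset 1 := fun x => forall i, x i != 0.

(* A point of G^m is x : 'I_(m+m) -> K; first m coordinates additive
   (z_1..z_m), last m multiplicative (w_1..w_m). *)
Definition Gz m (x : 'I_(m + m) -> K) (i : 'I_m) := x (lshift m i).
Definition Gw m (x : 'I_(m + m) -> K) (i : 'I_m) := x (rshift m i).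
Definition Gmk m (z w : 'I_m -> K) : 'I_(m + m) -> K :=
  fun k => match split k with inl i => z i | inr i => w i end.

Definition inG (m : nat) : pset (m + m) := fun x => forall i, Gw x i != 0.
Arguments inG : clear implicits.

Definition act k m (M : 'M[int]_(k, m)) (x : 'I_(m + m) -> K) : 'I_(k + k) -> K :=
  Gmk (fun i => \sum_j (Gz x j) *~ M i j) (fun i => \prod_j (Gw x j) ^ (M i j)).

Definition actV k m (M : 'M[int]_(k, m)) (V : pset (m + m)) : pset (k + k) :=
  zclosure (inG k) (fun y => exists x, V x /\ y = act M x).

Definition rankZ k m (M : 'M[int]_(k, m)) : nat :=
  \rank (map_mx (fun a : int => (a%:~R : rat)) M).

Definition rotund n (V : pset (n + n)) :=
  forall M : 'M[int]_n, dim_ge (inG n) (actV M V) (rankZ M).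

Definition proj_a (S : pset (1 + 1)) : pset 1 :=
  zclosure Ga_univ (fun z => exists y, S y /\ z = Gz y).
Definition proj_m (S : pset (1 + 1)) : pset 1 :=
  zclosure Gm_univ (fun z => exists y, S y /\ z = Gw y).

Definition abs_free n (V : pset (n + n)) :=
  forall M : 'M[int]_(1, n), M != 0 ->
    dim_eq Ga_univ (proj_a (actV M V)) 1 /\ dim_eq Gm_univ (proj_m (actV M V)) 1.

Definition simple n (V : pset (n + n)) :=
  [/\ abs_free V, rotund V &
      forall M : 'M[int]_n, (0 < rankZ M < n)%N ->
        dim_ge (inG n) (actV M V) (rankZ M).+1].

Definition perfectly_rotund n (V : pset (n + n)) := simple V /\ dim_eq (inG n) V n.

(* Realisation map.  s = |w| is characterised as the element of R = K^sigma
   with s^2 = w sigma(w) which is a square in R (i.e. positive in R).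
   i*Im(z) = (z - sigma z)/2 and Re(z) = (z + sigma z)/2. *)
Definition is_abs (sigma : K -> K) (w s : K) :=
  [/\ s ^+ 2 = w * sigma w, sigma s = s & exists t, sigma t = t /\ s = t ^+ 2].

Definition realset (sigma : K -> K) n (V : pset (n + n)) : pset ((n + n) + (n + n)) :=
  fun y => exists x, V x /\ exists s : 'I_n -> K,
    (forall i, is_abs sigma (Gw x i) (s i)) /\
    y = Gmk
          (fun k => match split k with
                    | inl i => (Gz x i + sigma (Gz x i)) / 2
                    | inr i => (Gz x i - sigma (Gz x i)) / 2 end)
          (fun k => match split k with
                    | inl i => s i
                    | inr i => Gw x i / s i end).

Definition Vcheck (sigma : K -> K) n (V : pset (n + n)) : pset ((n + n) + (n + n)) :=
  zclosure (inG (n + n)) (realset sigma V).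

End Zariski.
Arguments inG {K} m _.

(* Main.v *)
(** On points of V the involution sigma behaves like complex conjugation. If f is a transcendence
    basis of V, then f takes generic values (Chevalley), so f(x) and sigma(f(x)) satisfy no
    relation for x in V; hence the graph of sigma is Zariski dense in V x sigma(V).

    Choose an irreducible V~ mapping onto V under (z, u) |-> (z, u^2). Since |u^2| = u sigma(u), the
    realisation of V is the image of the graph of sigma on V~ under a morphism, hence irreducible,
    and doubling the action of M = (N | P) on it gives the sum (N + P) V + (N - P) sigma(V).

    For the sum A V + B sigma(V), put (A | B) in echelon form: the lower rows only involve sigma(V)
    and give the base, the fibres contain translates of A V, so rotundity of V bounds the dimension
    below by rank(A | B). In case of equality simplicity of V forces rank A and rank B into {0, n}.
    If both equal n and the dimension is n, then the sum is invariant under translation by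
    differences of points of B sigma(V). As V is absolutely free these separate any two monomials in
    the multiplicative coordinates, so the sum contains the whole multiplicative part; but an
    additive coordinate is not constant on it either, so its dimension exceeds n. *)
Require Import Defs.
From HB Require Import structures.
From mathcomp Require Import all_boot all_order all_algebra.
From mathcomp Require Import mpoly.
From mathcomp Require Import ring zify.
From Stdlib Require Import Classical ClassicalEpsilon FunctionalExtensionality PropExtensionality.
Set Implicit Arguments. Unset Strict Implicit. Unset Printing Implicit Defensive.
Import Order.TTheory GRing.Theory Num.Theory.
Local Open Scope ring_scope.

(** * Polynomial evaluation *)

Section Evaluation.
Variable K : fieldType.

(** [K] may be algebraic over the rationals, so it need not contain generic points, and sigma is not
    algebraic. Independence is therefore tested on functions instead of at points: a variety is a
    type with a coordinate map, the pulled back polynomials form its function ring, integrality of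
    this ring stands for irreducibility, and the transcendence degree of the ring is the dimension
    of the closure of the image. Images, products, slices and the graph of sigma are then objects of
    one kind, none of which has to be closed.

    The modulus is a square root of w sigma(w), hence not a polynomial in w and sigma(w); this is
    what forces the passage to the cover. It costs nothing in dimension, because multiplication by 2
    in the group has finite fibres.

    The translation invariance of the extremal sum has a dimension-theoretic source: when A and B
    are both invertible and the sum has dimension n, every slice over a point of sigma(V) already
    has dimension n, so each slice is dense in the sum. Two slices are translates of each other,
    hence the translation preserves the ideal of the sum. *)

Lemma mpoly_ring_ind d (P : {mpoly K[d]} -> Prop) :
  (forall c, P c%:MP) -> (forall i, P 'X_i) ->
  (forall p q, P p -> P q -> P (p + q)) ->
  (forall p q, P p -> P q -> P (p * q)) -> forall p, P p.
Proof.
move=> PC PX PD PM; elim/mpolyind => [|c m p _ _ Pp]; first by rewrite -mpolyC0.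
apply: (PD) => //; rewrite -mul_mpolyC; apply: (PM) => //.
rewrite mpolyXE_id; elim/big_rec: _ => [|i q _ Pq]; first by rewrite -mpolyC1.
apply: (PM) => //; elim: (m i) => [|k IHk]; first by rewrite expr0 -mpolyC1.
by rewrite exprS; apply: PM.
Qed.

Definition fcons d (t : K) (b : 'I_d -> K) : 'I_d.+1 -> K :=
  fun i => oapp b t (unlift ord0 i).

Lemma fcons0 d t (b : 'I_d -> K) : fcons t b ord0 = t.
Proof. by rewrite /fcons unlift_none. Qed.

Lemma fconsS d t (b : 'I_d -> K) i : fcons t b (lift ord0 i) = b i.
Proof. by rewrite /fcons liftK. Qed.

Lemma fcons_eta d (x : 'I_d.+1 -> K) :
  fcons (x ord0) (fun i => x (lift ord0 i)) = x.
Proof.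
by apply: functional_extensionality => i; rewrite /fcons; case: unliftP => [j|] ->.
Qed.

Definition ev2 d (G : {poly {mpoly K[d]}}) (b : 'I_d -> K) (t : K) : K :=
  (map_poly (meval b) G).[t].

Lemma ev2D d (G H : {poly {mpoly K[d]}}) b t : ev2 (G + H) b t = ev2 G b t + ev2 H b t.
Proof. by rewrite /ev2 rmorphD hornerD. Qed.
Lemma ev2M d (G H : {poly {mpoly K[d]}}) b t : ev2 (G * H) b t = ev2 G b t * ev2 H b t.
Proof. by rewrite /ev2 rmorphM hornerM. Qed.
Lemma ev2N d (G : {poly {mpoly K[d]}}) b t : ev2 (- G) b t = - ev2 G b t.
Proof. by rewrite /ev2 rmorphN hornerN. Qed.
Lemma ev2B d (G H : {poly {mpoly K[d]}}) b t : ev2 (G - H) b t = ev2 G b t - ev2 H b t.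
Proof. by rewrite ev2D ev2N. Qed.
Lemma ev2C d (p : {mpoly K[d]}) b t : ev2 p%:P b t = p.@[b].
Proof. by rewrite /ev2 map_polyC hornerC. Qed.
Lemma ev2X d b t : ev2 ('X : {poly {mpoly K[d]}}) b t = t.
Proof. by rewrite /ev2 map_polyX hornerX. Qed.
Lemma ev2Z d (p : {mpoly K[d]}) G b t : ev2 (p *: G) b t = p.@[b] * ev2 G b t.
Proof. by rewrite -mul_polyC ev2M ev2C. Qed.
Lemma ev2Xn d b t n : ev2 ('X^n : {poly {mpoly K[d]}}) b t = t ^+ n.
Proof. by rewrite /ev2 map_polyXn hornerXn. Qed.

Lemma ev2E d (G : {poly {mpoly K[d]}}) b t :
  ev2 G b t = \sum_(i < size G) (G`_i).@[b] * t ^+ i.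
Proof.
rewrite /ev2 (horner_coef_wide _ (size_poly _ _)).
by apply: eq_bigr => i _; rewrite coef_map.
Qed.

Definition psubst m k (h : 'I_m -> {mpoly K[k]}) (p : {mpoly K[m]}) : {mpoly K[k]} :=
  mmap (@mpolyC k K) h p.

HB.instance Definition _ m k (h : 'I_m -> {mpoly K[k]}) :=
  GRing.RMorphism.copy (psubst h) (mmap (@mpolyC k K) h).

Lemma psubst_eval m k (h : 'I_m -> {mpoly K[k]}) p x :
  (psubst h p).@[x] = p.@[fun i => (h i).@[x]].
Proof.
rewrite [RHS]mevalE /psubst /mmap raddf_sum /=; apply: eq_bigr => mm _.
by rewrite mevalM mevalC /mmap1 rmorph_prod; congr (_ * _); apply: eq_bigr => i _; rewrite rmorphXn.
Qed.

(** The isomorphism from polynomials in t over K[x] to K[t, x], with t as variable [ord0]. Its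
    inverse is never written down; surjectivity supplies preimages. *)
Definition of_poly d (G : {poly {mpoly K[d]}}) : {mpoly K[d.+1]} :=
  (map_poly (psubst (fun j => 'X_(lift ord0 j))) G).['X_ord0].

Lemma of_poly_surj d (p : {mpoly K[d.+1]}) : exists G, of_poly G = p.
Proof.
pose h (j : 'I_d) : {mpoly K[d.+1]} := 'X_(lift ord0 j).
elim/mpoly_ring_ind: p => [c|i|p q [G <-] [H <-]|p q [G <-] [H <-]].
- by exists (c%:MP)%:P; rewrite /of_poly map_polyC hornerC /= /psubst mmapC.
- case: (unliftP ord0 i) => [j|] ->; last first.
    by exists 'X; rewrite /of_poly map_polyX hornerX.
  by exists ('X_j)%:P; rewrite /of_poly map_polyC hornerC /= /psubst mmapX mmap1U.
- by exists (G + H); rewrite /of_poly rmorphD hornerD.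
- by exists (G * H); rewrite /of_poly rmorphM hornerM.
Qed.

Lemma of_polyM d (G H : {poly {mpoly K[d]}}) : of_poly (G * H) = of_poly G * of_poly H.
Proof. by rewrite /of_poly rmorphM hornerM. Qed.

Lemma of_poly_eval d (G : {poly {mpoly K[d]}}) b t :
  (of_poly G).@[fcons t b] = ev2 G b t.
Proof.
rewrite /of_poly ev2E (horner_coef_wide _ (size_poly _ _)) raddf_sum /=.
apply: eq_bigr => i _; rewrite coef_map mevalM rmorphXn /= mevalXU fcons0; congr (_ * _).
by rewrite psubst_eval; apply: meval_eq => j; rewrite mevalXU fconsS.
Qed.

Lemma to_poly_eval d (p : {mpoly K[d.+1]}) :
  exists G, of_poly G = p /\ forall b t, ev2 G b t = p.@[fcons t b].
Proof. by have [G <-] := of_poly_surj p; exists G; split=> // b t; rewrite of_poly_eval. Qed.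

Hypothesis char0 : [pchar K] =i pred0.

Lemma natr_inj0 : injective (fun n : nat => n%:R : K).
Proof.
suff H a b : (a <= b)%N -> a%:R = b%:R :> K -> a = b.
  by move=> a b /= E; case/orP: (leq_total a b) => /H; [apply|move/(_ (esym E)) ->].
move=> ab E; have : (b - a)%:R == 0 :> K by rewrite natrB // E subrr.
by rewrite ((pcharf0P K).1 char0); lia.
Qed.

Lemma poly_nat_roots (p : {poly K}) : (forall n : nat, p.[n%:R] = 0) -> p = 0.
Proof.
move=> H; apply: (@roots_geq_poly_eq0 _ p [seq n%:R | n <- iota 0 (size p)]).
- by apply/allP => x /mapP [n _ ->]; rewrite rootE H.
- by rewrite map_inj_uniq ?iota_uniq //; exact: natr_inj0.
- by rewrite size_map size_iota.
Qed.

(** Natural numbers are infinitely many in characteristic 0 and are fixed by every automorphism; the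
    second property is what [conj_graph_zero] exploits. *)
Lemma mpoly_nat_zero d (p : {mpoly K[d]}) :
  (forall x : 'I_d -> nat, p.@[fun i => (x i)%:R] = 0) -> p = 0.
Proof.
elim: d p => [|d IH] p H.
  rewrite (nvar0_mpolyC p) in H *; have := H (fun=> 0%N).
  by rewrite mevalC => ->.
have [G [Ep EG]] := to_poly_eval p; rewrite -Ep.
suff -> : G = 0 by rewrite /of_poly rmorph0 horner0.
apply/polyP => i; rewrite coef0; apply: IH => x.
have : map_poly (meval (fun i => (x i)%:R)) G = 0.
  apply: poly_nat_roots => n; rewrite -/(ev2 _ _ _) EG.
  rewrite -[RHS](H (fun i => oapp x n (unlift ord0 i))).
  by apply: meval_eq => j; rewrite /fcons; case: unliftP.
by move/polyP/(_ i); rewrite coef_map coef0.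
Qed.

Lemma mpoly_zero d (p : {mpoly K[d]}) : (forall x, p.@[x] = 0) -> p = 0.
Proof. by move=> H; apply: mpoly_nat_zero => x; apply: H. Qed.

Lemma ev2_zero d (G : {poly {mpoly K[d]}}) : (forall b t, ev2 G b t = 0) -> G = 0.
Proof.
move=> H; apply/polyP => i; rewrite coef0; apply: mpoly_zero => x.
have : map_poly (meval x) G = 0 by apply: poly_nat_roots => n; apply: H.
by move/polyP/(_ i); rewrite coef_map coef0.
Qed.

Lemma of_poly_eq0 d (G : {poly {mpoly K[d]}}) : of_poly G = 0 -> G = 0.
Proof. by move=> E; apply: ev2_zero => b t; rewrite -of_poly_eval E meval0. Qed.

End Evaluation.

(** * Algebras of functions *)

Section FunctionAlgebras.
Variable K : fieldType.

Section OnType.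
Variable X : Type.
Implicit Types (A : (X -> K) -> Prop) (phi psi : X -> K).

(** Subrings of the ring of all functions on [X] play the role of coordinate rings, so quotients by
    ideals are avoided; [dom] below is integrality, expressed through values. *)
Record subalg A : Prop := Subalg {
  subalgC : forall c, A (fun=> c);
  subalgD : forall phi psi, A phi -> A psi -> A (fun x => phi x + psi x);
  subalgM : forall phi psi, A phi -> A psi -> A (fun x => phi x * psi x) }.

Definition dom A := forall phi psi, A phi -> A psi ->
  (forall x, phi x * psi x = 0) -> (forall x, phi x = 0) \/ (forall x, psi x = 0).

Definition polyfun d (F : X -> 'I_d -> K) phi :=
  exists p : {mpoly K[d]}, forall x, phi x = p.@[F x].

Definition alg_indep k (f : X -> 'I_k -> K) :=
  forall P : {mpoly K[k]}, (forall x, P.@[f x] = 0) -> P = 0.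

Definition trdeg_ge A k :=
  exists f : X -> 'I_k -> K, (forall i, A (fun x => f x i)) /\ alg_indep f.

(** Denominators are cleared, so the coefficients are polynomials in [g]. Nontriviality asks for a
    coefficient that is nonzero as a function on [X]: the members of [g] may be dependent, and a
    nonzero polynomial could vanish on them. *)
Definition algebraic_over m (g : X -> 'I_m -> K) phi :=
  exists R : {poly {mpoly K[m]}},
    (exists i x, (R`_i).@[g x] != 0) /\ forall x, ev2 R (g x) (phi x) = 0.

Lemma subalg_eval A : subalg A -> forall d (F : X -> 'I_d -> K),
  (forall i, A (fun x => F x i)) -> forall p : {mpoly K[d]}, A (fun x => p.@[F x]).
Proof.
move=> sA d F AF; elim/mpoly_ring_ind => [c|i|p q Ap Aq|p q Ap Aq].
- by have := subalgC sA c; congr A; apply: functional_extensionality => x; rewrite mevalC.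
- by have := AF i; congr A; apply: functional_extensionality => x; rewrite mevalXU.
- by have := subalgD sA Ap Aq; congr A; apply: functional_extensionality => x; rewrite mevalD.
- by have := subalgM sA Ap Aq; congr A; apply: functional_extensionality => x; rewrite mevalM.
Qed.

Lemma polyfun_sub A d (F : X -> 'I_d -> K) phi : subalg A ->
  (forall i, A (fun x => F x i)) -> polyfun F phi -> A phi.
Proof.
move=> sA AF [p Ep]; have := subalg_eval sA AF p.
by congr A; apply: functional_extensionality.
Qed.

Lemma subalg_polyfun d (F : X -> 'I_d -> K) : subalg (polyfun F).
Proof.
split=> [c|phi psi [p Ep] [q Eq]|phi psi [p Ep] [q Eq]].
- by exists c%:MP => x; rewrite mevalC.
- by exists (p + q) => x; rewrite mevalD Ep Eq.
- by exists (p * q) => x; rewrite mevalM Ep Eq.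
Qed.

Lemma polyfun_coord d (F : X -> 'I_d -> K) i : polyfun F (fun x => F x i).
Proof. by exists 'X_i => x; rewrite mevalXU. Qed.

Lemma polyfun_eval d (F : X -> 'I_d -> K) p : polyfun F (fun x => p.@[F x]).
Proof. by exists p. Qed.

Lemma trdeg_ge_sub A A' k : (forall phi, A phi -> A' phi) -> trdeg_ge A k -> trdeg_ge A' k.
Proof. by move=> AA' [f [Af aif]]; exists f; split=> // i; apply: AA'. Qed.

Definition fspan (I : finType) (b : I -> X -> K) phi :=
  exists c : I -> K, forall x, phi x = \sum_i c i * b i x.

Lemma fspan_lin_dep (I J : finType) (v : I -> X -> K) (w : J -> X -> K) :
  (forall i, fspan w (v i)) -> (#|J| < #|I|)%N ->
  exists c : I -> K, (exists i, c i != 0) /\ forall x, \sum_i c i * v i x = 0.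
Proof.
move=> /choice [C EC] ltJI.
pose M := \matrix_(i < #|I|, j < #|J|) C (enum_val i) (enum_val j).
have /rowV0Pn [u /sub_kermxP uM /rV0Pn [i0 ui0]] : kermx M != 0.
  rewrite -mxrank_eq0 mxrank_ker -lt0n subn_gt0.
  by apply: leq_ltn_trans ltJI; apply: rank_leq_col.
exists (fun i => u 0 (enum_rank i)); split.
  by exists (enum_val i0); rewrite enum_valK.
move=> x; under eq_bigr => i _ do rewrite EC mulr_sumr.
rewrite exchange_big /= big1 // => j _.
have : (u *m M) 0 (enum_rank j) = 0 by rewrite uM mxE.
rewrite mxE (reindex_onto enum_rank enum_val) /=; last by move=> i _; rewrite enum_valK.
under eq_bigl => i do rewrite enum_rankK eqxx.
under eq_bigr => i _ do rewrite mxE !enum_rankK.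
move=> /(congr1 (fun z => z * w j x)); rewrite mul0r mulr_suml => E.
by rewrite -[RHS]E; apply: eq_bigr => i _; rewrite mulrA.
Qed.

Lemma fspan_big (I J : finType) (w : J -> X -> K) (c : I -> K) (v : I -> X -> K) :
  (forall i, fspan w (v i)) -> fspan w (fun x => \sum_i c i * v i x).
Proof.
move=> /choice [C EC]; exists (fun j => \sum_i c i * C i j) => x.
under eq_bigr => i _ do rewrite EC mulr_sumr.
rewrite exchange_big; apply: eq_bigr => j _ /=.
by rewrite mulr_suml; apply: eq_bigr => i _; rewrite mulrA.
Qed.

Lemma fspan_seq (J : finType) (w : J -> X -> K) (I : eqType) (r : seq I) (v : I -> X -> K) :
  (forall i, i \in r -> fspan w (v i)) -> fspan w (fun x => \sum_(i <- r) v i x).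
Proof.
elim: r => [|i r IH] H.
  by exists (fun=> 0) => x; rewrite big_nil big1 // => j _; rewrite mul0r.
have [c Ec] := H i (mem_head _ _).
have [|c' Ec'] := IH; first by move=> j jr; apply: H; rewrite inE jr orbT.
exists (fun j => c j + c' j) => x; rewrite big_cons Ec Ec' -big_split /=.
by apply: eq_bigr => j _; rewrite mulrDl.
Qed.

Lemma fspanZ (J : finType) (w : J -> X -> K) c phi :
  fspan w phi -> fspan w (fun x => c * phi x).
Proof.
by case=> C EC; exists (fun j => c * C j) => x; rewrite EC mulr_sumr; apply: eq_bigr => j _; rewrite mulrA.
Qed.

Lemma fspanD (J : finType) (w : J -> X -> K) phi psi :
  fspan w phi -> fspan w psi -> fspan w (fun x => phi x + psi x).
Proof.
move=> [c Ec] [c' Ec']; exists (fun j => c j + c' j) => x; rewrite Ec Ec' -big_split /=.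
by apply: eq_bigr => j _; rewrite mulrDl.
Qed.

Lemma fspan_gen (J : finType) (w : J -> X -> K) j : fspan w (w j).
Proof.
exists (fun i => (i == j)%:R) => x; rewrite (bigD1 j) //= eqxx mul1r big1 ?addr0 //.
by move=> i /negPf ->; rewrite mul0r.
Qed.

End OnType.

(** A leading coefficient that vanishes identically on [X] can be cut off without changing any value
    of the relation; this stops at the latest at the coefficient known to be nonzero. *)
Lemma algebraic_over_monic_rel (X : Type) m (g : X -> 'I_m -> K) phi :
  algebraic_over g phi -> exists e (a : {mpoly K[m]}) (r : nat -> {mpoly K[m]}),
    [/\ exists x, a.@[g x] != 0 &
     forall x, a.@[g x] * phi x ^+ e = \sum_(l < e) (r l).@[g x] * phi x ^+ l].
Proof.
case=> R; elim: {R}(size R) {-2}R (leqnn (size R)) => [|n IH] R szR [[i [x Rx]] ER].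
  by move: Rx; move/size_poly_leq0P: szR => ->; rewrite coef0 meval0 eqxx.
case: (classic (exists x, (R`_n).@[g x] != 0)) => [Rn|Rn].
  exists n, (R`_n), (fun l => - R`_l); split=> // y.
  have := ER y; rewrite /ev2 (@horner_coef_wide _ n.+1) ?(leq_trans (size_poly _ _)) //.
  rewrite big_ord_recr /= coef_map => E.
  rewrite -[LHS]subr0 -[X in _ - X]E opprD addrCA subrr addr0 -sumrN.
  by apply: eq_bigr => l _; rewrite coef_map mevalN mulNr.
have Rn0 y : (R`_n).@[g y] = 0.
  by apply/eqP/negPn/negP => H; apply: Rn; exists y.
apply: (IH (take_poly n R)); first exact: size_take_poly.
split.
  exists i, x; rewrite coef_take_poly; case: ltngtP => // [ni|ni].
    by move: Rx; rewrite nth_default ?meval0 ?eqxx // (leq_trans szR).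
  by move: Rx; rewrite ni Rn0 eqxx.
move=> y; rewrite -(ER y) /ev2 (@horner_coef_wide _ n); last first.
  exact: leq_trans (size_poly _ _) (size_take_poly _ _).
rewrite (@horner_coef_wide _ n.+1 (map_poly _ R)) ?(leq_trans (size_poly _ _)) //.
rewrite big_ord_recr /= [in RHS]coef_map /= Rn0 mul0r addr0.
by apply: eq_bigr => l _; rewrite !coef_map coef_take_poly ltn_ord.
Qed.

End FunctionAlgebras.

(** * The exchange theorem *)

Section Exchange.
Variables (K : fieldType) (X : Type).
Implicit Types (phi psi : X -> K).

Lemma fspan_ext (J : finType) (w : J -> X -> K) phi psi :
  phi =1 psi -> fspan w phi -> fspan w psi.
Proof. by move=> E [c Ec]; exists c => x; rewrite -E Ec. Qed.

Lemma fspan_mul (I J : finType) (v : I -> X -> K) (w : J -> X -> K) (u : X -> K) phi :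
  (forall i, fspan w (fun x => u x * v i x)) -> fspan v phi ->
  fspan w (fun x => u x * phi x).
Proof.
move=> H [c Ec]; apply: fspan_ext (fspan_big c H) => x /=.
by rewrite Ec mulr_sumr; apply: eq_bigr => i _; rewrite mulrCA.
Qed.

Variables (A : (X -> K) -> Prop) (sA : subalg A) (dA : dom A).

Lemma dom_prod (I : finType) m (g : X -> 'I_m -> K) (a : I -> {mpoly K[m]}) :
  (forall i, A (fun x => g x i)) -> X -> 
  (forall i, exists x, (a i).@[g x] != 0) -> exists x, (\prod_i a i).@[g x] != 0.
Proof.
move=> Ag x0 Ha; elim/big_rec: _ => [|i p _ [y py]].
  by exists x0; rewrite meval1 oner_eq0.
apply: NNPP => H; have [|E|E] := dA (subalg_eval sA Ag (a i)) (subalg_eval sA Ag p).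
- move=> x; rewrite -mevalM; apply/eqP/negPn/negP => Hx; apply: H; by exists x.
- by have [x] := Ha i; rewrite E eqxx.
- by move: py; rewrite E eqxx.
Qed.

Variables (m : nat) (g : X -> 'I_m -> K) (Ag : forall i, A (fun x => g x i)).
Variables (d : nat) (h : X -> 'I_d -> K).
Hypothesis Ah : forall j, A (fun x => h x j).
Hypothesis hg : forall j, algebraic_over g (fun x => h x j).

(** Multiplying the relation of [h j] by the other leading coefficients and by a power of [h j]
    gives all relations the same leading coefficient and degree. The degree is a successor so that
    reduced exponents are at most [E]. *)
Lemma common_monic_rel : X -> exists E (a : {mpoly K[m]}) (r : 'I_d -> nat -> {mpoly K[m]}),
  (exists x, a.@[g x] != 0) /\
  forall j x, a.@[g x] * h x j ^+ E.+1 = \sum_(l < E.+1) (r j l).@[g x] * h x j ^+ l.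
Proof.
move=> x0.
have /choice [e /choice [a /choice [r Hr]]] := fun j => algebraic_over_monic_rel (hg j).
exists (\max_j e j)%N, (\prod_j a j).
exists (fun j l => if ((\max_j e j).+1 - e j <= l)%N then
  (\prod_(i | i != j) a i) * r j (l - ((\max_j e j).+1 - e j))%N else 0).
split; first by apply: dom_prod => // j; have [] := Hr j.
move=> j x; set M := (\max_j e j)%N.
have ej : (e j <= M)%N by apply: leq_bigmax.
set D := (M.+1 - e j)%N; have ED : M.+1 = (D + e j)%N by rewrite subnK // leqW.
rewrite (bigD1 j) //= mevalM.
rewrite ED big_split_ord /= [X in _ = X + _]big1 ?add0r => [|i _]; last first.
  by rewrite leqNgt ltn_ord meval0 mul0r.
have [_ Hx] := Hr j; rewrite exprD.
under [RHS]eq_bigr => i _ do rewrite leq_addr addKn mevalM exprD.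
transitivity ((\prod_(i | i != j) a i).@[g x] * h x j ^+ D * ((a j).@[g x] * h x j ^+ e j)).
  by ring.
by rewrite Hx mulr_sumr; apply: eq_bigr => i _; ring.
Qed.

(** * Growth of spans of monomials modulo algebraic relations *)

Section Counting.
Variables (E : nat) (a : {mpoly K[m]}) (r : 'I_d -> nat -> {mpoly K[m]}).
Hypothesis rel : forall j x,
  a.@[g x] * h x j ^+ E.+1 = \sum_(l < E.+1) (r j l).@[g x] * h x j ^+ l.
Variable B : nat.
Hypotheses (szr : forall j l, (l < E.+1)%N -> (msize (r j l) <= B)%N) (sza : (msize a <= B)%N).

Definition mon (b : 'I_m -> nat) (c : 'I_d -> nat) (x : X) : K :=
  (\prod_i g x i ^+ b i) * (\prod_j h x j ^+ c j).

Definition bas L (bc : {ffun 'I_m -> 'I_L.+1} * {ffun 'I_d -> 'I_E.+1}) : X -> K :=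
  mon (fun i => bc.1 i) (fun j => bc.2 j).

Lemma fspan_mon L b c : (forall i, b i <= L)%N -> (forall j, c j <= E)%N ->
  fspan (@bas L) (mon b c).
Proof.
move=> bL cE; apply: fspan_ext (fspan_gen _ ([ffun i => inord (b i)], [ffun j => inord (c j)])).
move=> x; rewrite /bas /mon /=; congr (_ * _); apply: eq_bigr => i _.
  by rewrite ffunE inordK ?ltnS.
by rewrite ffunE inordK ?ltnS.
Qed.

Lemma fspan_mul_poly_mon (p : {mpoly K[m]}) L b c : (msize p <= B)%N ->
  (forall i, b i <= L)%N -> (forall j, c j <= E)%N ->
  fspan (@bas (L + B)) (fun x => p.@[g x] * mon b c x).
Proof.
move=> szp bL cE.
apply: (@fspan_ext _ _ (fun x => \sum_(mu <- msupp p) p@_mu * mon (fun i => (mu i + b i)%N) c x)).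
  move=> x; rewrite mevalE mulr_suml; apply: eq_bigr => mu _.
  rewrite -mulrA /mon; congr (_ * _); rewrite mulrA; congr (_ * _).
  by rewrite -big_split; apply: eq_bigr => i _; rewrite exprD.
apply: fspan_seq => mu mup; apply: fspanZ; apply: fspan_mon => // i.
rewrite addnC leq_add //.
have := msize_mdeg_lt mup; rewrite mdegE (bigD1 i) //=; lia.
Qed.

Lemma fspan_mul_a L phi : fspan (@bas L) phi ->
  fspan (@bas (L + B)) (fun x => a.@[g x] * phi x).
Proof.
apply: fspan_mul => -[b c]; apply: fspan_mul_poly_mon => //= i.
  by rewrite -ltnS ltn_ord.
by rewrite -ltnS ltn_ord.
Qed.

(** An exponent of [h j] below [E] is simply raised; at [E] the factor [a] allows the relation to
    rewrite the power by lower ones, whose coefficients in [g] cost at most [B] in the exponents. *)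
Lemma fspan_mul_h j L phi : fspan (@bas L) phi ->
  fspan (@bas (L + B)) (fun x => a.@[g x] * h x j * phi x).
Proof.
have mon_h b (c c' : 'I_d -> nat) l x : (forall i, c' i = if i == j then c i + l else c i)%N ->
    mon b c x * h x j ^+ l = mon b c' x.
  move=> c'E; rewrite /mon -mulrA; congr (_ * _).
  rewrite (bigD1 j) //= [RHS](bigD1 j) //= c'E eqxx exprD mulrAC; congr (_ * _).
  by apply: eq_bigr => i /negPf ij; rewrite c'E ij.
apply: fspan_mul => -[b c]; have bL i : (b i <= L)%N by rewrite -ltnS ltn_ord.
have cE i : (c i <= E)%N by rewrite -ltnS ltn_ord.
case: (ltngtP (c j) E) (cE j) => // [cj _|cj _].
  apply: fspan_ext (@fspan_mul_poly_mon a L (fun i => b i)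
    (fun i => if i == j then (c i).+1 else c i) sza bL _) => [x|i] /=.
    rewrite -mulrA [h x j * _]mulrC -[h x j]expr1; congr (_ * _).
    by rewrite /bas /=; apply/esym/mon_h => i; rewrite addn1.
  by case: eqP => [->|].
pose cl (l : nat) (i : 'I_d) : nat := if i == j then l else c i.
pose v (l : 'I_E.+1) x := (r j l).@[g x] * mon (fun i => b i) (cl l) x.
apply: (@fspan_ext _ _ (fun x => \sum_(l <- enum 'I_E.+1) v l x)).
  move=> x; rewrite big_enum /=.
  have -> : bas (b, c) x = mon (fun i => b i) (cl 0%N) x * h x j ^+ E.
    rewrite (mon_h _ _ (fun i => c i)) // => i; rewrite /cl; case: eqP => [->|] //.
  transitivity (mon (fun i => b i) (cl 0%N) x * (a.@[g x] * h x j ^+ E.+1)); last by rewrite exprS; ring.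
  rewrite rel mulr_sumr; apply: eq_bigr => l _.
  by rewrite [RHS]mulrCA; congr (_ * _); apply: esym; apply: mon_h => i; rewrite /cl; case: eqP.
apply: (fspan_seq (v := v)) => l _; apply: fspan_mul_poly_mon => // [|i]; first exact: szr.
by rewrite /cl; case: eqP => // _; rewrite -ltnS ltn_ord.
Qed.

(** A filtration degree for functions of [h]: it is subadditive under products, so the cost of a
    monomial grows linearly with its exponents. This linear growth drives the dimension count. *)
Definition ordB (u : X -> K) delta := forall L phi, fspan (@bas L) phi ->
  fspan (@bas (L + delta * B)) (fun x => a.@[g x] ^+ delta * u x * phi x).

Lemma ordB_a u D n : ordB u D -> ordB u (D + n).
Proof.
elim: n => [|n IH] Hu; first by rewrite addn0.
move=> L phi Hphi; have := fspan_mul_a (IH Hu _ _ Hphi).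
rewrite addnS mulSnr addnA; apply: fspan_ext => x; rewrite exprS; ring.
Qed.

Lemma ordB_mul u v D D' : ordB u D -> ordB v D' -> ordB (fun x => u x * v x) (D + D').
Proof.
move=> Hu Hv L phi Hphi; have := Hu _ _ (Hv _ _ Hphi).
have -> : (L + (D + D') * B = L + D' * B + D * B)%N by rewrite mulnDl; lia.
by apply: fspan_ext => x; rewrite exprD; ring.
Qed.

Lemma ordB_add u v D : ordB u D -> ordB v D -> ordB (fun x => u x + v x) D.
Proof.
by move=> Hu Hv L phi Hphi; apply: fspan_ext (fspanD (Hu _ _ Hphi) (Hv _ _ Hphi)) => x; ring.
Qed.

Lemma ordB_poly (p : {mpoly K[d]}) : exists D, ordB (fun x => p.@[h x]) D.
Proof.
elim/mpoly_ring_ind: p => [c|i|p q [D Hp] [D' Hq]|p q [D Hp] [D' Hq]].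
- exists 0%N => L phi Hphi; rewrite addn0.
  by apply: fspan_ext (fspanZ c Hphi) => x; rewrite mevalC mul1r.
- exists 1%N => L phi Hphi; rewrite mul1n; apply: fspan_ext (fspan_mul_h i Hphi) => x.
  by rewrite mevalXU expr1.
- exists (D + D')%N => L phi Hphi.
  have Hq' : ordB (fun x => q.@[h x]) (D + D') by rewrite addnC; apply: ordB_a.
  by apply: fspan_ext (ordB_add (ordB_a D' Hp) Hq' Hphi) => x; rewrite mevalD.
- exists (D + D')%N => L phi Hphi; apply: fspan_ext (ordB_mul Hp Hq Hphi) => x.
  by rewrite mevalM.
Qed.

Lemma ordB_exp u D n : ordB u D -> ordB (fun x => u x ^+ n) (n * D).
Proof.
move=> Hu; elim: n => [|n IH].
  by move=> L phi Hphi; rewrite addn0; apply: fspan_ext Hphi => x; rewrite !expr0 !mul1r.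
rewrite mulSn => L phi Hphi; apply: fspan_ext (ordB_mul Hu IH Hphi) => x; by rewrite exprS.
Qed.

Lemma ordB_prod (I : Type) (s : seq I) (u : I -> X -> K) D : (forall i, ordB (u i) D) ->
  ordB (fun x => \prod_(i <- s) u i x) (size s * D).
Proof.
move=> Hu; elim: s => [|i s IH].
  by move=> L phi Hphi; rewrite addn0; apply: fspan_ext Hphi => x; rewrite expr0 big_nil !mul1r.
move=> L phi Hphi; apply: fspan_ext (ordB_mul (Hu i) IH Hphi) => x.
by rewrite big_cons.
Qed.

Lemma monomial_in_span k (f : X -> 'I_k -> K) : (forall i, polyfun h (fun x => f x i)) ->
  exists D, forall n (al : 'I_k -> nat), (forall i, al i <= n)%N ->
  fspan (@bas (n * D * B)) (fun x => a.@[g x] ^+ (n * D) * \prod_i f x i ^+ al i).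
Proof.
move=> /choice [p Ep]; have /choice [D0 HD0] := fun i => ordB_poly (p i).
pose D := (\sum_i D0 i)%N; have HD i : ordB (fun x => f x i) D.
  have := ordB_a (D - D0 i) (HD0 i); rewrite subnKC; last first.
    by rewrite /D (bigD1 i) //= leq_addr.
  by move=> H L phi Hphi; apply: fspan_ext (H _ _ Hphi) => x; rewrite Ep.
exists (k * D)%N => n al aln.
have H1 i : ordB (fun x => f x i ^+ al i) (n * D).
  have := ordB_a ((n - al i) * D) (ordB_exp (al i) (HD i)).
  by rewrite -mulnDl subnKC.
have := ordB_prod (enum 'I_k) H1; rewrite size_enum_ord mulnCA.
have H0 : fspan (@bas 0) (fun=> 1).
  have := @fspan_mon 0 (fun=> 0)%N (fun=> 0)%N (fun=> leqnn _) (fun=> leq0n _).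
  apply: fspan_ext => x; by rewrite /mon !big1 ?mulr1.
move=> /(_ _ _ H0); by rewrite add0n; apply: fspan_ext => x; rewrite mulr1 big_enum.
Qed.

End Counting.

(* Multiplying the monomials f^al, al in a box of side N, by a common power of a denominator puts
   N^(m+1) functions into a space of dimension O(N^m). *)
Theorem alg_dependent_of_algebraic (f : X -> 'I_m.+1 -> K) :
  (forall i, polyfun h (fun x => f x i)) -> ~ alg_indep f.
Proof.
move=> fh aif; case: (classic (inhabited X)) => [[x0]|X0]; last first.
  by have /eqP := aif 1 (fun x => False_ind _ (X0 (inhabits x))); rewrite oner_eq0.
have [E [a [r [[x1 ax1] rel]]]] := common_monic_rel x0.
pose B := (msize a + \sum_j \sum_(l < E.+1) msize (r j l))%N.
have sza : (msize a <= B)%N by rewrite leq_addr.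
have szr j l : (l < E.+1)%N -> (msize (r j l) <= B)%N.
  move=> lE; rewrite /B (bigD1 j) //= (bigD1 (Ordinal lE)) //=; lia.
have [D HD] := monomial_in_span rel szr sza fh.
(* [Q] makes N * D * B + 1 at most N * Q, so the span has dimension at most (N * Q)^m * (E+1)^d; [N]
   exceeds Q^m * (E+1)^d, so this is less than N^(m+1). *)
pose Q := (D * B).+1; pose N := (Q ^ m * E.+1 ^ d).+1.
pose v (al : {ffun 'I_m.+1 -> 'I_N}) x := a.@[g x] ^+ (N * D) * \prod_i f x i ^+ al i.
have Hv al : fspan (@bas E (N * D * B)) (v al).
  by apply: HD => i; rewrite ltnW.
have [|c [[al0 cal0] Hc]] := fspan_lin_dep Hv.
  rewrite card_prod !card_ffun !card_ord.
  apply: (@leq_ltn_trans ((N * Q) ^ m * E.+1 ^ d)%N).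
    have le_exp k a1 a2 : (a1 <= a2)%N -> (a1 ^ k <= a2 ^ k)%N.
      by move=> le12; elim: k => // k IH; rewrite !expnS leq_mul.
    by rewrite leq_mul2r le_exp ?orbT // /Q mulnS -mulnA -add1n leq_add2r.
  rewrite expnMn -mulnA mulnC expnS ltn_mul2r expn_gt0 /=.
  by rewrite /N ltnS leqnn.
pose P : {mpoly K[m.+1]} := \sum_al c al *: 'X_[[multinom (al i : nat) | i < m.+1]].
have PE x : P.@[f x] = \sum_al c al * \prod_i f x i ^+ al i.
  rewrite /P raddf_sum; apply: eq_bigr => al _; rewrite /= mevalZ mevalX; congr (_ * _).
  by apply: eq_bigr => i _; rewrite mnmE.
have [| | |aN0|P0] := dA (_ : A (fun x => a.@[g x] ^+ (N * D))) (_ : A (fun x => P.@[f x])).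
- have := subalg_eval sA Ag (a ^+ (N * D)); congr A; apply: functional_extensionality => x.
  by rewrite rmorphXn.
- apply: subalg_eval => // i; exact: polyfun_sub (fh i).
- by move=> x; rewrite PE mulr_sumr -[RHS](Hc x); apply: eq_bigr => al _; rewrite /v mulrCA.
- by have /eqP := aN0 x1; rewrite expf_eq0 (negPf ax1) andbF.
have P0' := aif _ P0; move: cal0.
suff -> : c al0 = P@_[multinom (al0 i : nat) | i < m.+1] by rewrite P0' mcoeff0 eqxx.
rewrite /P raddf_sum /= (bigD1 al0) //= mcoeffZ mcoeffX eqxx mulr1 big1 ?addr0 //.
move=> al /negPf ne; rewrite mcoeffZ mcoeffX; case: eqP => [E1|]; last by rewrite mulr0.
suff E2 : al = al0 by rewrite E2 eqxx in ne.
apply/ffunP => i; apply: val_inj; have := congr1 (fun mu : 'X_{1..m.+1} => mu i) E1.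
by rewrite !mnmE.
Qed.

End Exchange.

(** * Transcendence degree *)

Section TranscendenceDegree.
Variable K : fieldType.
Hypothesis char0 : [pchar K] =i pred0.

Lemma alg_indep_inhabited (X : Type) k (f : X -> 'I_k -> K) : alg_indep f -> inhabited X.
Proof.
move=> aif; apply: NNPP => X0.
by have /eqP := aif 1 (fun x => False_ind _ (X0 (inhabits x))); rewrite oner_eq0.
Qed.

Lemma trdeg_ge_inhabited (X : Type) (A : (X -> K) -> Prop) k : trdeg_ge A k -> inhabited X.
Proof. by case=> f [_ /alg_indep_inhabited]. Qed.

Lemma trdeg_ge0 (X : Type) (A : (X -> K) -> Prop) : inhabited X -> trdeg_ge A 0.
Proof.
case=> x0; exists (fun _ _ => 0); split=> [[]//|P HP].
by rewrite (nvar0_mpolyC P); have := HP x0; rewrite {1}(nvar0_mpolyC P) mevalC => ->.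
Qed.

Lemma trdeg_geS (X : Type) (A : (X -> K) -> Prop) k : trdeg_ge A k.+1 -> trdeg_ge A k.
Proof.
case=> f [Af aif]; exists (fun x i => f x (lift ord0 i)); split=> [i|P HP]; first exact: Af.
have E : of_poly (P%:P) = 0.
  by apply: aif => x; rewrite -(fcons_eta (f x)) of_poly_eval ev2C HP.
by apply: polyC_inj; rewrite (of_poly_eq0 char0 E) polyC0.
Qed.

Lemma trdeg_ge_le (X : Type) (A : (X -> K) -> Prop) j k :
  (j <= k)%N -> trdeg_ge A k -> trdeg_ge A j.
Proof.
by move/subnK <-; elim: (k - j)%N => // n IH; rewrite addSn => /trdeg_geS.
Qed.

Lemma not_alg_indep_fcons (X : Type) k (g : X -> 'I_k -> K) phi :
  ~ alg_indep (fun x => fcons (phi x) (g x)) ->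
  exists G : {poly {mpoly K[k]}}, G <> 0 /\ forall x, ev2 G (g x) (phi x) = 0.
Proof.
move=> H; apply: NNPP => HG; apply: H => P HP.
have [G EG] := of_poly_surj P; case: (classic (G = 0)) => [G0|G0].
  by rewrite -EG G0 /of_poly rmorph0 horner0.
by case: HG; exists G; split=> // x; rewrite -of_poly_eval EG HP.
Qed.

Lemma algebraic_over_of_dependent (X : Type) k (g : X -> 'I_k -> K) phi :
  alg_indep g -> ~ alg_indep (fun x => fcons (phi x) (g x)) -> algebraic_over g phi.
Proof.
move=> aig /not_alg_indep_fcons [G [G0 HG]].
exists G; split=> //; apply: NNPP => H; apply: G0; apply/polyP => i; rewrite coef0.
by apply: aig => x; apply/eqP/negPn/negP => Hx; apply: H; exists i, x.
Qed.

Lemma algebraic_over_of_max (X : Type) (A : (X -> K) -> Prop) k (g : X -> 'I_k -> K) phi :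
  ~ trdeg_ge A k.+1 -> (forall i, A (fun x => g x i)) -> alg_indep g -> A phi ->
  algebraic_over g phi.
Proof.
move=> mx Ag aig Aphi; apply: algebraic_over_of_dependent => // ai; apply: mx.
exists (fun x => fcons (phi x) (g x)); split=> // i.
by rewrite /fcons; case: unliftP => [j _|_] /=; [exact: Ag|exact: Aphi].
Qed.

Lemma poly_X_factor d (G : {poly {mpoly K[d]}}) : G <> 0 ->
  exists e (G' : {poly {mpoly K[d]}}), G = 'X^e * G' /\ G'`_0 <> 0.
Proof.
elim: {G}(size G) {-2}G (leqnn (size G)) => [|n IH] G szG G0.
  by case: G0; apply/eqP; rewrite -size_poly_leq0.
case: (eqVneq G`_0 0) => [E|]; last by move/eqP=> E; exists 0%N, G; rewrite expr0 mul1r.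
have EG : G = drop_poly 1 G * 'X.
  rewrite -{1}(poly_take_drop 1 G) expr1 (_ : take_poly 1 G = 0) ?add0r //.
  apply/polyP => i; rewrite coef_take_poly coef0; case: i => //.
have [||e [G' [E' HG']]] := IH (drop_poly 1 G).
- by rewrite size_drop_poly; lia.
- by move=> H; apply: G0; rewrite EG H mul0r.
by exists e.+1, G'; split=> //; rewrite {1}EG E' exprSr; ring.
Qed.

Lemma ev2_subalg (X : Type) (A : (X -> K) -> Prop) d (f : X -> 'I_d -> K) phi G :
  subalg A -> (forall i, A (fun x => f x i)) -> A phi -> A (fun x => ev2 G (f x) (phi x)).
Proof.
move=> sA Af Aphi; have := @subalg_eval _ _ _ sA _ (fun x => fcons (phi x) (f x)) _ (of_poly G).
move=> H; have := H _; under [fun x => (of_poly _).@[_]]functional_extensionality => x do rewrite of_poly_eval.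
apply=> i; rewrite /fcons; case: unliftP => [j _|_] /=; [exact: Af|exact: Aphi].
Qed.

(* A relation for (phi, f) on [X] may be divided by powers of phi, and then restricts to a relation
   for f on [Y]. *)
Lemma alg_indep_fcons (X Y : Type) (iota : Y -> X) (A : (X -> K) -> Prop) d
    (f : X -> 'I_d -> K) phi :
  subalg A -> dom A -> (forall i, A (fun x => f x i)) -> A phi ->
  alg_indep (fun y => f (iota y)) -> (forall y, phi (iota y) = 0) -> ~ (forall x, phi x = 0) ->
  alg_indep (fun x => fcons (phi x) (f x)).
Proof.
move=> sA dA Af Aphi aif phi0 phin0; apply: NNPP => /not_alg_indep_fcons [G [G0 HG]].
have [e [G' [EG G'0]]] := poly_X_factor G0.
have AX : A (fun x => phi x ^+ e).
  have := ev2_subalg 'X^e sA Af Aphi; congr A.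
  by apply: functional_extensionality => x; rewrite ev2Xn.
have [x|H|H] := dA _ _ AX (ev2_subalg G' sA Af Aphi).
- by rewrite -(ev2Xn (f x)) -ev2M -EG HG.
- by apply: phin0 => x; apply/eqP; have /eqP := H x; rewrite expf_eq0 => /andP [].
apply: G'0; apply: aif => y; rewrite -[RHS](H (iota y)) phi0.
by rewrite /ev2 horner_coef0 coef_map.
Qed.

Lemma algebraic_over_coord (X : Type) d (F : X -> 'I_d -> K) j : X ->
  algebraic_over F (fun x => F x j).
Proof.
move=> x0; exists ('X - ('X_j)%:P); split=> [|x]; last by rewrite ev2B ev2X ev2C mevalXU subrr.
by exists 1%N, x0; rewrite coefB coefX coefC subr0 meval1 oner_eq0.
Qed.

Lemma trdeg_polyfun_bound (X : Type) d (F : X -> 'I_d -> K) :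
  dom (polyfun F) -> ~ trdeg_ge (polyfun F) d.+1.
Proof.
move=> dF tr; have [x0] := trdeg_ge_inhabited tr; case: tr => f [Af].
apply: (alg_dependent_of_algebraic (subalg_polyfun F) dF (polyfun_coord F) (polyfun_coord F)) => //.
by move=> j; apply: algebraic_over_coord.
Qed.

Lemma trdeg_max (X : Type) (A : (X -> K) -> Prop) d : inhabited X -> ~ trdeg_ge A d.+1 ->
  exists e, trdeg_ge A e /\ ~ trdeg_ge A e.+1.
Proof.
move=> X0; elim: d => [|d IH] H; first by exists 0%N; split=> //; apply: trdeg_ge0.
by case: (classic (trdeg_ge A d.+1)) => H1; [exists d.+1|apply: IH].
Qed.

(** The reciprocal polynomial, with the coefficients in reverse order, annihilates the inverse. *)
Lemma algebraic_over_inv (X : Type) k (g : X -> 'I_k -> K) phi :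
  (forall x, phi x != 0) -> algebraic_over g phi -> algebraic_over g (fun x => (phi x)^-1).
Proof.
move=> phi0 [R [[i [x Rx]] HR]].
have ilt : (i < size R)%N.
  by rewrite ltnNge; apply: contra Rx => H; rewrite nth_default // meval0.
exists (\poly_(l < size R) R`_(size R - l.+1)); split.
  exists (size R - i.+1)%N, x; rewrite coef_poly ifT; last lia.
  by rewrite (_ : (size R - (size R - i.+1).+1)%N = i) //; lia.
move=> y; apply: (mulfI (expf_neq0 (size R).-1 (phi0 y))); rewrite mulr0 -[RHS](HR y).
rewrite /ev2 (@horner_coef_wide _ (size R)) ?(leq_trans (size_poly _ _)) ?size_poly //.
rewrite (@horner_coef_wide _ (size R) (map_poly _ R)) ?size_poly // mulr_sumr.
rewrite (reindex_inj rev_ord_inj) /=; apply: eq_bigr => l _.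
rewrite !coef_map coef_poly ifT /=; last by case: l => l /= ?; lia.
rewrite mulrCA; congr (_.@[_] * _).
  by congr (_`_ _); case: l => l /= ?; lia.
apply: (mulIf (expf_neq0 (size R - l.+1) (phi0 y))); rewrite -mulrA -exprMn mulVf // expr1n mulr1 -exprD.
by congr (_ ^+ _); case: l => l /= ?; lia.
Qed.

Lemma algebraic_over_root (X : Type) k (g : X -> 'I_k -> K) phi c : (0 < c)%N ->
  algebraic_over g (fun x => phi x ^+ c) -> algebraic_over g phi.
Proof.
move=> c0 [R [[i [x Rx]] HR]]; exists (R \Po 'X^c); split.
  by exists (i * c)%N, x; rewrite coef_comp_poly_Xn // dvdn_mull // mulnK.
by move=> y; rewrite -[RHS](HR y) /ev2 map_comp_poly map_polyXn horner_comp hornerXn.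
Qed.

Lemma algebraic_over_pull (X Y : Type) (pi : Y -> X) k m (s : 'I_k -> 'I_m)
    (g : X -> 'I_k -> K) (g' : Y -> 'I_m -> K) phi :
  (forall x, exists y, pi y = x) -> (forall y i, g' y (s i) = g (pi y) i) ->
  algebraic_over g phi -> algebraic_over g' (fun y => phi (pi y)).
Proof.
move=> surj gE [R [[i [x Rx]] HR]].
have E y p : (psubst (fun i => 'X_(s i)) p).@[g' y] = p.@[g (pi y)].
  by rewrite psubst_eval; apply: meval_eq => j; rewrite mevalXU gE.
exists (map_poly (psubst (fun i => 'X_(s i))) R); split.
  by have [y Ey] := surj x; exists i, y; rewrite coef_map /= E Ey.
move=> y; rewrite -[RHS](HR (pi y)) /ev2 -map_poly_comp; congr (_.[_]).
by apply: eq_map_poly => p /=; rewrite E.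
Qed.

(** Negative exponents make the action of integer matrices non-polynomial. A single fraction with
    nowhere vanishing denominator is asked for on all of [X], so regular functions again form a
    domain. *)
Definition regfun (X : Type) d (F : X -> 'I_d -> K) (phi : X -> K) :=
  exists p q : {mpoly K[d]}, forall x, q.@[F x] != 0 /\ phi x = p.@[F x] / q.@[F x].

Section RegularFunctions.
Variables (X : Type) (d : nat) (F : X -> 'I_d -> K).

Lemma subalg_regfun : subalg (regfun F).
Proof.
split=> [c|phi psi [p [q Ep]] [p' [q' Ep']]|phi psi [p [q Ep]] [p' [q' Ep']]].
- by exists c%:MP, 1 => x; rewrite meval1 oner_eq0 mevalC divr1.
- exists (p * q' + p' * q), (q * q') => x; have [[? ->] [? ->]] := (Ep x, Ep' x).
  by rewrite mevalD !mevalM mulf_neq0 // addf_div.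
- exists (p * p'), (q * q') => x; have [[? ->] [? ->]] := (Ep x, Ep' x).
  by rewrite !mevalM mulf_neq0 // mulf_div.
Qed.

Lemma polyfun_regfun phi : polyfun F phi -> regfun F phi.
Proof. by case=> p Ep; exists p, 1 => x; rewrite meval1 oner_eq0 divr1 Ep. Qed.

Lemma regfun_inv phi : (forall x, phi x != 0) -> regfun F phi -> regfun F (fun x => (phi x)^-1).
Proof.
move=> phi0 [p [q Ep]]; exists q, p => x; have := phi0 x; have [q0 ->] := Ep x.
by rewrite mulf_eq0 negb_or => /andP [-> _]; rewrite invf_div.
Qed.

Hypothesis dF : dom (polyfun F).

Lemma dom_regfun : dom (regfun F).
Proof.
move=> phi psi [p [q Ep]] [p' [q' Ep']] H.
have [x|E|E] := dF (polyfun_eval F p) (polyfun_eval F p').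
- have := H x; have [[q0 ->] [q0' ->]] := (Ep x, Ep' x).
  move/eqP; rewrite mulf_div mulf_eq0 invr_eq0 [X in _ || X]mulf_eq0 (negPf q0) (negPf q0') !orbF.
  by move/eqP.
- by left=> x; have [_ ->] := Ep x; rewrite E mul0r.
- by right=> x; have [_ ->] := Ep' x; rewrite E mul0r.
Qed.

(** Finitely many regular functions are polynomials in the coordinates and in the inverse of one
    common denominator. That inverse is algebraic over a transcendence basis of the polynomial
    functions, so the exchange theorem applies. *)
Lemma trdeg_regfun k : trdeg_ge (regfun F) k -> trdeg_ge (polyfun F) k.
Proof.
move=> tr; have [x0] := trdeg_ge_inhabited tr.
have [e [[g [Ag aig]] mx]] := trdeg_max (inhabits x0) (trdeg_polyfun_bound dF).
case: (leqP k e) => [ke|ek]; first by apply: trdeg_ge_le ke _; exists g.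
have [f [/choice [p /choice [q Epq]] aif]] := trdeg_ge_le ek tr; exfalso.
pose Q := \prod_i q i.
have Q0 x : Q.@[F x] != 0.
  rewrite rmorph_prod; apply/prodf_neq0 => i _; by have [] := Epq i x.
pose h x := fcons (Q.@[F x])^-1 (F x).
have Ah : forall i, regfun F (fun x => h x i).
  move=> i; rewrite /h /fcons; case: unliftP => [j _|_] /=.
    exact: polyfun_regfun (polyfun_coord F j).
  by apply: regfun_inv => //; apply: polyfun_regfun (polyfun_eval F _).
have Ag' i : regfun F (fun x => g x i) by exact: polyfun_regfun.
apply: (alg_dependent_of_algebraic subalg_regfun dom_regfun Ag' Ah _ _ aif).
  move=> j; rewrite /h /fcons; case: unliftP => [i _|_] /=.
    exact: algebraic_over_of_max mx Ag aig (polyfun_coord F i).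
  by apply: algebraic_over_inv => //; apply: algebraic_over_of_max mx Ag aig (polyfun_eval F _).
(* With Q the product of all denominators, p_i / q_i is Q^-1 times p_i times the product of the
   other q_j. *)
move=> i; exists ('X_ord0 * psubst (fun j => 'X_(lift ord0 j)) (p i * \prod_(j | j != i) q j)) => x.
rewrite mevalM mevalXU /h fcons0 psubst_eval.
rewrite (@meval_eq _ _ _ (F x)); last by move=> j; rewrite mevalXU fconsS.
rewrite /Q (bigD1 i) //= !mevalM; have [qi0 ->] := Epq i x.
have : (\prod_(j | j != i) q j).@[F x] != 0.
  by rewrite rmorph_prod; apply/prodf_neq0 => j _; have [] := Epq j x.
by move=> qj0; field; rewrite qi0 qj0.
Qed.

End RegularFunctions.

End TranscendenceDegree.

(** * The Hilbert basis theorem and closed sets *)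

Section Noetherian.

Record ideal (R : comNzRingType) (I : R -> Prop) : Prop := Ideal {
  ideal0 : I 0;
  idealD : forall x y, I x -> I y -> I (x + y);
  idealM : forall x y, I y -> I (x * y) }.

Inductive ideal_gen (R : comNzRingType) (P : R -> Prop) : R -> Prop :=
| ideal_gen0 : ideal_gen P 0
| ideal_genS x p y : P p -> ideal_gen P y -> ideal_gen P (x * p + y).

Definition noetherian (R : comNzRingType) := forall I : R -> Prop, ideal I ->
  exists s : seq R, (forall x, x \in s -> I x) /\ forall x, I x -> ideal_gen (fun p => p \in s) x.

Lemma ideal_gen_ideal (R : comNzRingType) (P : R -> Prop) : ideal (ideal_gen P).
Proof.
split=> [|x y|x y]; first exact: ideal_gen0.
- by elim=> [|z p t Pp _ IH] Py; rewrite ?add0r // -addrA; apply: ideal_genS; last exact: IH.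
- elim=> [|z p t Pp _ IH]; first by rewrite mulr0; apply: ideal_gen0.
  by rewrite mulrDr mulrA; apply: ideal_genS.
Qed.

Lemma ideal_gen_in (R : comNzRingType) (P : R -> Prop) x : P x -> ideal_gen P x.
Proof. by move=> Px; rewrite -[x]mul1r -[1 * x]addr0; apply: ideal_genS => //; apply: ideal_gen0. Qed.

Lemma ideal_gen_sub (R : comNzRingType) (P I : R -> Prop) x :
  ideal I -> (forall p, P p -> I p) -> ideal_gen P x -> I x.
Proof.
move=> iI PI; elim=> [|z p y Pp _ IH]; first exact: ideal0.
by apply: (idealD iI) => //; apply: (idealM iI); apply: PI.
Qed.

Lemma idealB (R : comNzRingType) (I : R -> Prop) x y : ideal I -> I x -> I y -> I (x - y).
Proof. by move=> iI Ix Iy; apply: (idealD iI) => //; rewrite -mulN1r; apply: idealM. Qed.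

Lemma noetherian_field (K : fieldType) : noetherian K.
Proof.
move=> I iI; case: (classic (exists x, I x /\ x != 0)) => [[x [Ix x0]]|H].
  exists [:: x]; split=> [y|y _]; first by rewrite inE => /eqP ->.
  rewrite -[y](mulfVK x0); apply: (idealM (ideal_gen_ideal _)).
  by apply: ideal_gen_in; rewrite inE.
exists [::]; split=> // x Ix; case: (eqVneq x 0) => [->|x0]; first exact: ideal_gen0.
by case: H; exists x.
Qed.

Lemma noetherian_surj (R S : comNzRingType) (f : {rmorphism R -> S}) :
  (forall y, exists x, f x = y) -> noetherian R -> noetherian S.
Proof.
move=> surj nR I iI; have [|s [sI genI]] := nR (fun x => I (f x)).
  split=> [|x y Ix Iy|x y Iy]; first by rewrite rmorph0; apply: ideal0.
    by rewrite rmorphD; apply: idealD.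
  by rewrite rmorphM; apply: idealM.
exists (map f s); split=> [y /mapP [x xs ->]|y]; first exact: sI.
have [x <-] := surj y; move/genI; elim=> [|z p t ps _ IH].
  by rewrite rmorph0; apply: ideal_gen0.
by rewrite rmorphD rmorphM; apply: ideal_genS => //; apply: map_f.
Qed.

Section HilbertBasis.
Variables (R : comNzRingType) (nR : noetherian R) (I : {poly R} -> Prop) (iI : ideal I).

(** [Q] selects degrees: with all degrees allowed [t] generates the ideal of all leading
    coefficients, with a single degree k allowed that of degree k. The bound on [D] in terms of [Q]
    then ensures that generators for degree k already work in degree k. *)
Lemma lead_ideal_lift (t : seq R) (Q : nat -> Prop) :
  (forall a, a \in t -> exists f n, [/\ I f, Q n, (size f <= n.+1)%N & f`_n = a]) ->
  exists (s : seq {poly R}) D, [/\ forall f, f \in s -> I f,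
    (forall B, (forall n, Q n -> (n <= B)%N) -> (D <= B)%N) &
    forall b m, ideal_gen (fun a => a \in t) b -> (D <= m)%N ->
      exists g, [/\ ideal_gen (fun f => f \in s) g, (size g <= m.+1)%N & g`_m = b]].
Proof.
move=> H.
have [s [D [sI DB Hs]]] : exists (s : seq {poly R}) D, [/\ forall f, f \in s -> I f,
    (forall B, (forall n, Q n -> (n <= B)%N) -> (D <= B)%N) &
    forall a, a \in t -> exists f n, [/\ f \in s, (n <= D)%N, (size f <= n.+1)%N & f`_n = a]].
  elim: t H => [|a t IH] H; first by exists [::], 0%N; split.
  have [s [D [sI DB Hs]]] := IH (fun b bt => H b (mem_behead (s := a :: t) bt)).
  have [f [n [If Qn szf fn]]] := H a (mem_head _ _).
  exists (f :: s), (maxn n D); split=> [g|B HB|b].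
  - by rewrite inE => /orP [/eqP ->|/sI].
  - by rewrite geq_max HB ?DB.
  rewrite inE => /orP [/eqP ->|/Hs [g [k [gs kD szg gk]]]].
    by exists f, n; rewrite mem_head leq_maxl.
  by exists g, k; rewrite inE gs orbT leq_max kD orbT.
exists s, D; split=> // b m gb Dm; elim: gb => [|x a y at_ _ [g [gs szg gm]]].
  by exists 0; split; [apply: ideal_gen0|rewrite size_poly0|rewrite coef0].
have [f [n [fs nD szf fn]]] := Hs a at_.
have nm := leq_trans nD Dm.
exists ((x%:P * 'X^(m - n)) * f + g); split.
- exact: ideal_genS.
- rewrite (leq_trans (size_polyD _ _)) // geq_max szg andbT -mulrA mul_polyC.
  rewrite (leq_trans (size_scale_leq _ _)) // mulrC.
  case: (eqVneq f 0) => [->|f0]; first by rewrite mul0r size_poly0.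
  by rewrite size_mulXn //; lia.
by rewrite coefD gm -mulrA mul_polyC coefZ (mulrC 'X^_) coefMXn ltnNge leq_subr /= subKn // fn.
Qed.

Lemma hilbert_basis_ideal : exists s : seq {poly R},
  (forall x, x \in s -> I x) /\ forall x, I x -> ideal_gen (fun p => p \in s) x.
Proof.
(* The size is bounded instead of prescribed, so zero is included as a coefficient and [L Q] is an
   ideal. *)
pose L (Q : nat -> Prop) a := exists f n, [/\ I f, Q n, (size f <= n.+1)%N & f`_n = a].
have step (Q : nat -> Prop) : ideal (L Q) -> exists (s : seq {poly R}) D,
    [/\ forall f, f \in s -> I f, (forall B, (forall n, Q n -> (n <= B)%N) -> (D <= B)%N) &
    forall f n, I f -> Q n -> size f = n.+1 -> (D <= n)%N ->
     exists g, ideal_gen (fun f => f \in s) g /\ (size (f - g)%R <= n)%N].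
  move=> /nR [t [tL genL]]; have [s [D [sI DB Hs]]] := lead_ideal_lift tL.
  exists s, D; split=> // f n If Qn szf Dn.
  have [|g [gs szg gn]] := Hs f`_n n _ Dn; first by apply: genL; exists f, n; rewrite szf.
  exists g; split=> //; apply/leq_sizeP => j; rewrite leq_eqVlt coefB => /orP [/eqP <-|nj].
    by rewrite gn subrr.
  by rewrite !nth_default ?subrr // ?szf // (leq_trans szg).
have idealQ (Q : nat -> Prop) : (forall n m, Q n -> Q m -> Q (maxn n m)) -> (exists n, Q n) ->
    ideal (L Q).
  move=> Qmax [n0 Qn0]; split.
  - by exists 0, n0; split=> //; [apply: ideal0|rewrite size_poly0|rewrite coef0].
  - move=> _ _ [f [n [If Qn szf <-]]] [g [m [Ig Qm szg <-]]].
    exists ('X^(maxn n m - n) * f + 'X^(maxn n m - m) * g), (maxn n m); split.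
    + by apply: (idealD iI); apply: (idealM iI).
    + exact: Qmax.
    + have szX k (h : {poly R}) l : (size h <= k.+1)%N -> (k <= l)%N -> (size ('X^(l - k) * h)%R <= l.+1)%N.
        move=> szh kl; rewrite mulrC; case: (eqVneq h 0) => [->|h0]; first by rewrite mul0r size_poly0.
        by rewrite size_mulXn //; lia.
      by rewrite (leq_trans (size_polyD _ _)) // geq_max !szX // ?leq_maxl ?leq_maxr.
    have cX k (h : {poly R}) l : (k <= l)%N -> ('X^(l - k) * h)`_l = h`_k.
      by move=> kl; rewrite mulrC coefMXn ltnNge leq_subr /= subKn.
    by rewrite coefD !cX ?leq_maxl ?leq_maxr.
  - move=> x _ [f [n [If Qn szf <-]]]; exists (x%:P * f), n; split=> //.
    + exact: idealM.
    + by rewrite mul_polyC (leq_trans (size_scale_leq _ _)).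
    by rewrite mul_polyC coefZ.
(* These generators reduce every element of degree at least [D]. *)
have [|s [D [sI _ Hs]]] := step (fun=> True); first by apply: idealQ => //; exists 0%N.
(* Each of the finitely many degrees below [D] gets its own generators. *)
have [s' [s'I Hs']] : exists s' : seq {poly R}, (forall f, f \in s' -> I f) /\
    forall f n, I f -> size f = n.+1 -> (n < D)%N ->
     exists g, ideal_gen (fun f => f \in s') g /\ (size (f - g)%R <= n)%N.
  elim: D {Hs} => [|D [s' [s'I Hs']]]; first by exists [::].
  have [|s1 [D1 [s1I D1D Hs1]]] := step (fun n => n = D).
    by apply: idealQ => [n m -> ->|]; [rewrite maxnn|exists D].
  have {}D1D : (D1 <= D)%N by apply: D1D => n ->.
  exists (s1 ++ s'); split=> [f|f n If szf].
    by rewrite mem_cat => /orP [/s1I|/s'I].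
  rewrite ltnS leq_eqVlt => /orP [/eqP nD|nD].
    have [|g [gs szg]] := Hs1 f n If nD szf; first by rewrite nD.
    exists g; split=> //; apply: (ideal_gen_sub (ideal_gen_ideal _)) gs => p ps.
    by apply: ideal_gen_in; rewrite mem_cat ps.
  have [g [gs szg]] := Hs' f n If szf nD.
  exists g; split=> //; apply: (ideal_gen_sub (ideal_gen_ideal _)) gs => p ps.
  by apply: ideal_gen_in; rewrite mem_cat ps orbT.
exists (s ++ s'); split=> [x|f]; first by rewrite mem_cat => /orP [/sI|/s'I].
elim: {f}(size f) {-2}f (leqnn (size f)) => [|n IH] f szf If.
  by move: szf; rewrite size_poly_leq0 => /eqP ->; apply: ideal_gen0.
case: (ltngtP (size f) n.+1) szf => // [szf _|szf _]; first exact: IH.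
have [g [Ig gs szg]] : exists g, [/\ I g, ideal_gen (fun p => p \in s ++ s') g & (size (f - g)%R <= n)%N].
  case: (leqP D n) => Dn.
    have [g [gs szg]] := Hs f n If Logic.I szf Dn; exists g; split=> //.
      exact: ideal_gen_sub gs.
    apply: (ideal_gen_sub (ideal_gen_ideal _)) gs => p ps.
    by apply: ideal_gen_in; rewrite mem_cat ps.
  have [g [gs szg]] := Hs' f n If szf Dn; exists g; split=> //.
    exact: ideal_gen_sub gs.
  apply: (ideal_gen_sub (ideal_gen_ideal _)) gs => p ps.
  by apply: ideal_gen_in; rewrite mem_cat ps orbT.
rewrite -[f](subrK g); apply: (idealD (ideal_gen_ideal _)) => //.
by apply: IH => //; apply: idealB.
Qed.

End HilbertBasis.

Lemma noetherian_poly (R : comNzRingType) : noetherian R -> noetherian {poly R}.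
Proof. by move=> nR I iI; apply: hilbert_basis_ideal. Qed.

Lemma noetherian_mpoly (K : fieldType) d : noetherian {mpoly K[d]}.
Proof.
elim: d => [|d IH].
  apply: (@noetherian_surj K _ (@mpolyC 0 K : {rmorphism K -> {mpoly K[0]}})); last exact: noetherian_field.
  by move=> p; exists p@_0%MM; apply: esym; apply: nvar0_mpolyC.
pose f : {rmorphism {poly {mpoly K[d]}} -> {mpoly K[d.+1]}} :=
  horner_eval ('X_ord0 : {mpoly K[d.+1]}) \o map_poly (psubst (fun j => 'X_(lift ord0 j))).
by apply: (noetherian_surj (f := f) _ (noetherian_poly IH)); exact: of_poly_surj.
Qed.

End Noetherian.

(** * Vanishing ideals, minimal closed sets and irreducibility *)

Section ClosedSets.
Variables (K : fieldType) (d : nat) (U : pset K d).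

Definition vanish (S : pset K d) (p : {mpoly K[d]}) := forall x, S x -> p.@[x] = 0.

Lemma ideal_vanish S : ideal (vanish S).
Proof.
split=> [x _|p q Sp Sq x Sx|p q Sq x Sx]; first by rewrite meval0.
  by rewrite mevalD Sp ?Sq ?addr0.
by rewrite mevalM Sq ?mulr0.
Qed.

Lemma vanish_sub S S' p : psubset S S' -> vanish S' p -> vanish S p.
Proof. by move=> SS' H x /SS'; apply: H. Qed.

Lemma zclosedP A : zclosed U A <->
  psubset A U /\ forall x, U x -> (forall p, vanish A p -> p.@[x] = 0) -> A x.
Proof.
split=> [[P HP]|[AU H]].
  split=> [x /HP [] //|x Ux Hx]; apply/HP; split=> // p Pp; apply: Hx => y /HP [_]; exact.
exists (vanish A) => x; split=> [Ax|[Ux Hx]]; last exact: H.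
by split=> [|p]; [exact: AU|exact].
Qed.

Lemma zclosed_closure S : zclosed U (zclosure U S).
Proof.
exists (fun p => forall y, S y -> U y -> p.@[y] = 0) => x; by [].
Qed.

Lemma vanish_closure S p : psubset S U -> vanish (zclosure U S) p <-> vanish S p.
Proof.
move=> SU; split=> H x; first by move=> Sx; apply: H; split=> [|q]; [exact: SU|apply=> //; exact: SU].
by case=> Ux; apply=> y Sy _; apply: H.
Qed.

Lemma zclosed_setI A p : zclosed U A -> zclosed U (fun x => A x /\ p.@[x] = 0).
Proof.
case=> P HP; exists (fun q => P q \/ q = p) => x; split.
  by move=> [/HP [Ux H] px]; split=> // q [/H|->].
by move=> [Ux H]; split; [apply/HP; split=> // q Pq; apply: H; left|apply: H; right].
Qed.

(* A strictly decreasing sequence of closed sets would give a strictly increasing sequence of ideals,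
   whose union is finitely generated. *)
Lemma minimal_zclosed (Q : pset K d -> Prop) A : zclosed U A -> Q A ->
  exists B, [/\ zclosed U B, Q B, psubset B A &
    forall B', zclosed U B' -> Q B' -> psubset B' B -> psubset B B'].
Proof.
move=> cA QA; apply: NNPP => H.
pose T := {B | [/\ zclosed U B, Q B & psubset B A]}.
have /choice [next Hnext] : forall B : T, exists B' : T,
    psubset (sval B') (sval B) /\ ~ psubset (sval B) (sval B').
  case=> B [cB QB BA]; apply: NNPP => HB; apply: H; exists B; split=> // B' cB' QB' B'B.
  apply: NNPP => HBB'; apply: HB.
  by exists (exist _ B' (And3 cB' QB' (fun x Bx => BA x (B'B x Bx)))).
pose seqB n := iter n next (exist _ A (And3 cA QA (fun x Ax => Ax)) : T).
pose I n := vanish (sval (seqB n)).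
have Imono n m p : (n <= m)%N -> I n p -> I m p.
  move/subnK <-; elim: (m - n)%N => // k IH Inp; rewrite addSn.
  by apply: vanish_sub (IH Inp); case: (Hnext (seqB (k + n)%N)).
have [|s [sI genI]] := @noetherian_mpoly K d (fun p => exists n, I n p).
  split=> [|p q [n Ip] [m Iq]|p q [n Iq]].
  - by exists 0%N; apply: ideal0 (ideal_vanish _).
  - exists (maxn n m); apply: (idealD (ideal_vanish _)).
      exact: Imono (leq_maxl _ _) Ip.
    exact: Imono (leq_maxr _ _) Iq.
  - by exists n; apply: (idealM (ideal_vanish _)).
have [N HN] : exists N, forall p, p \in s -> I N p.
  elim: s sI {genI} => [|p s IH] sI; first by exists 0%N.
  have [n In] := sI p (mem_head _ _).
  have [|m Im] := IH; first by move=> q qs; apply: sI; rewrite inE qs orbT.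
  exists (maxn n m) => q; rewrite inE => /orP [/eqP ->|/Im].
    exact: Imono (leq_maxl _ _) In.
  exact: Imono (leq_maxr _ _).
have [_ []] := Hnext (seqB N); rewrite -/(seqB N.+1).
case: (svalP (seqB N.+1)) => /zclosedP [_ cl] _ _ x Bx.
apply: cl; first by case: (svalP (seqB N)) => /zclosedP [BU _] _ _; apply: BU.
move=> p Ip; have /genI gp : exists n, I n p by exists N.+1.
have : I N p by apply: ideal_gen_sub gp => //; apply: ideal_vanish.
by apply.
Qed.

(** Primality of the vanishing ideal. It makes no reference to the ambient set and is meaningful for
    sets that are not closed, such as images. *)
Definition prime_set (S : pset K d) := (exists x, S x) /\
  forall p q, (forall x, S x -> p.@[x] * q.@[x] = 0) -> vanish S p \/ vanish S q.

Lemma prime_set_dom S : prime_set S -> dom (polyfun (fun x : {x | S x} => sval x)).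
Proof.
move=> [_ H] phi psi [p Ep] [q Eq] E.
have [x Sx|Hp|Hq] := H p q; first by have := E (exist _ x Sx); rewrite Ep Eq.
  by left=> -[x Sx]; rewrite Ep Hp.
by right=> -[x Sx]; rewrite Eq Hq.
Qed.

Definition pimage (X : Type) (F : X -> 'I_d -> K) : pset K d := fun y => exists x, y = F x.

Lemma prime_set_image (X : Type) (F : X -> 'I_d -> K) :
  inhabited X -> dom (polyfun F) -> prime_set (pimage F).
Proof.
move=> [x0] dF; split; first by exists (F x0), x0.
move=> p q H; have [x|E|E] := dF _ _ (polyfun_eval F p) (polyfun_eval F q).
- by apply: H; exists x.
- by left=> _ [x ->].
- by right=> _ [x ->].
Qed.

Lemma prime_set_closure S : psubset S U -> prime_set S -> prime_set (zclosure U S).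
Proof.
move=> SU [[x Sx] H]; split.
  by exists x; split=> [|p]; [exact: SU|apply=> //; exact: SU].
move=> p q Hpq; rewrite !vanish_closure //; apply: H => y Sy; apply: Hpq.
by split=> [|r]; [exact: SU|apply=> //; exact: SU].
Qed.

Lemma zirredP A : zirred U A <-> zclosed U A /\ prime_set A.
Proof.
split=> [[cA [x Ax] irr]|[cA [[x Ax] prA]]].
  split=> //; split; first by exists x.
  move=> p q Hpq; have [y Ay|H|H] := irr _ _ (zclosed_setI p cA) (zclosed_setI q cA).
  - by have /eqP := Hpq y Ay; rewrite mulf_eq0 => /orP [] /eqP E; [left|right].
  - by left=> y /H [].
  - by right=> y /H [].
split=> //; first by exists x.
move=> B C /zclosedP [BU clB] /zclosedP [CU clC] ABC; have /zclosedP [AU _] := cA.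
apply: NNPP => H.
have out D : (forall y, U y -> (forall p, vanish D p -> p.@[y] = 0) -> D y) ->
    ~ psubset A D -> exists p, vanish D p /\ ~ vanish A p.
  move=> clD AD; apply: NNPP => HD; apply: AD => y Ay; apply: clD; first exact: AU.
  by move=> p Dp; apply: NNPP => py; apply: HD; exists p; split=> // Ap; apply: py; apply: Ap.
have [|p [Bp Ap]] := out B clB; first by move=> AB; apply: H; left.
have [|q [Cq Aq]] := out C clC; first by move=> AC; apply: H; right.
case: (prA p q) => // y /ABC [/Bp ->|/Cq ->]; by rewrite ?mul0r ?mulr0.
Qed.

End ClosedSets.

(** * Elimination of a variable *)

Lemma min_measure (T : Type) (P : T -> Prop) (mu : T -> nat) : (exists x, P x) ->
  exists x, P x /\ forall y, (mu y < mu x)%N -> ~ P y.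
Proof.
case=> x Px; apply: NNPP => H.
elim: {x}(mu x).+1 {-2}x (ltnSn (mu x)) Px => // n IH x xn Px.
apply: H; exists x; split=> // y yx Py.
by apply: (IH y _ Py); rewrite (leq_trans yx).
Qed.

Section Chevalley.
Variable K : closedFieldType.
Hypothesis char0 : [pchar K] =i pred0.

Lemma poly_drop_lead (R : nzRingType) (F : {poly R}) : F != 0 ->
  (size (F - lead_coef F *: 'X^((size F).-1))%R < size F)%N /\
  forall i, (F - lead_coef F *: 'X^((size F).-1))`_i = if i == (size F).-1 then 0 else F`_i.
Proof.
move=> F0; have H i : (F - lead_coef F *: 'X^((size F).-1))`_i = if i == (size F).-1 then 0 else F`_i.
  rewrite coefB coefZ coefXn; case: eqP => [->|_]; last by rewrite mulr0 subr0.
  by rewrite mulr1 lead_coefE subrr.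
split=> //; rewrite -[X in (_ < X)%N]prednK ?size_poly_gt0 // ltnS.
apply/leq_sizeP => j; rewrite H; case: eqP => // /eqP ne le.
by rewrite nth_default // (polySpred F0) ltn_neqAle eq_sym ne le.
Qed.

Section OneVariable.
Variables (d : nat) (T : pset K d.+1).
Hypothesis clT : forall x, (forall p, vanish T p -> p.@[x] = 0) -> T x.
Hypothesis prT : prime_set T.

Definition pr : pset K d := fun b => exists t, T (fcons t b).
Definition vT (G : {poly {mpoly K[d]}}) := forall b t, T (fcons t b) -> ev2 G b t = 0.

Lemma vT_of_poly G : vT G <-> vanish T (of_poly G).
Proof.
split=> [H x Tx|H b t Tbt]; last by rewrite -of_poly_eval H.
by rewrite -(fcons_eta x) of_poly_eval H // fcons_eta.
Qed.

Lemma vTC p : vT p%:P <-> vanish pr p.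
Proof.
split=> [H b [t Tbt]|H b t Tbt]; first by have := H b t Tbt; rewrite ev2C.
by rewrite ev2C H //; exists t.
Qed.

Lemma vT_ideal : ideal vT.
Proof.
split=> [b t _|G H vG vH b t Tbt|G H vH b t Tbt]; first by rewrite /ev2 rmorph0 horner0.
  by rewrite ev2D vG ?vH ?addr0.
by rewrite ev2M vH ?mulr0.
Qed.

Lemma vT_prime G H : vT (G * H) -> vT G \/ vT H.
Proof.
rewrite !vT_of_poly of_polyM => GH; apply: prT.2 => x Tx.
by rewrite -mevalM GH.
Qed.

Lemma vT_scale c G : ~ vanish pr c -> vT (c *: G) -> vT G.
Proof. by rewrite -mul_polyC => nc /vT_prime [/vTC|]. Qed.

Lemma prime_set_pr : prime_set pr.
Proof.
split; first by have [[x Tx] _] := prT; exists (fun i => x (lift ord0 i)), (x ord0); rewrite fcons_eta.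
move=> p q H; rewrite -!vTC; apply: vT_prime => b t Tbt.
by rewrite ev2M !ev2C H //; exists t.
Qed.

Lemma vanish_pr_ideal : ideal (vanish pr).
Proof. exact: ideal_vanish. Qed.

Lemma closed_of_poly b t : (forall G, vT G -> ev2 G b t = 0) -> T (fcons t b).
Proof.
move=> H; apply: clT => p; have [G <-] := of_poly_surj p.
by move/vT_of_poly/H; rewrite of_poly_eval.
Qed.

(** Without a relation for the eliminated variable, [T] contains the whole line over each point of
    the closure of the projection. A coefficient of [Gu] not vanishing at the base point makes [Gu]
    a nonzero polynomial on this line, so some natural number is not a root. *)
Lemma elim_free_variable Gu : (forall G, vT G -> forall i, vanish pr G`_i) -> ~ vT Gu ->
  exists v, ~ vanish pr v /\ forall b, (forall p, vanish pr p -> p.@[b] = 0) ->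
    v.@[b] != 0 -> exists t, T (fcons t b) /\ ev2 Gu b t != 0.
Proof.
move=> all_coef nGu; have [i Hi] : exists i, ~ vanish pr Gu`_i.
  apply: NNPP => H; apply: nGu => b t Tbt; rewrite ev2E big1 // => i _.
  have -> : (Gu`_i).@[b] = 0; last by rewrite mul0r.
  by apply: NNPP => Hi; apply: H; exists i => /(_ b) Hb; apply: Hi; apply: Hb; exists t.
exists Gu`_i; split=> // b clb Gub; apply: NNPP => H.
have /polyP /(_ i) : map_poly (meval b) Gu = 0.
  apply: (poly_nat_roots char0) => n; apply/eqP/negPn/negP => Hn.
  apply: H; exists n%:R; split=> //; apply: closed_of_poly => G /all_coef GB.
  by rewrite ev2E big1 // => j _; rewrite clb ?mul0r.
by rewrite coef_map coef0 /=; apply/eqP.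
Qed.

Lemma idomain_divp (P Q : {poly {mpoly K[d]}}) : Q != 0 -> exists k S R,
  (lead_coef Q ^+ k) *: P = S * Q + R /\ (size R < size Q)%N.
Proof.
move=> Q0; exists (scalp P Q), (P %/ Q), (P %% Q); split; last by rewrite ltn_modp.
by rewrite (Pdiv.Idomain.divp_eq P Q).
Qed.

(** [F] is a nontrivial relation of least degree, a substitute for a minimal polynomial, with
    leading coefficient [l]. Roots of [F] over base points with [l] nonzero lie in [T]; a substitute
    [c] for the resultant of [F] and [Gu] keeps [Gu] nonzero there. *)
Lemma elim_algebraic_variable Gu :
  (exists G, vT G /\ exists i, ~ vanish pr G`_i) -> ~ vT Gu ->
  exists v, ~ vanish pr v /\ forall b, (forall p, vanish pr p -> p.@[b] = 0) ->
    v.@[b] != 0 -> exists t, T (fcons t b) /\ ev2 Gu b t != 0.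
Proof.
move=> /(min_measure (fun G : {poly {mpoly K[d]}} => size G)) [F [[vF [i Fi]] minF]] nGu.
have vsmall G : vT G -> (size G < size F)%N -> forall j, vanish pr G`_j.
  by move=> vG szG j; apply: NNPP => H; apply: (minF _ szG); split=> //; exists j.
have F0 : F != 0.
  by apply/eqP => F0; apply: Fi; rewrite F0 coef0; apply: ideal0 vanish_pr_ideal.
pose l := lead_coef F.
have nl : ~ vanish pr l.
  move=> vl; have [szF' EF'] := poly_drop_lead F0.
  apply: (minF _ szF'); split.
    apply: (idealB vT_ideal) => //.
    rewrite -mul_polyC mulrC; apply: (idealM vT_ideal); exact/vTC.
  exists i; rewrite EF'; case: eqP => [E|//].
  by case: Fi; rewrite E -lead_coefE.
have nlk k G : vT ((l ^+ k) *: G) -> vT G.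
  apply: vT_scale => H; apply: nl => x px; have /eqP := H x px.
  by rewrite rmorphXn expf_eq0 => /andP [_ /eqP].
have szF : (1 < size F)%N.
  rewrite ltnNge; apply/negP => H; apply: nl; apply/vTC.
  by rewrite /l -(_ : F = (lead_coef F)%:P) // {1}(size1_polyC H) lead_coefE; congr (_`_ _)%:P; lia.
(* The pseudo-remainder of any relation by [F] is a relation of smaller size, so its coefficients
   vanish on the base; at a root of [F] the relation itself must then vanish. *)
have TF b t : (forall p, vanish pr p -> p.@[b] = 0) -> l.@[b] != 0 -> ev2 F b t = 0 -> T (fcons t b).
  move=> clb lb Fbt; apply: closed_of_poly => G vG.
  have [k [S [R [E szR]]]] := idomain_divp G F0.
  have vR : vT R.
    have -> : R = l ^+ k *: G - S * F by rewrite E addrC addKr.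
    by apply: (idealB vT_ideal); rewrite -?mul_polyC; apply: (idealM vT_ideal).
  have := congr1 (fun H => ev2 H b t) E; rewrite ev2D ev2M Fbt mulr0 add0r ev2Z.
  rewrite [ev2 R b t]ev2E big1 => [/eqP|j _]; last by rewrite clb ?mul0r //; apply: vsmall.
  by rewrite rmorphXn mulf_eq0 expf_eq0 (negPf lb) andbF => /eqP.
(* A least-degree element outside [vT] that is a multiple of [Gu] modulo [vT]; it turns out to be
   constant in t and so acts as the resultant. *)
pose J G := ~ vT G /\ exists a, vT (G - a * Gu).
have [G [[nG [a Ga]] minG]] : exists G, J G /\ forall H : {poly {mpoly K[d]}}, (size H < size G)%N -> ~ J H.
  apply: (min_measure (fun G : {poly {mpoly K[d]}} => size G)); exists Gu; split=> //; exists 1; rewrite mul1r subrr; exact: ideal0 vT_ideal.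
have G0 : G != 0 by apply/eqP => G0; apply: nG; rewrite G0; apply: ideal0 vT_ideal.
have szGF : (size G < size F)%N.
  rewrite ltnNge; apply/negP => szFG.
  have [k [S [R [E szR]]]] := idomain_divp G F0.
  have ER : R = l ^+ k *: G - S * F by rewrite E addrC addKr.
  apply: (minG R (leq_trans szR szFG)); split.
    move=> vR; apply: nG; apply: (nlk k); rewrite /l E; apply: (idealD vT_ideal) => //.
    exact: (idealM vT_ideal).
  exists ((l ^+ k)%:P * a); rewrite ER -mul_polyC.
  have -> : (l ^+ k)%:P * G - S * F - (l ^+ k)%:P * a * Gu = (l ^+ k)%:P * (G - a * Gu) - S * F by ring.
  by apply: (idealB vT_ideal); [exact: (idealM vT_ideal)|exact: (idealM vT_ideal)].
pose c := lead_coef G.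
have nc : ~ vanish pr c.
  move=> vc; have [szG' _] := poly_drop_lead G0.
  have vm : vT (lead_coef G *: 'X^((size G).-1)).
    by rewrite -mul_polyC mulrC; apply: (idealM vT_ideal); apply/vTC.
  apply: (minG _ szG'); split.
    by move=> vG'; apply: nG; rewrite -[G](subrK (lead_coef G *: 'X^((size G).-1))); apply: (idealD vT_ideal).
  exists a; have -> : G - lead_coef G *: 'X^((size G).-1) - a * Gu = (G - a * Gu) - lead_coef G *: 'X^((size G).-1) by ring.
  by apply: (idealB vT_ideal).
have szG : (size G <= 1)%N.
  (* If [G] had positive degree, dividing [F] by it would leave a remainder in [vT] by minimality of
     [G]. Then S * G lies in [vT], hence so does [S] by primality. As [S] is smaller than [F] its
     leading coefficient vanishes on the base, although its product with [c] is c^k * l. *)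
  rewrite leqNgt; apply/negP => szG.
  have [k [S [R [E szR]]]] := idomain_divp F G0.
  have ER : R = c ^+ k *: F - S * G by rewrite E addrC addKr.
  have vR : vT R.
    apply: NNPP => nR; apply: (minG _ szR); split=> //.
    exists (- (S * a)); rewrite ER.
    have -> : c ^+ k *: F - S * G - - (S * a) * Gu = c ^+ k *: F - S * (G - a * Gu) by ring.
    apply: (idealB vT_ideal); [ |exact: (idealM vT_ideal)].
    by rewrite -mul_polyC; apply: (idealM vT_ideal).
  have vSG : vT (S * G).
    have -> : S * G = c ^+ k *: F - R by rewrite ER; ring.
    apply: (idealB vT_ideal); [ |by []].
    by rewrite -mul_polyC; apply: (idealM vT_ideal).
  have vS : vT S by case: (vT_prime vSG).
  have ck0 : c ^+ k != 0 by rewrite expf_neq0 // lead_coef_eq0.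
  have szckF : size (c ^+ k *: F) = size F by rewrite size_scale.
  have szSG : size (S * G) = size F.
    have -> : S * G = c ^+ k *: F - R by rewrite ER; ring.
    by rewrite size_polyDl szckF // size_polyN (ltn_trans szR szGF).
  have S0 : S != 0.
    by apply/eqP => S0; move: szSG; rewrite S0 mul0r size_poly0; lia.
  have szS : (size S < size F)%N.
    by rewrite -szSG size_mul //; move: (size S) (size G) szG => x y; lia.
  have lcS : lead_coef S * c = c ^+ k * l.
    rewrite -lead_coefM -lead_coefZ -/l.
    have -> : S * G = c ^+ k *: F - R by rewrite ER; ring.
    by rewrite lead_coefDl // size_polyN szckF (ltn_trans szR szGF).
  have vlS : vanish pr (lead_coef S) by apply: vsmall.
  have : vanish pr (c ^+ k * l).
    by rewrite -lcS mulrC; apply: (idealM vanish_pr_ideal).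
  move/vTC; rewrite polyCM.
  rewrite mul_polyC => H; apply: nl; apply/vTC; move: H; apply: vT_scale => H; apply: nc => x px.
  by have /eqP := H x px; rewrite rmorphXn expf_eq0 => /andP [_ /eqP].
have EG : G = c%:P by rewrite /c {2}(size1_polyC szG) lead_coefC; apply: size1_polyC.
exists (c * l); split.
  by move/vTC; rewrite polyCM => /vT_prime [] /vTC.
move=> b clb; rewrite mevalM mulf_eq0 negb_or => /andP [cb lb].
have : size (map_poly (meval b) F) != 1%N.
  by rewrite size_map_poly_id0 ?neq_ltn ?szF ?orbT.
case/closed_rootP => t; rewrite rootE => /eqP Ft.
have Tbt : T (fcons t b) by apply: TF.
exists t; split=> //; apply/eqP => Gu0.
have := Ga b t Tbt; rewrite ev2B ev2M Gu0 mulr0 subr0 EG ev2C; exact/eqP.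
Qed.

(** One step of Chevalley's theorem. The base point ranges over the closure of the projection, and
    the inequation [u] is traded for [v], so that the step can be iterated. *)
Lemma elim_variable u : ~ vanish T u ->
  exists v, ~ vanish pr v /\ forall b, (forall p, vanish pr p -> p.@[b] = 0) ->
    v.@[b] != 0 -> exists t, T (fcons t b) /\ u.@[fcons t b] != 0.
Proof.
have [Gu <-] := of_poly_surj u => nu.
have {nu} nu : ~ vT Gu by move=> H; apply: nu; apply/vT_of_poly.
have [v [nv Hv]] : exists v, ~ vanish pr v /\ forall b, (forall p, vanish pr p -> p.@[b] = 0) ->
    v.@[b] != 0 -> exists t, T (fcons t b) /\ ev2 Gu b t != 0.
  case: (classic (forall G, vT G -> forall i, vanish pr G`_i)) => H.
    exact: elim_free_variable.
  apply: elim_algebraic_variable => //; apply: NNPP => H'; apply: H => G vG i.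
  by apply: NNPP => Hi; apply: H'; exists G; split=> //; exists i.
exists v; split=> // b clb vb; have [t [Tbt Gbt]] := Hv b clb vb.
by exists t; rewrite of_poly_eval.
Qed.

End OneVariable.
End Chevalley.

(** * Dimension and transcendence degree *)

Section Dimension.
Variable K : closedFieldType.
Hypothesis char0 : [pchar K] =i pred0.

Definition drop_coords e k (x : 'I_(e + k) -> K) : 'I_k -> K := fun i => x (rshift e i).

Definition drop_set e k (T : pset K (e + k)) : pset K k :=
  fun b => exists x, T x /\ b = drop_coords x.

Lemma elim_variables e k (T : pset K (e + k)) u :
  (forall x, (forall p, vanish T p -> p.@[x] = 0) -> T x) -> prime_set T -> ~ vanish T u ->
  exists v, ~ vanish (drop_set T) v /\ forall b, (forall p, vanish (drop_set T) p -> p.@[b] = 0) ->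
    v.@[b] != 0 -> exists x, [/\ T x, u.@[x] != 0 & drop_coords x = b].
Proof.
elim: e T u => [|e IH] T u clT prT nu.
  have drop0 (x : 'I_(0 + k) -> K) : drop_coords x = x.
    by apply: functional_extensionality => i; rewrite /drop_coords; congr x; apply: val_inj.
  have dropT x : drop_set T x <-> T x.
    by split=> [[y [Ty ->]]|Tx]; [rewrite drop0|exists x; rewrite drop0].
  exists u; split=> [vu|b clb ub]; first by apply: nu => x /dropT; apply: vu.
  exists b; split=> //; apply: clT => p vp; apply: clb => x /dropT; exact: vp.
have [v1 [nv1 Hv1]] := elim_variable char0 clT prT nu.
(* The projection need not be closed; its closure has the same vanishing ideal and satisfies the
   hypotheses of the induction. *)
pose T1 : pset K (e + k) := fun b => forall p, vanish (pr T) p -> p.@[b] = 0.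
have vT1 p : vanish T1 p <-> vanish (pr T) p.
  by split=> [H x prx|H x]; [apply: H => q; apply|apply].
have prT1 : prime_set T1.
  have [[x prx] H] := prime_set_pr prT; split; first by exists x => p; apply.
  move=> p q Hpq; rewrite !vT1; apply: H => y pry; apply: Hpq => r; exact.
have clT1 x : (forall p, vanish T1 p -> p.@[x] = 0) -> T1 x.
  by move=> H p /vT1; apply: H.
have [|v [nv Hv]] := IH T1 v1 clT1 prT1; first by move/vT1.
have dropfc t (x : 'I_(e + k) -> K) : drop_coords (e := e.+1) (fcons t x) = drop_coords x.
  apply: functional_extensionality => i; rewrite /drop_coords.
  by rewrite (_ : rshift e.+1 i = lift ord0 (rshift e i)) ?fconsS //; apply: val_inj.
have dropT1 p : vanish (drop_set T1) p <-> vanish (drop_set T) p.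
  pose p' : {mpoly K[e + k]} := psubst (fun i => 'X_(rshift e i)) p.
  have Ep' x : p'.@[x] = p.@[drop_coords x].
    by rewrite psubst_eval; apply: meval_eq => i; rewrite mevalXU.
  transitivity (vanish (pr T) p').
    rewrite -vT1; split=> [H x T1x|H _ [x [T1x ->]]]; last by rewrite -Ep' H.
    by rewrite Ep'; apply: H; exists x.
  split=> [H _ [x [Tx ->]]|H x [t Tx]]; last by rewrite Ep' -(dropfc t); apply: H; exists (fcons t x).
  rewrite -(fcons_eta (x : 'I_(e + k).+1 -> K)) dropfc -Ep'; apply: H; exists (x ord0).
  by rewrite fcons_eta.
exists v; split=> [/dropT1//|b clb vb].
have [|x [T1x v1x xb]] := Hv b _ vb; first by move=> p /dropT1; apply: clb.
have [t [Ttx utx]] := Hv1 x T1x v1x.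
by exists (fcons t x); split=> //; rewrite dropfc.
Qed.

Definition indep_on d k (S : pset K d) (f : 'I_k -> {mpoly K[d]}) :=
  forall P : {mpoly K[k]}, (forall x, S x -> P.@[fun i => (f i).@[x]] = 0) -> P = 0.

(** Elimination can carry a single inequation along, so the ambient sets are complements of one
    hypersurface; this covers affine space, the multiplicative group and [inG]. *)
Definition principal d (U : pset K d) := exists h : {mpoly K[d]}, forall x, U x <-> h.@[x] != 0.

Lemma indep_on_inhabited d k (S : pset K d) (f : 'I_k -> {mpoly K[d]}) :
  indep_on S f -> exists x, S x.
Proof.
move=> aif; apply: NNPP => H; have/eqP : (1 : {mpoly K[k]}) = 0.
  by apply: aif => x Sx; case: H; exists x.
by rewrite oner_eq0.
Qed.

(** Elimination is applied to the graph of [f] over the closure of [S] in affine space. Independence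
    of [f] says that the graph projects densely to the values; the inequation [h] brings the point
    found back from the closure into [U]. *)
Lemma chevalley d k (U S : pset K d) (f : 'I_k -> {mpoly K[d]}) :
  principal U -> zclosed U S -> prime_set S -> indep_on S f ->
  exists g : {mpoly K[k]}, g != 0 /\
    forall b, g.@[b] != 0 -> exists x, S x /\ forall i, (f i).@[x] = b i.
Proof.
move=> [h Uh] /zclosedP [SU clS] [[x0 Sx0] prS] aif.
pose gr (j : 'I_(d + k)) : {mpoly K[d]} := match split j with inl i => 'X_i | inr i => f i end.
pose graph x j := (gr j).@[x].
have graphl x i : graph x (lshift k i) = x i.
  by rewrite /graph /gr (unsplitK (inl i)) mevalXU.
have graphr x i : graph x (rshift d i) = (f i).@[x].
  by rewrite /graph /gr (unsplitK (inr i)).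
pose clos x := forall p, vanish S p -> p.@[x] = 0.
pose T : pset K (d + k) := fun y => exists x, clos x /\ y = graph x.
have Sclos x : S x -> clos x by move=> Sx p; apply.
have vTE p : vanish T p <-> vanish S (psubst gr p).
  split=> [H x Sx|H _ [x [clx ->]]].
    by rewrite psubst_eval; apply: H; exists x; split=> //; apply: Sclos.
  by have := clx _ H; rewrite psubst_eval.
have prT : prime_set T.
  split; first by exists (graph x0), x0; split=> //; apply: Sclos.
  move=> p q H; rewrite !vTE; apply: prS => x Sx.
  by rewrite !psubst_eval; apply: H; exists x; split=> //; apply: Sclos.
have clT y : (forall p, vanish T p -> p.@[y] = 0) -> T y.
  move=> H; exists (fun i => y (lshift k i)).
  have Eg : y = graph (fun i => y (lshift k i)).
    apply: functional_extensionality => j; rewrite -(splitK j); case: (split j) => i /=.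
      by rewrite graphl.
    rewrite graphr; pose q := 'X_(rshift d i) - psubst (fun i => 'X_(lshift k i)) (f i) : {mpoly K[d + k]}.
    have : q.@[y] = 0.
      apply: H; apply/vTE => x Sx; rewrite psubst_eval -/(graph x) mevalB mevalXU psubst_eval graphr.
      apply/eqP; rewrite subr_eq0; apply/eqP; by apply: meval_eq => l; rewrite mevalXU graphl.
    rewrite mevalB mevalXU psubst_eval => /eqP; rewrite subr_eq0 => /eqP ->.
    by apply: meval_eq => l; rewrite mevalXU.
  split=> // p vp.
  have := H (psubst (fun i => 'X_(lshift k i)) p); rewrite psubst_eval => E.
  rewrite -[RHS]E; first by apply: meval_eq => l; rewrite mevalXU.
  apply/vTE => x Sx; rewrite psubst_eval -/(graph x) psubst_eval -[RHS](vp x Sx).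
  by apply: meval_eq => l; rewrite mevalXU graphl.
pose u : {mpoly K[d + k]} := psubst (fun i => 'X_(lshift k i)) h.
have uE y : u.@[y] = h.@[fun i => y (lshift k i)].
  by rewrite psubst_eval; apply: meval_eq => i; rewrite mevalXU.
have [|v [nv Hv]] := elim_variables (u := u) clT prT.
  move=> vu; have /eqP : u.@[graph x0] = 0 by apply: vu; exists x0; split=> //; apply: Sclos.
  rewrite uE (_ : (fun i => _) = x0); last by apply: functional_extensionality => i; rewrite graphl.
  by apply/negP; apply/Uh; apply: SU.
exists v; split=> [|b vb].
  by apply/eqP => v0; apply: nv; rewrite v0; apply: ideal0 (ideal_vanish _).
have [|y [[x [clx ->]] uy yb]] := Hv b _ vb.
  move=> p vp; rewrite (_ : p = 0) ?meval0 //; apply: aif => x Sx; apply: vp.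
  exists (graph x); split; first by exists x; split=> //; apply: Sclos.
  by apply: functional_extensionality => i; rewrite /drop_coords graphr.
exists x; split=> [|i]; last by rewrite -graphr -yb.
apply: clS => //; apply/Uh; rewrite uE in uy.
by rewrite (_ : x = (fun i => graph x (lshift k i))) //; apply: functional_extensionality => i; rewrite graphl.
Qed.

(** * Chains of irreducible sets compared with transcendence degree *)

Section Chains.
Variables (d : nat) (U : pset K d).

Lemma indep_on_sub k (S S' : pset K d) (f : 'I_k -> {mpoly K[d]}) :
  psubset S S' -> indep_on S f -> indep_on S' f.
Proof. by move=> SS' aif P HP; apply: aif => x /SS'; apply: HP. Qed.

Lemma indep_on_closure k (S : pset K d) (f : 'I_k -> {mpoly K[d]}) : psubset S U ->
  indep_on (zclosure U S) f -> indep_on S f.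
Proof.
move=> SU aif P HP; apply: aif => x clx; rewrite -psubst_eval.
by apply: clx.2 => y Sy _; rewrite psubst_eval HP.
Qed.

Lemma indep_onP k (S : pset K d) (f : 'I_k -> {mpoly K[d]}) :
  indep_on S f <-> alg_indep (fun (s : {x | S x}) i => (f i).@[sval s]).
Proof.
split=> H P HP; apply: H; first by move=> x Sx; apply: (HP (exist _ x Sx)).
by case=> x Sx; apply: HP.
Qed.

Lemma indep_on_imageP k X (F : X -> 'I_d -> K) (f : 'I_k -> {mpoly K[d]}) :
  indep_on (pimage F) f <-> alg_indep (fun x i => (f i).@[F x]).
Proof.
split=> H P HP; apply: H; first by move=> _ [x ->]; apply: HP.
by move=> x; apply: HP; exists x.
Qed.

Lemma trdeg_polyfunP k X (F : X -> 'I_d -> K) :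
  trdeg_ge (polyfun F) k <-> exists f : 'I_k -> {mpoly K[d]}, indep_on (pimage F) f.
Proof.
split=> [[f [/choice [p Ep] aif]]|[f aif]].
  exists p; apply/indep_on_imageP => P HP; apply: aif => x; rewrite -[RHS](HP x).
  exact: meval_eq.
exists (fun x i => (f i).@[F x]); split=> [i|]; first exact: polyfun_eval.
exact/indep_on_imageP.
Qed.

(** A polynomial that vanishes on the smaller set but not on the larger is independent of functions
    that stay independent on the smaller one. *)
Lemma indep_on_step k (B A : pset K d) (f : 'I_k -> {mpoly K[d]}) :
  prime_set A -> psubset B A -> (exists p, vanish B p /\ ~ vanish A p) -> indep_on B f ->
  exists f' : 'I_k.+1 -> {mpoly K[d]}, indep_on A f'.
Proof.
move=> prA BA [p [vp np]] aif.
pose i0 (s : {x | B x}) : {x | A x} := exist _ (sval s) (BA _ (svalP s)).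
exists (fun i => oapp f p (unlift ord0 i)); apply/indep_onP.
have := @alg_indep_fcons K _ _ i0 _ _ (fun (s : {x | A x}) i => (f i).@[sval s])
   (fun s => p.@[sval s]) (subalg_polyfun _) (prime_set_dom prA).
move=> H P HP; apply: H => //.
- by move=> i; apply: polyfun_eval.
- exact: polyfun_eval.
- exact/indep_onP.
- by move=> [x Bx] /=; apply: vp.
- by move=> H; apply: np => x Ax; apply: (H (exist _ x Ax)).
by move=> s; rewrite -[RHS](HP s); apply: meval_eq => i; rewrite /fcons; case: (unlift ord0 i).
Qed.

Lemma indep_on_of_dim_ge A k : dim_ge U A k -> exists f : 'I_k -> {mpoly K[d]}, indep_on A f.
Proof.
case=> C [irrC strict].
have H j : (j <= k)%N -> exists f : 'I_j -> {mpoly K[d]}, indep_on (C j) f.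
  elim: j => [|j IH] jk.
    have [/zirredP [_ [[x Cx] _]] _] := irrC 0%N jk.
    exists (fun _ => 0) => P HP; rewrite (nvar0_mpolyC P).
    by have := HP x Cx; rewrite {1}(nvar0_mpolyC P) mevalC => ->.
  have [f aif] := IH (ltnW jk); have [sub nsub] := strict j jk.
  have [/zirredP [clC' prC'] _] := irrC j.+1 jk.
  have [/zirredP [clC _] _] := irrC j (ltnW jk).
  apply: (indep_on_step prC' sub _ aif); apply: NNPP => H; apply: nsub => x C'x.
  move: clC => /zclosedP [_]; apply; first by move: clC' => /zclosedP [C'U _]; apply: C'U.
  by move=> p vp; apply: NNPP => px; apply: H; exists p; split=> // H; apply: px; apply: H.
have [f aif] := H k (leqnn k); exists f.
by apply: indep_on_sub aif; case: (irrC k (leqnn k)).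
Qed.

Hypothesis principalU : principal U.

(** If a product vanishes on [B] while neither factor does, cutting [B] by either factor makes [f]
    dependent by minimality; the product of the two relations would be a relation on all of [B]. *)
Lemma minimal_indep_prime k (A B : pset K d) (f : 'I_k -> {mpoly K[d]}) :
  zclosed U B -> indep_on B f ->
  (forall B', zclosed U B' -> indep_on B' f -> psubset B' B -> psubset B B') -> prime_set B.
Proof.
move=> clB aiB minB; split; first exact: indep_on_inhabited aiB.
move=> p q Hpq; apply: NNPP => H.
have sub r : ~ vanish B r -> exists P : {mpoly K[k]}, P != 0 /\
    forall x, B x -> r.@[x] = 0 -> P.@[fun i => (f i).@[x]] = 0.
  move=> nr; apply: NNPP => HP; apply: nr.
  have aiB' : indep_on (fun x => B x /\ r.@[x] = 0) f.
    move=> P HPr; apply/eqP/negPn/negP => P0; apply: HP; exists P; split=> // x Bx rx.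
    by apply: HPr.
  by move=> x Bx; have [] := minB _ (zclosed_setI r clB) aiB' (fun x H => H.1) x Bx.
have [|P [P0 HP]] := sub p; first by move=> vp; apply: H; left.
have [|Q [Q0 HQ]] := sub q; first by move=> vq; apply: H; right.
have : P * Q != 0 by rewrite mulf_neq0.
apply/negP/negPn/eqP; apply: aiB => x Bx; rewrite mevalM.
have /eqP := Hpq x Bx; rewrite mulf_eq0 => /orP [] /eqP E.
  by rewrite HP ?mul0r.
by rewrite HQ ?mulr0.
Qed.

(** The set is cut by fixing the first independent function at a value [c]. By Chevalley the others
    still take generic values on the slice, so a minimal closed subset keeping them independent is
    irreducible and loses just one function. *)
Lemma zirred_hypersurface k A (f : 'I_k.+1 -> {mpoly K[d]}) :
  zclosed U A -> prime_set A -> indep_on A f ->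
  exists B (f' : 'I_k -> {mpoly K[d]}),
    [/\ zirred U B, psubset B A, ~ psubset A B & indep_on B f'].
Proof.
move=> clA prA aif; have [g [g0 Hg]] := chevalley principalU clA prA aif.
have [x0 gx0] : exists x0, g.@[x0] != 0.
  apply: NNPP => H; move/eqP: g0; apply; apply: (mpoly_zero char0) => x.
  by apply/eqP/negPn/negP => gx; apply: H; exists x.
pose c := x0 ord0.
(* The inequation [g] restricted to first coordinate [c]; it is nonzero because [c] belongs to a
   point where [g] does not vanish. *)
pose q : {mpoly K[k]} := psubst (fun i => oapp (fun j => 'X_j) c%:MP (unlift ord0 i)) g.
have qE b : q.@[b] = g.@[fcons c b].
  rewrite psubst_eval; apply: meval_eq => i; rewrite /fcons.
  by case: (unlift ord0 i) => [j|] /=; rewrite ?mevalXU ?mevalC.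
pose f' i := f (lift ord0 i).
pose Ac x := A x /\ (f ord0 - c%:MP).@[x] = 0.
have clAc : zclosed U Ac by apply: zclosed_setI.
have aiAc : indep_on Ac f'.
  move=> P HP; have : P * q = 0.
    apply: (mpoly_zero char0) => b; rewrite mevalM qE.
    have [->|gb] := eqVneq g.@[fcons c b] 0; first by rewrite mulr0.
    have [x [Ax Ex]] := Hg _ gb.
    rewrite (_ : P.@[b] = 0) ?mul0r // -[RHS](HP x).
      by apply: meval_eq => i; rewrite Ex fconsS.
    by split=> //; rewrite mevalB mevalC Ex fcons0 subrr.
  move/eqP; rewrite mulf_eq0 => /orP [/eqP //|/eqP q0].
  by move: gx0; rewrite -(fcons_eta x0) -/c -qE q0 meval0 eqxx.
have [B [clB aiB BAc minB]] := minimal_zclosed (Q := fun B => indep_on B f') clAc aiAc.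
exists B, f'; split=> //.
- apply/zirredP; split=> //; exact: minimal_indep_prime aiB minB.
- by move=> x /BAc [].
move=> AB; have /eqP : ('X_ord0 - c%:MP : {mpoly K[k.+1]}) = 0.
  apply: aif => x /AB /BAc [_]; rewrite !mevalB mevalXU !mevalC; exact.
move=> /eqP E0; have := congr1 (fun p : {mpoly K[k.+1]} => p.@[fun=> c + 1]) E0.
by rewrite meval0 mevalB mevalXU mevalC addrAC subrr add0r => /eqP; rewrite oner_eq0.
Qed.

Lemma dim_ge_of_indep_on A k (f : 'I_k -> {mpoly K[d]}) :
  zclosed U A -> prime_set A -> indep_on A f -> dim_ge U A k.
Proof.
elim: k A f => [|k IH] A f clA prA aif.
  exists (fun=> A); split=> // j _; split; [exact/zirredP|by move=> x].
have [B [f' [/zirredP [clB prB] BA nAB aiB]]] := zirred_hypersurface clA prA aif.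
have [C [irrC strict]] := IH B f' clB prB aiB.
exists (fun j => if (j <= k)%N then C j else A); split=> j jk.
  case: ifP => jk'; last by split; [exact/zirredP|move=> x].
  by have [? CB] := irrC j jk'; split=> // x /CB /BA.
have jk' : (j <= k)%N by [].
rewrite jk'; case: ifP => jk1; first exact: strict.
have -> : j = k by lia.
have [_ CB] := irrC k (leqnn k).
by split=> [x /CB /BA //|AC]; apply: nAB => x /AC /CB.
Qed.

(** The dictionary through which dimensions of closures of images are computed from here on. *)
Lemma dim_ge_image X (F : X -> 'I_d -> K) k : inhabited X -> dom (polyfun F) ->
  (forall x, U (F x)) -> dim_ge U (zclosure U (pimage F)) k <-> trdeg_ge (polyfun F) k.
Proof.
move=> X0 dF FU; have imU : psubset (pimage F) U by move=> _ [x ->].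
rewrite trdeg_polyfunP; split=> [/indep_on_of_dim_ge [f]|[f aif]].
  by move/(indep_on_closure imU); exists f.
apply: (dim_ge_of_indep_on (zclosed_closure _ _) (prime_set_closure imU (prime_set_image X0 dF))).
by apply: indep_on_sub aif => x Fx; split=> [|p]; [exact: imU|apply=> //; exact: imU].
Qed.

Lemma zirred_image X (F : X -> 'I_d -> K) : inhabited X -> dom (polyfun F) ->
  (forall x, U (F x)) -> zirred U (zclosure U (pimage F)).
Proof.
move=> X0 dF FU; have imU : psubset (pimage F) U by move=> _ [x ->].
apply/zirredP; split; first exact: zclosed_closure.
exact: prime_set_closure (prime_set_image X0 dF).
Qed.

End Chains.
End Dimension.

(** * Density of the graph of the involution *)

Section Pairs.
Variable K : fieldType.

Lemma Gmk_l m (z w : 'I_m -> K) i : Gmk z w (lshift m i) = z i.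
Proof. by rewrite /Gmk (unsplitK (inl i)). Qed.

Lemma Gmk_r m (z w : 'I_m -> K) i : Gmk z w (rshift m i) = w i.
Proof. by rewrite /Gmk (unsplitK (inr i)). Qed.

Lemma Gz_Gmk m (z w : 'I_m -> K) : Gz (Gmk z w) = z.
Proof. by apply: functional_extensionality => i; rewrite /Gz Gmk_l. Qed.

Lemma Gw_Gmk m (z w : 'I_m -> K) : Gw (Gmk z w) = w.
Proof. by apply: functional_extensionality => i; rewrite /Gw Gmk_r. Qed.

Lemma Gmk_eta m (x : 'I_(m + m) -> K) : Gmk (Gz x) (Gw x) = x.
Proof.
apply: functional_extensionality => j; rewrite -(splitK j); case: (split j) => i /=.
  by rewrite Gmk_l.
by rewrite Gmk_r.
Qed.

Lemma Gmk_ind m (P : 'I_(m + m) -> Prop) :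
  (forall i, P (lshift m i)) -> (forall i, P (rshift m i)) -> forall j, P j.
Proof. by move=> Pl Pr j; rewrite -(splitK j); case: (split j) => i /=. Qed.

(* For fixed y the functions of x form a domain, so X * Y is covered by the y for which p(-, y)
   vanishes and those for which q(-, y) does. *)
Lemma dom_pair (X Y : Type) d (F1 : X -> 'I_d -> K) (F2 : Y -> 'I_d -> K) :
  dom (polyfun F1) -> dom (polyfun F2) ->
  dom (polyfun (fun xy : X * Y => Gmk (F1 xy.1) (F2 xy.2))).
Proof.
move=> d1 d2 phi psi [p Ep] [q Eq] H.
have fixy y (r : {mpoly K[d + d]}) : polyfun F1 (fun x => r.@[Gmk (F1 x) (F2 y)]).
  exists (psubst (fun j => match split j with inl i => 'X_i | inr i => (F2 y i)%:MP end) r) => x.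
  rewrite psubst_eval; apply: meval_eq => j; rewrite /Gmk.
  by case: (split j) => i; rewrite ?mevalXU ?mevalC.
have fixx x (r : {mpoly K[d + d]}) : polyfun F2 (fun y => r.@[Gmk (F1 x) (F2 y)]).
  exists (psubst (fun j => match split j with inl i => (F1 x i)%:MP | inr i => 'X_i end) r) => y.
  rewrite psubst_eval; apply: meval_eq => j; rewrite /Gmk.
  by case: (split j) => i; rewrite ?mevalXU ?mevalC.
have Hy y : (forall x, p.@[Gmk (F1 x) (F2 y)] = 0) \/ (forall x, q.@[Gmk (F1 x) (F2 y)] = 0).
  by apply: d1 => // x; rewrite -[RHS](H (x, y)) Ep Eq.
apply: NNPP => Hn; have [Hp|[[x1 y1] Hp]] : (forall z, phi z = 0) \/ exists z, phi z <> 0.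
- by case: (classic (exists z, phi z <> 0)) => E; [right|left=> z; apply: NNPP => Hz; apply: E; exists z].
- by apply: Hn; left.
have [Hq|[[x2 y2] Hq]] : (forall z, psi z = 0) \/ exists z, psi z <> 0.
- by case: (classic (exists z, psi z <> 0)) => E; [right|left=> z; apply: NNPP => Hz; apply: E; exists z].
- by apply: Hn; right.
have [y|E|E] := d2 _ _ (fixx x1 p) (fixx x2 q).
- by case: (Hy y) => ->; rewrite ?mul0r ?mulr0.
- by apply: Hp; rewrite Ep E.
- by apply: Hq; rewrite Eq E.
Qed.

End Pairs.

Section Conjugation.
Variable K : closedFieldType.
Hypothesis char0 : [pchar K] =i pred0.
Variable sigma : {rmorphism K -> K}.
Hypothesis sigmaK : forall x, sigma (sigma x) = x.
Hypothesis sigma_nontriv : exists x, sigma x != x.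

Lemma char0_two : (2%:R : K) != 0.
Proof. by rewrite ((pcharf0P K).1 char0). Qed.

Lemma anti_invariant : exists j : K, sigma j = - j /\ j != 0.
Proof.
have [x sx] := sigma_nontriv; exists (x - sigma x).
by rewrite rmorphB sigmaK opprB subr_eq0 eq_sym.
Qed.

Lemma closed_sqrt (x : K) : exists y, y ^+ 2 = x.
Proof.
have /closed_rootP [y] : size ('X^2 - x%:P : {poly K}) != 1%N by rewrite size_XnsubC.
by rewrite rootE hornerD hornerN hornerXn hornerC subr_eq0 => /eqP; exists y.
Qed.

(** For anti-invariant j with square root y, the norm y sigma(y) is invariant with square -j^2. If
    t^2 = -1 this is the square of the anti-invariant t j, so the two agree up to sign, which makes
    t j invariant and hence zero. *)
Lemma fixed_sqr_neqN1 (t : K) : sigma t = t -> t ^+ 2 != -1.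
Proof.
move=> st; apply/eqP => t2; have [j [sj j0]] := anti_invariant.
have [y y2] := closed_sqrt j.
have E : (y * sigma y) ^+ 2 = (t * j) ^+ 2.
  by rewrite !exprMn -rmorphXn y2 sj t2; ring.
have sE : sigma (y * sigma y) = y * sigma y by rewrite rmorphM sigmaK mulrC.
have stj : sigma (t * j) = - (t * j) by rewrite rmorphM st sj mulrN.
have t0 : t != 0 by apply/eqP => t0; move: t2; rewrite t0 expr0n => /eqP; rewrite eq_sym oppr_eq0 oner_eq0.
have H (z : K) : sigma z = z -> sigma z = - z -> z = 0.
  move=> -> /eqP; rewrite -subr_eq0 opprK -mulr2n -mulr_natr mulf_eq0 (negPf char0_two) orbF.
  by move/eqP.
have /eqP : t * j = 0; last by rewrite mulf_eq0 (negPf t0) (negPf j0).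
move/eqP: E; rewrite eqf_sqr => /orP [] /eqP E.
  by apply: H => //; rewrite -E.
by apply: H => //; rewrite -[t * j]opprK -E rmorphN sE.
Qed.

Lemma is_abs_square (u : K) : is_abs sigma (u ^+ 2) (u * sigma u).
Proof.
split; first by rewrite rmorphXn exprMn.
  by rewrite rmorphM sigmaK mulrC.
have [v <-] := closed_sqrt u; exists (v * sigma v); split; first by rewrite rmorphM sigmaK mulrC.
by rewrite rmorphXn exprMn.
Qed.

(** Two candidates agree up to sign, and opposite ones would make -1 the square of the invariant
    element t / t'. *)
Lemma is_abs_unique (w s s' : K) : w != 0 -> is_abs sigma w s -> is_abs sigma w s' -> s = s'.
Proof.
move=> w0 [s2 ss [t [st Et]]] [s'2 ss' [t' [st' Et']]].
have sw0 : sigma w != 0 by rewrite fmorph_eq0.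
have s'0 : s' != 0.
  by apply/eqP => s'0; move/eqP: s'2; rewrite s'0 expr0n eq_sym mulf_eq0 (negPf w0) (negPf sw0).
have t'0 : t' != 0 by apply/eqP => E; move: s'0; rewrite Et' E expr0n eqxx.
move/eqP: s2; rewrite -s'2 eqf_sqr => /orP [/eqP //|/eqP E].
have stt : sigma (t / t') = t / t' by rewrite fmorph_div /= st st'.
case/eqP: (fixed_sqr_neqN1 stt).
by rewrite expr_div_n -Et -Et' E; field.
Qed.

Lemma conj_eval d (p : {mpoly K[d]}) x :
  (map_mpoly sigma p).@[fun i => sigma (x i)] = sigma p.@[x].
Proof.
elim/mpoly_ring_ind: p => [c|i|p q Ep Eq|p q Ep Eq].
- by rewrite map_mpolyC /= ?rmorph0 // !mevalC.
- by rewrite map_mpolyX !mevalXU.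
- by rewrite rmorphD !mevalD rmorphD Ep Eq.
- by rewrite rmorphM !mevalM rmorphM Ep Eq.
Qed.

Lemma conjK_eval d (p : {mpoly K[d]}) x :
  p.@[fun i => sigma (x i)] = sigma (map_mpoly sigma p).@[x].
Proof.
rewrite -conj_eval; congr (_.@[_]); apply/mpolyP => m.
by rewrite !mcoeff_map_mpoly /= sigmaK.
Qed.

Definition conjf X d (F : X -> 'I_d -> K) : X -> 'I_d -> K := fun x i => sigma (F x i).

Lemma polyfun_conj X d (F : X -> 'I_d -> K) phi :
  polyfun F phi -> polyfun (conjf F) (fun x => sigma (phi x)).
Proof. by case=> p Ep; exists (map_mpoly sigma p) => x; rewrite conj_eval Ep. Qed.

Lemma dom_conj X d (F : X -> 'I_d -> K) : dom (polyfun F) -> dom (polyfun (conjf F)).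
Proof.
move=> dF phi psi [p Ep] [q Eq] H.
have [x|E|E] := dF _ _ (polyfun_eval F (map_mpoly sigma p)) (polyfun_eval F (map_mpoly sigma q)).
- by apply: (fmorph_inj sigma); rewrite rmorphM -!conjK_eval -Ep -Eq H rmorph0.
- by left=> x; rewrite Ep conjK_eval E rmorph0.
- by right=> x; rewrite Eq conjK_eval E rmorph0.
Qed.

Lemma alg_indep_conj X k (f : X -> 'I_k -> K) : alg_indep f -> alg_indep (conjf f).
Proof.
move=> aif P HP; have E : map_mpoly sigma P = 0.
  by apply: aif => x; apply: (fmorph_inj sigma); rewrite -conjK_eval HP rmorph0.
by apply: (mpoly_zero char0) => x; rewrite -[x]/(fun i => x i) (_ : (fun i => x i) = fun i => sigma (sigma (x i)));
  [rewrite conjK_eval E meval0 rmorph0|apply: functional_extensionality => i; rewrite sigmaK].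
Qed.

Lemma trdeg_conj X d (F : X -> 'I_d -> K) k :
  trdeg_ge (polyfun F) k -> trdeg_ge (polyfun (conjf F)) k.
Proof.
case=> f [Ff aif]; exists (conjf f); split=> [i|]; last exact: alg_indep_conj.
exact: polyfun_conj (Ff i).
Qed.

Lemma algebraic_over_conj X k (g : X -> 'I_k -> K) phi :
  algebraic_over g phi -> algebraic_over (conjf g) (fun x => sigma (phi x)).
Proof.
case=> R [[i [x Rx]] HR]; exists (map_poly (map_mpoly sigma) R); split.
  by exists i, x; rewrite coef_map /= conj_eval fmorph_eq0.
move=> y; rewrite -[RHS](rmorph0 sigma) -(HR y) /ev2 -horner_map -!map_poly_comp.
by congr (_.[_]); apply: eq_map_poly => p /=; rewrite conj_eval.
Qed.

(** It suffices to use points a + j b with natural a and b, whose conjugates are a - j b. The linear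
    substitution is invertible since 2 and j are nonzero. *)
Lemma conj_graph_zero e (Q : {mpoly K[e + e]}) :
  (forall t, Q.@[Gmk t (fun i => sigma (t i))] = 0) -> Q = 0.
Proof.
move=> H; have [j [sj j0]] := anti_invariant.
pose Q' : {mpoly K[e + e]} := psubst (fun l => match split l with
  | inl i => 'X_(lshift e i) + j%:MP * 'X_(rshift e i)
  | inr i => 'X_(lshift e i) - j%:MP * 'X_(rshift e i) end) Q.
have Q'E a : Q'.@[a] = Q.@[Gmk (fun i => Gz a i + j * Gw a i) (fun i => Gz a i - j * Gw a i)].
  rewrite psubst_eval; apply: meval_eq => l; rewrite /Gmk; case: (split l) => i.
    by rewrite mevalD mevalM mevalC !mevalXU.
  by rewrite mevalB mevalM mevalC !mevalXU.
have Q'0 : Q' = 0.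
  apply: (mpoly_nat_zero char0) => a; rewrite Q'E -[RHS](H (fun i => (a (lshift e i))%:R + j * (a (rshift e i))%:R)).
  by congr (_.@[Gmk _ _]); apply: functional_extensionality => i; rewrite rmorphD rmorphM !rmorph_nat sj mulNr.
apply: (mpoly_zero char0) => y.
have := Q'E (Gmk (fun i => (Gz y i + Gw y i) / 2%:R) (fun i => (Gz y i - Gw y i) / (2%:R * j))).
rewrite Q'0 meval0 Gz_Gmk Gw_Gmk => E; have := char0_two => two0.
rewrite [RHS]E -{1}(Gmk_eta y).
by congr (_.@[Gmk _ _]); apply: functional_extensionality => i; field; rewrite ?two0 ?j0.
Qed.

(* A transcendence basis f of S, together with its conjugate, is a transcendence basis of
   S x sigma(S); it stays algebraically independent on the graph of sigma, as f takes generic values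
   by Chevalley. *)
Theorem conj_graph_dense d (U S : pset K d) (p : {mpoly K[d + d]}) :
  principal U -> zclosed U S -> prime_set S ->
  (forall x, S x -> p.@[Gmk x (fun i => sigma (x i))] = 0) ->
  forall x y, S x -> S y -> p.@[Gmk x (fun i => sigma (y i))] = 0.
Proof.
move=> pU clS prS Hp; pose X := {x | S x}; pose F1 (x : X) := sval x.
have [[x0 Sx0] _] := prS; have dF1 : dom (polyfun F1) := prime_set_dom prS.
have X0 : inhabited X := inhabits (exist _ x0 Sx0).
have [e [/trdeg_polyfunP [f aif] mx]] := trdeg_max X0 (trdeg_polyfun_bound dF1).
have {}aif : indep_on S f.
  by apply: indep_on_sub aif => _ [[y Sy] ->].
pose F (xy : X * X) := Gmk (F1 xy.1) (conjf F1 xy.2).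
have dF : dom (polyfun F) by apply: dom_pair => //; apply: dom_conj.
pose fX (x : X) i := (f i).@[F1 x].
pose g (xy : X * X) := Gmk (fX xy.1) (conjf fX xy.2).
have gF i : polyfun F (fun x => g x i).
  elim/Gmk_ind: i => i.
    exists (psubst (fun i => 'X_(lshift d i)) (f i)) => xy.
    by rewrite /g Gmk_l psubst_eval; apply: meval_eq => l; rewrite mevalXU /F Gmk_l.
  exists (psubst (fun i => 'X_(rshift d i)) (map_mpoly sigma (f i))) => xy.
  rewrite /g Gmk_r /conjf -conj_eval psubst_eval.
  by apply: meval_eq => l; rewrite mevalXU /F Gmk_r.
(* On the diagonal the second half of [g] is the conjugate of the first half, so a relation there,
   multiplied by the Chevalley inequation, vanishes at every pair (t, sigma(t)). *)
have aigd : alg_indep (fun x : X => g (x, x)).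
  have [g0 [g0n Hg0]] := chevalley char0 pU clS prS aif.
  move=> Q HQ; pose g0' : {mpoly K[e + e]} := psubst (fun i => 'X_(lshift e i)) g0.
  have g0'E a b : g0'.@[Gmk a b] = g0.@[a].
    by rewrite psubst_eval; apply: meval_eq => i; rewrite mevalXU Gmk_l.
  have : Q * g0' = 0.
    apply: conj_graph_zero => t; rewrite mevalM g0'E.
    have [->|g0t] := eqVneq g0.@[t] 0; first by rewrite mulr0.
    have [x [Sx Ex]] := Hg0 t g0t; rewrite (_ : Q.@[_] = 0) ?mul0r //.
    rewrite -[RHS](HQ (exist _ x Sx)); congr (_.@[Gmk _ _]).
      by apply: functional_extensionality => i; rewrite -Ex.
    by apply: functional_extensionality => i; rewrite -Ex.
  move/eqP; rewrite mulf_eq0 => /orP [/eqP //|/eqP E].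
  case/eqP: g0n; apply: (mpoly_zero char0) => a.
  by rewrite -(g0'E a a) E meval0.
have alg_g j : algebraic_over g (fun xy => F xy j).
  have fx i : algebraic_over fX (fun x => F1 x i).
    apply: algebraic_over_of_max mx _ _ (polyfun_coord F1 i); first by move=> l; apply: polyfun_eval.
    by move/indep_onP: aif.
  elim/Gmk_ind: j => i.
    have := algebraic_over_pull (pi := fst) (g' := g) (s := @lshift e e) _ _ (fx i).
    under [fun y => F y _]functional_extensionality => y do rewrite /F Gmk_l.
    apply=> [x|xy l]; first by exists (x, x).
    by rewrite /g Gmk_l.
  have := algebraic_over_pull (pi := snd) (g' := g) (s := @rshift e e) _ _ (algebraic_over_conj (fx i)).
  under [fun y => F y _]functional_extensionality => y do rewrite /F Gmk_r.
  apply=> [x|xy l]; first by exists (x, x).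
  by rewrite /g Gmk_r.
(* Since [p] vanishes on the diagonal, where [g] stays independent, a nonzero [p] would be
   independent of [g] on the product; but everything there is algebraic over the e + e members of
   [g]. *)
have Hpp : forall xy, p.@[F xy] = 0.
  apply: NNPP => Hn.
  have := alg_dependent_of_algebraic (subalg_polyfun F) dF gF (polyfun_coord F) alg_g
    (f := fun xy => fcons p.@[F xy] (g xy)) => /(_ _) [] //.
    move=> i; rewrite /fcons; case: unliftP => [j _|_] /=; [exact: gF|exact: polyfun_eval].
  apply: (alg_indep_fcons (iota := fun x : X => (x, x)) (subalg_polyfun F) dF gF (polyfun_eval F p) aigd) => //.
  by case=> x Sx; apply: Hp.
by move=> x y Sx Sy; apply: (Hpp (exist _ x Sx, exist _ y Sy)).
Qed.

End Conjugation.

(** * Square roots and the realisation map *)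

Section SquaringCover.
Variable K : closedFieldType.
Variables (d : nat) (U : pset K d).

Definition sqc (j : 'I_d) (x : 'I_d -> K) : 'I_d -> K :=
  fun i => if i == j then x i ^+ 2 else x i.

Lemma sqc_decomp j (h : {mpoly K[d]}) : exists h0 h1 : {mpoly K[d]}, forall x,
  h.@[x] = h0.@[sqc j x] + x j * h1.@[sqc j x].
Proof.
have sqj x : ('X_j : {mpoly K[d]}).@[sqc j x] = x j ^+ 2 by rewrite mevalXU /sqc eqxx.
elim/mpoly_ring_ind: h => [c|i|p q [p0 [p1 Ep]] [q0 [q1 Eq]]|p q [p0 [p1 Ep]] [q0 [q1 Eq]]].
- by exists c%:MP, 0 => x; rewrite meval0 !mevalC mulr0 addr0.
- have [->|ij] := eqVneq i j.
    by exists 0, 1 => x; rewrite meval0 meval1 mevalXU add0r mulr1.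
  by exists 'X_i, 0 => x; rewrite meval0 !mevalXU mulr0 addr0 /sqc (negPf ij).
- by exists (p0 + q0), (p1 + q1) => x; rewrite !mevalD Ep Eq; ring.
exists (p0 * q0 + 'X_j * (p1 * q1)), (p0 * q1 + p1 * q0) => x.
by rewrite !mevalD !mevalM sqj Ep Eq; ring.
Qed.

Hypothesis U_sqc : forall j x, U (sqc j x) <-> U x.

(** Squaring one coordinate has degree two, so a polynomial vanishing on [A] has a norm h0^2 - X_j
    h1^2, the product of its values at the two square roots, which vanishes on the image. If neither
    root over [y] lies in [A], some norm is nonzero at [y]. *)
Lemma zclosed_sqc j A : zclosed U A -> zclosed U (fun y => exists x, A x /\ y = sqc j x).
Proof.
move=> /zclosedP [AU clA]; apply/zclosedP; split=> [_ [x [Ax ->]]|y Uy Hy].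
  by apply/U_sqc; apply: AU.
have [t t2] := closed_sqrt (y j).
pose pt (s : K) : 'I_d -> K := fun i => if i == j then s else y i.
have sqpt s : s ^+ 2 = y j -> sqc j (pt s) = y.
  move=> s2; apply: functional_extensionality => i; rewrite /sqc /pt.
  by case: eqP => // ->.
have st : sqc j (pt t) = y by apply: sqpt.
have sNt : sqc j (pt (- t)) = y by apply: sqpt; rewrite sqrrN.
apply: NNPP => H.
have out s : sqc j (pt s) = y -> exists f, vanish A f /\ f.@[pt s] <> 0.
  move=> sy; apply: NNPP => Hf; apply: H; exists (pt s); split=> //.
  apply: clA; first by apply/(U_sqc j); rewrite sy.
  by move=> p vp; apply: NNPP => ps; apply: Hf; exists p.
have [f [vf /eqP ft]] := out _ st; have [g [vg /eqP gt]] := out _ sNt.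
(* If each of [f] and [g] vanishes at the root where the other one does not, their sum is nonzero at
   both roots. *)
have [h [vh ht hNt]] : exists h, [/\ vanish A h, h.@[pt t] != 0 & h.@[pt (- t)] != 0].
  case: (eqVneq f.@[pt (- t)] 0) => [fNt|]; last by exists f.
  case: (eqVneq g.@[pt t] 0) => [gt0|]; last by exists g.
  exists (f + g); rewrite !mevalD fNt gt0 addr0 add0r; split=> //.
  by apply: (idealD (ideal_vanish A)).
have [h0 [h1 Eh]] := sqc_decomp j h.
have ptj s : pt s j = s by rewrite /pt eqxx.
have : (h0 ^+ 2 - 'X_j * h1 ^+ 2).@[y] = h.@[pt t] * h.@[pt (- t)].
  rewrite !Eh st sNt !ptj mevalB rmorphXn mevalM rmorphXn /= mevalXU -t2; ring.
rewrite Hy; first by move/esym/eqP; rewrite mulf_eq0 (negPf ht) (negPf hNt).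
move=> _ [x [Ax ->]]; have := vh x Ax; rewrite Eh => /eqP; rewrite addr_eq0 => /eqP E.
by rewrite mevalB rmorphXn mevalM rmorphXn /= mevalXU E /sqc eqxx; ring.
Qed.

(* A minimal closed subset of the preimage of V still mapping onto V is irreducible, because
   squaring a coordinate is a closed map. *)
Lemma irreducible_sqc_cover j V : zirred U V -> exists V1,
  [/\ zirred U V1, forall x, V1 x -> V (sqc j x) & forall y, V y -> exists x, V1 x /\ y = sqc j x].
Proof.
move=> irrV; have [clV [v0 Vv0] irr] := irrV; have /zclosedP [VU clV'] := clV.
pose Y x := U x /\ V (sqc j x).
have clY : zclosed U Y.
  apply/zclosedP; split=> [x []//|x Ux Hx]; split=> //; apply: clV'; first exact/U_sqc.
  move=> p vp.
  pose p' : {mpoly K[d]} := psubst (fun i => if i == j then 'X_i ^+ 2 else 'X_i) p.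
  have p'E z : p'.@[z] = p.@[sqc j z].
    rewrite psubst_eval; apply: meval_eq => i; rewrite /sqc; case: ifP => _.
      by rewrite rmorphXn /= mevalXU.
    by rewrite mevalXU.
  by rewrite -p'E; apply: Hx => z [_ Vz]; rewrite p'E; apply: vp.
pose onto (B : pset K d) := forall y, V y -> exists x, B x /\ y = sqc j x.
have ontoY : onto Y.
  move=> y Vy; have [t t2] := closed_sqrt (y j).
  pose x i := if i == j then t else y i; have E : y = sqc j x.
    apply: functional_extensionality => i; rewrite /sqc /x; by case: eqP => // ->.
  exists x; split=> //; split; last by rewrite -E.
  by apply/(U_sqc j); rewrite -E; apply: VU.
have [B [clB ontoB BY minB]] := minimal_zclosed clY ontoY.
exists B; split=> //; last by move=> x /BY [].
apply/zirredP; split=> //; split; first by have [x [Bx _]] := ontoB v0 Vv0; exists x.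
move=> p q Hpq.
pose Bz r x := B x /\ (r : {mpoly K[d]}).@[x] = 0.
have clBz r : zclosed U (Bz r) by apply: zclosed_setI.
have vanishB r : onto (Bz r) -> vanish B r.
  by move=> or x /(minB _ (clBz r) or (fun x H => H.1)) [].
have [|H|H] := irr _ _ (zclosed_sqc j (clBz p)) (zclosed_sqc j (clBz q)).
- move=> y /ontoB [x [Bx ->]]; have /eqP := Hpq x Bx; rewrite mulf_eq0.
  by case/orP => /eqP E; [left|right]; exists x.
- by left; apply: vanishB => y Vy; apply: H.
- by right; apply: vanishB => y Vy; apply: H.
Qed.

Lemma irreducible_sq_cover (s : seq 'I_d) V : uniq s -> zirred U V -> exists V1,
  [/\ zirred U V1, forall x, V1 x -> V (fun i => if i \in s then x i ^+ 2 else x i) &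
   forall y, V y -> exists x, V1 x /\ y = (fun i => if i \in s then x i ^+ 2 else x i)].
Proof.
elim: s V => [|j s IH] V /=.
  by move=> _ irrV; exists V; split=> // y Vy; exists y.
move=> /andP [js us] irrV; have [V1 [irrV1 V1V VV1]] := IH V us irrV.
have [V2 [irrV2 V2V1 V1V2]] := irreducible_sqc_cover j irrV1.
have E x : (fun i => if i \in s then sqc j x i ^+ 2 else sqc j x i) =
           (fun i => if i \in j :: s then x i ^+ 2 else x i).
  apply: functional_extensionality => i; rewrite inE /sqc.
  by case: (eqVneq i j) => [->|_] //; rewrite (negPf js).
exists V2; split=> // [x /V2V1 /V1V|y Vy]; first by rewrite E.
have [x1 [V1x1 ->]] := VV1 y Vy; have [x [V2x ->]] := V1V2 x1 V1x1.
by exists x; rewrite E.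
Qed.

End SquaringCover.

(** * The realisation map on the cover by square roots *)

Section CheckParametrisation.
Variable K : closedFieldType.
Hypothesis char0 : [pchar K] =i pred0.
Variable sigma : {rmorphism K -> K}.
Hypothesis sigmaK : forall x, sigma (sigma x) = x.
Hypothesis sigma_nontriv : exists x, sigma x != x.

Lemma principal_inG m : principal (@inG K m).
Proof.
exists (\prod_i 'X_(rshift m i)) => x; rewrite rmorph_prod; split=> [Hx|/prodf_neq0 H i].
  by apply/prodf_neq0 => i _; rewrite /= mevalXU; apply: Hx.
by have := H i isT; rewrite /= mevalXU.
Qed.

Definition sqw m (x : 'I_(m + m) -> K) : 'I_(m + m) -> K := Gmk (Gz x) (fun i => Gw x i ^+ 2).

Lemma multiplicative_sq_cover n (V : pset K (n + n)) : zirred (inG n) V -> exists V1,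
  [/\ zirred (inG n) V1, forall x, V1 x -> V (sqw x) & forall y, V y -> exists x, V1 x /\ y = sqw x].
Proof.
pose s := [seq rshift n i | i <- enum 'I_n].
have us : uniq s by rewrite map_inj_uniq ?enum_uniq //; exact: rshift_inj.
have E x : (fun i => if i \in s then x i ^+ 2 else x i) = sqw x.
  apply: functional_extensionality; apply: Gmk_ind => i; rewrite /sqw ?Gmk_l ?Gmk_r.
    case: ifP => // /mapP [l _ /(congr1 val) /= E]; have := ltn_ord i; rewrite E.
    by rewrite ltnNge leq_addr.
  by rewrite map_f ?mem_enum.
have U_sqc (j : 'I_(n + n)) (x : 'I_(n + n) -> K) : inG n (sqc j x) <-> inG n x.
  by split=> H i; have := H i; rewrite /Gw /sqc; case: (_ == j); rewrite ?sqrf_eq0.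
move/(irreducible_sq_cover U_sqc us) => [V1 [irrV1 H1 H2]].
exists V1; split=> // [x /H1|y /H2 [x]]; first by rewrite E.
by rewrite E => Hx; exists x.
Qed.

(* On points (z, u), (z', u') of the cover w = u^2 the modulus is u u' and the phase u / u' when
   (z', u') is the conjugate of (z, u). *)
Definition realise n (x y : 'I_(n + n) -> K) : 'I_((n + n) + (n + n)) -> K :=
  Gmk (Gmk (fun i => (Gz x i + Gz y i) / 2) (fun i => (Gz x i - Gz y i) / 2))
      (Gmk (fun i => Gw x i * Gw y i) (fun i => Gw x i / Gw y i)).

Definition conj_pt d (x : 'I_d -> K) : 'I_d -> K := fun i => sigma (x i).

(** Uniqueness of the modulus forces [s i] to be u sigma(u), which turns the existentially described
    realisation into the image of a map. *)
Lemma realset_cover n (V V1 : pset K (n + n)) : psubset V1 (inG n) ->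
  (forall x, V1 x -> V (sqw x)) -> (forall y, V y -> exists x, V1 x /\ y = sqw x) ->
  forall y, realset sigma V y <-> exists x, V1 x /\ y = realise x (conj_pt x).
Proof.
move=> V1G V1V VV1 y.
have realE x (s : 'I_n -> K) : inG n x -> (forall i, s i = Gw x i * sigma (Gw x i)) ->
   Gmk (fun k => match split k with
                    | inl i => (Gz (sqw x) i + sigma (Gz (sqw x) i)) / 2
                    | inr i => (Gz (sqw x) i - sigma (Gz (sqw x) i)) / 2 end)
          (fun k => match split k with
                    | inl i => s i
                    | inr i => Gw (sqw x) i / s i end) = realise x (conj_pt x).
  move=> Gx Es; rewrite /realise /sqw Gz_Gmk Gw_Gmk; congr Gmk.
  apply: functional_extensionality => k; rewrite /Gmk; case: (split k) => i //.
  rewrite Es /conj_pt /Gw -!/(Gw _ _).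
  have u0 := Gx i; have su0 : sigma (Gw x i) != 0 by rewrite fmorph_eq0.
  by rewrite expr2 invfM mulrACA mulfV // mul1r.
split=> [[x [Vx [s [Hs ->]]]]|[x [V1x ->]]].
  have [x1 [V1x1 Ex]] := VV1 x Vx; exists x1; split=> //; rewrite Ex; apply: realE.
    exact: V1G.
  move=> i; have := is_abs_square sigmaK (Gw x1 i); have := Hs i.
  rewrite Ex /sqw Gw_Gmk => H1 H2; apply: (is_abs_unique char0 sigmaK sigma_nontriv _ H1 H2).
  by rewrite sqrf_eq0; apply: V1G.
exists (sqw x); split; first exact: V1V.
exists (fun i => Gw x i * sigma (Gw x i)); split.
  by move=> i; rewrite /sqw Gw_Gmk; apply: is_abs_square.
by rewrite realE //; apply: V1G.
Qed.

Lemma Vcheck_cover n (V V1 : pset K (n + n)) : psubset V1 (inG n) ->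
  (forall x, V1 x -> V (sqw x)) -> (forall y, V y -> exists x, V1 x /\ y = sqw x) ->
  Vcheck sigma V = zclosure (inG (n + n))
    (pimage (fun x : {x | V1 x} => realise (sval x) (conj_pt (sval x)))).
Proof.
move=> V1G V1V VV1; rewrite /Vcheck; congr zclosure; apply: functional_extensionality => y.
apply: propositional_extensionality; rewrite (realset_cover V1G V1V VV1).
by split=> [[x [V1x ->]]|[[x V1x] ->]]; [exists (exist _ x V1x)|exists x].
Qed.

End CheckParametrisation.

(** * Integer matrices acting on G *)

Section Action.
Variable K : fieldType.

Lemma Gz_act k m (M : 'M[int]_(k, m)) (x : 'I_(m + m) -> K) i :
  Gz (act M x) i = \sum_j (Gz x j) *~ M i j.
Proof. by rewrite /act Gz_Gmk. Qed.

Lemma Gw_act k m (M : 'M[int]_(k, m)) (x : 'I_(m + m) -> K) i :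
  Gw (act M x) i = \prod_j (Gw x j) ^ (M i j).
Proof. by rewrite /act Gw_Gmk. Qed.

Lemma G_ext m (x y : 'I_(m + m) -> K) :
  (forall i, Gz x i = Gz y i) -> (forall i, Gw x i = Gw y i) -> x = y.
Proof.
move=> Hz Hw; rewrite -(Gmk_eta x) -(Gmk_eta y).
by congr Gmk; apply: functional_extensionality.
Qed.

Lemma inG_act k m (M : 'M[int]_(k, m)) (x : 'I_(m + m) -> K) : inG m x -> inG k (act M x).
Proof.
move=> Gx i; rewrite Gw_act; apply/prodf_neq0 => j _; exact: expfz_neq0.
Qed.

Lemma expfz_sum (I : Type) (r : seq I) (w : K) (n : I -> int) : w != 0 ->
  w ^ (\sum_(i <- r) n i) = \prod_(i <- r) w ^ n i.
Proof.
move=> w0; elim: r => [|i r IH]; first by rewrite !big_nil expr0z.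
by rewrite !big_cons expfzDr // IH.
Qed.

Lemma expfz_prod (I : Type) (r : seq I) (w : I -> K) (n : int) :
  (\prod_(i <- r) w i) ^ n = \prod_(i <- r) w i ^ n.
Proof.
elim: r => [|i r IH]; first by rewrite !big_nil exp1rz.
by rewrite !big_cons expfzMl IH.
Qed.

Lemma act_mul l k m (E : 'M[int]_(l, k)) (N : 'M[int]_(k, m)) (x : 'I_(m + m) -> K) :
  inG m x -> act E (act N x) = act (E *m N) x.
Proof.
move=> Gx; apply: G_ext => i.
  rewrite !Gz_act; under eq_bigr => j _ do rewrite Gz_act mulrz_suml.
  rewrite exchange_big /=; apply: eq_bigr => j _; rewrite mxE mulrz_sumr.
  by apply: eq_bigr => a _; rewrite mulrzA_C.
rewrite !Gw_act; under eq_bigr => j _ do rewrite Gw_act expfz_prod.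
rewrite exchange_big /=; apply: eq_bigr => j _; rewrite mxE expfz_sum; last exact: Gx.
by apply: eq_bigr => a _; rewrite exprz_exp; congr (_ ^ _); apply: mulrC.
Qed.

Definition gmul m (a b : 'I_(m + m) -> K) : 'I_(m + m) -> K :=
  Gmk (fun i => Gz a i + Gz b i) (fun i => Gw a i * Gw b i).

Definition ginv m (a : 'I_(m + m) -> K) : 'I_(m + m) -> K :=
  Gmk (fun i => - Gz a i) (fun i => (Gw a i)^-1).

Lemma Gz_gmul m (a b : 'I_(m + m) -> K) i : Gz (gmul a b) i = Gz a i + Gz b i.
Proof. by rewrite /gmul Gz_Gmk. Qed.
Lemma Gw_gmul m (a b : 'I_(m + m) -> K) i : Gw (gmul a b) i = Gw a i * Gw b i.
Proof. by rewrite /gmul Gw_Gmk. Qed.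

Lemma Gz_ginv m (a : 'I_(m + m) -> K) i : Gz (ginv a) i = - Gz a i.
Proof. by rewrite /ginv Gz_Gmk. Qed.
Lemma Gw_ginv m (a : 'I_(m + m) -> K) i : Gw (ginv a) i = (Gw a i)^-1.
Proof. by rewrite /ginv Gw_Gmk. Qed.

Lemma inG_gmul m (a b : 'I_(m + m) -> K) : inG m a -> inG m b -> inG m (gmul a b).
Proof. by move=> Ga Gb i; rewrite Gw_gmul mulf_neq0. Qed.

Lemma act_gmul k m (E : 'M[int]_(k, m)) (a b : 'I_(m + m) -> K) :
  act E (gmul a b) = gmul (act E a) (act E b).
Proof.
apply: G_ext => i.
  rewrite Gz_gmul !Gz_act -big_split; apply: eq_bigr => j _ /=.
  by rewrite Gz_gmul mulrzDl.
rewrite Gw_gmul !Gw_act -big_split; apply: eq_bigr => j _ /=.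
by rewrite Gw_gmul expfzMl.
Qed.

Lemma act0_gmul k m (a : 'I_(m + m) -> K) (b : 'I_(k + k) -> K) :
  gmul (act (0 : 'M[int]_(k, m)) a) b = b.
Proof.
apply: G_ext => i.
  by rewrite Gz_gmul Gz_act big1 ?add0r // => j _; rewrite mxE.
by rewrite Gw_gmul Gw_act big1 ?mul1r // => j _; rewrite mxE.
Qed.

(** Multiplication by [c] in the group, the action of a scalar matrix; natural exponents keep it
    polynomial, so it is regular even where coordinates vanish. *)
Definition pw c m (x : 'I_(m + m) -> K) : 'I_(m + m) -> K :=
  Gmk (fun i => c%:R * Gz x i) (fun i => Gw x i ^+ c).

Lemma act_scalar c m (x : 'I_(m + m) -> K) : act (c%:Z)%:M x = pw c x.
Proof.
rewrite /pw; apply: G_ext => i; rewrite ?Gz_act ?Gw_act ?Gz_Gmk ?Gw_Gmk (bigD1 i) //= mxE eqxx.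
  by rewrite big1 ?addr0 => [|j /negPf ji]; rewrite ?mulr1n ?mulr_natl // mxE eq_sym ji.
by rewrite big1 ?mulr1 => [|j /negPf ji]; rewrite ?mulr1n // mxE eq_sym ji.
Qed.

Lemma act1 m (x : 'I_(m + m) -> K) : act 1%:M x = x.
Proof.
rewrite -[1%:M]/((1%:Z)%:M) act_scalar /pw; apply: G_ext => i.
  by rewrite Gz_Gmk mul1r.
by rewrite Gw_Gmk expr1.
Qed.

End Action.

(** * Regular maps and their effect on transcendence degree *)

Section RegularMaps.
Variable K : fieldType.

Section Subalgebra.
Variables (X : Type) (A : (X -> K) -> Prop) (sA : subalg A).

Lemma subalg_ext phi psi : phi =1 psi -> A phi -> A psi.
Proof. by move=> E; congr A; apply: functional_extensionality. Qed.

Lemma subalg_sum (I : Type) (r : seq I) (f : I -> X -> K) :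
  (forall i, A (f i)) -> A (fun x => \sum_(i <- r) f i x).
Proof.
move=> Af; elim: r => [|i r IH].
  by apply: subalg_ext (subalgC sA 0) => x; rewrite big_nil.
by apply: subalg_ext (subalgD sA (Af i) IH) => x; rewrite big_cons.
Qed.

Lemma subalg_prod (I : Type) (r : seq I) (f : I -> X -> K) :
  (forall i, A (f i)) -> A (fun x => \prod_(i <- r) f i x).
Proof.
move=> Af; elim: r => [|i r IH].
  by apply: subalg_ext (subalgC sA 1) => x; rewrite big_nil.
by apply: subalg_ext (subalgM sA (Af i) IH) => x; rewrite big_cons.
Qed.

Lemma subalg_exp f n : A f -> A (fun x => f x ^+ n).
Proof.
move=> Af; elim: n => [|n IH]; first by apply: subalg_ext (subalgC sA 1) => x; rewrite expr0.
by apply: subalg_ext (subalgM sA Af IH) => x; rewrite exprS.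
Qed.

Lemma subalg_scale c f : A f -> A (fun x => c * f x).
Proof. by move=> Af; apply: (subalgM sA (subalgC sA c) Af). Qed.

Lemma subalg_intmul (z : int) f : A f -> A (fun x => f x *~ z).
Proof.
by move=> Af; apply: subalg_ext (subalg_scale z%:~R Af) => x; rewrite mulrzl.
Qed.

End Subalgebra.

Lemma regfun_exprz X d (F : X -> 'I_d -> K) f (z : int) :
  (forall x, f x != 0) -> regfun F f -> regfun F (fun x => f x ^ z).
Proof.
move=> f0 Ff; case: z => n; first exact: (subalg_exp (subalg_regfun F) _ Ff).
apply: regfun_inv; first by move=> x; rewrite expf_neq0.
exact: (subalg_exp (subalg_regfun F) _ Ff).
Qed.

Definition regmap X d e (F : X -> 'I_d -> K) (G : X -> 'I_e -> K) :=
  forall j, regfun F (fun x => G x j).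

Lemma regmap_id X d (F : X -> 'I_d -> K) : regmap F F.
Proof. by move=> j; apply: polyfun_regfun; apply: polyfun_coord. Qed.

Lemma regmap_Gmk X d m (F : X -> 'I_d -> K) (z w : X -> 'I_m -> K) :
  regmap F z -> regmap F w -> regmap F (fun x => Gmk (z x) (w x)).
Proof.
move=> Fz Fw; apply: Gmk_ind => i.
  by apply: subalg_ext (Fz i) => x; rewrite Gmk_l.
by apply: subalg_ext (Fw i) => x; rewrite Gmk_r.
Qed.

Lemma regmap_Gz X d m (F : X -> 'I_d -> K) (G : X -> 'I_(m + m) -> K) :
  regmap F G -> regmap F (fun x => Gz (G x)).
Proof. by move=> FG i; apply: FG. Qed.

Lemma regmap_Gw X d m (F : X -> 'I_d -> K) (G : X -> 'I_(m + m) -> K) :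
  regmap F G -> regmap F (fun x => Gw (G x)).
Proof. by move=> FG i; apply: FG. Qed.

Lemma regmap_act X d k m (M : 'M[int]_(k, m)) (F : X -> 'I_d -> K) (G : X -> 'I_(m + m) -> K) :
  (forall x, inG m (G x)) -> regmap F G -> regmap F (fun x => act M (G x)).
Proof.
move=> GG FG; apply: regmap_Gmk => i.
  by apply: (subalg_sum (subalg_regfun F)) => j; apply: (subalg_intmul (subalg_regfun F)); apply: regmap_Gz.
apply: (subalg_prod (subalg_regfun F)) => j; apply: regfun_exprz; last exact: regmap_Gw.
by move=> x; apply: GG.
Qed.

Lemma regmap_gmul X d m (F : X -> 'I_d -> K) (G H : X -> 'I_(m + m) -> K) :
  regmap F G -> regmap F H -> regmap F (fun x => gmul (G x) (H x)).
Proof.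
move=> FG FH; apply: regmap_Gmk => i.
  by apply: (subalgD (subalg_regfun F)); apply: regmap_Gz.
by apply: (subalgM (subalg_regfun F)); apply: regmap_Gw.
Qed.

Lemma regmap_pw X d m c (F : X -> 'I_d -> K) (G : X -> 'I_(m + m) -> K) :
  regmap F G -> regmap F (fun x => pw c (G x)).
Proof.
move=> FG; apply: regmap_Gmk => i.
  by apply: (subalg_scale (subalg_regfun F)); apply: regmap_Gz.
by apply: (subalg_exp (subalg_regfun F)); apply: regmap_Gw.
Qed.

Lemma polyfun_regmap X d e (F : X -> 'I_d -> K) (G : X -> 'I_e -> K) phi :
  regmap F G -> polyfun G phi -> regfun F phi.
Proof. by move=> FG; apply: polyfun_sub; first exact: subalg_regfun. Qed.

Lemma regfun_regmap X d e (F : X -> 'I_d -> K) (G : X -> 'I_e -> K) phi :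
  regmap F G -> regfun G phi -> regfun F phi.
Proof.
move=> FG [p [q Ep]]; have Fp := polyfun_regmap FG (polyfun_eval G p).
have Fq := regfun_inv (fun x => (Ep x).1) (polyfun_regmap FG (polyfun_eval G q)).
by apply: subalg_ext (subalgM (subalg_regfun F) Fp Fq) => x; rewrite (Ep x).2.
Qed.

Lemma dom_regmap X d e (F : X -> 'I_d -> K) (G : X -> 'I_e -> K) :
  regmap F G -> dom (polyfun F) -> dom (polyfun G).
Proof.
move=> FG dF phi psi Gphi Gpsi; apply: (dom_regfun dF); exact: polyfun_regmap FG _.
Qed.

Lemma regfun_pull X Y d e (pi : Y -> X) (F : X -> 'I_d -> K) (G : Y -> 'I_e -> K) phi :
  regmap G (fun y => F (pi y)) -> regfun F phi -> regfun G (fun y => phi (pi y)).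
Proof.
move=> GF [p [q Epq]]; apply: regfun_regmap GF _.
by exists p, q => y; apply: Epq.
Qed.

Hypothesis char0 : [pchar K] =i pred0.

Lemma trdeg_regmap X d e (F : X -> 'I_d -> K) (G : X -> 'I_e -> K) k :
  regmap F G -> dom (polyfun F) -> trdeg_ge (polyfun G) k -> trdeg_ge (polyfun F) k.
Proof.
move=> FG dF tr; apply: trdeg_regfun => //.
by apply: trdeg_ge_sub tr => phi; apply: polyfun_regmap.
Qed.

(* The coordinates of F are roots of those of pw c F. *)
Lemma trdeg_pw X m c (F : X -> 'I_(m + m) -> K) k : (0 < c)%N ->
  dom (polyfun F) -> trdeg_ge (polyfun F) k -> trdeg_ge (polyfun (fun x => pw c (F x))) k.
Proof.
move=> c0 dF tr; set G := fun x => pw c (F x).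
have FG : regmap F G by apply: regmap_pw; apply: regmap_id.
have cn0 : (c%:R : K) != 0 by rewrite ((pcharf0P K).1 char0) -lt0n.
have dG := dom_regmap FG dF.
have [e [[g [Gg aig]] mx]] := trdeg_max (trdeg_ge_inhabited tr) (trdeg_polyfun_bound dG).
case: (leqP k e) => [ke|ek]; first by apply: (trdeg_ge_le char0 ke); exists g.
have [f [Ff aif]] := trdeg_ge_le char0 ek tr; exfalso.
have over phi : polyfun G phi -> algebraic_over g phi by move=> H; apply: (algebraic_over_of_max mx).
have pG : forall phi, polyfun G phi -> regfun F phi by move=> phi; apply: polyfun_regmap FG.
apply: (alg_dependent_of_algebraic (subalg_regfun F) (dom_regfun dF) (fun i => pG _ (Gg i))
  (fun i => polyfun_regfun (polyfun_coord F i)) _ Ff aif).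
apply: Gmk_ind => i.
  apply: over; have := subalg_scale (subalg_polyfun G) (c%:R^-1) (polyfun_coord G (lshift m i)).
  by apply: subalg_ext => x; rewrite /G /pw Gmk_l mulKf.
apply: (algebraic_over_root c0); apply: over.
by apply: subalg_ext (polyfun_coord G (rshift m i)) => x; rewrite /G /pw Gmk_r.
Qed.

End RegularMaps.

(** * Closures of images under integer matrices and projections *)

Section Closures.
Variable K : fieldType.

Lemma zclosure_eq d (U S T : pset K d) : psubset S U -> psubset T U ->
  (forall p, vanish S p <-> vanish T p) -> zclosure U S = zclosure U T.
Proof.
move=> SU TU E; apply: functional_extensionality => x; apply: propositional_extensionality.
split=> [] [Ux H]; split=> // p Hp; apply: H => y Sy Uy; have [ST TS] := E p.
  by apply: TS => // z Tz; apply: Hp => //; apply: TU.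
by apply: ST => // z Sz; apply: Hp => //; apply: SU.
Qed.

(** The pullback of a polynomial along [act] is a fraction on the group; if it vanishes on the image
    of [F] then its numerator does, and so vanishes on the closure as well. *)
Lemma actV_closure X k m (M : 'M[int]_(k, m)) (F : X -> 'I_(m + m) -> K) :
  (forall x, inG m (F x)) ->
  actV M (zclosure (inG m) (pimage F)) = zclosure (inG k) (pimage (fun x => act M (F x))).
Proof.
move=> GF; apply: zclosure_eq.
- by move=> _ [x [[Gx _] ->]]; apply: inG_act.
- by move=> _ [x ->]; apply: inG_act.
move=> p; split=> H; [move=> _ [x ->]|move=> _ [y [[Gy cly] ->]]].
  by apply: H; exists (F x); split=> //; split=> [|q]; [|apply=> //; exists x].
pose Z := {y : 'I_(m + m) -> K | inG m y}; pose id0 (z : Z) := sval z.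
have [a [b Eab]] : regfun id0 (fun z => p.@[act M (id0 z)]).
  apply: polyfun_regmap (polyfun_eval _ p); apply: regmap_act; last exact: regmap_id.
  by case.
have [_ /= ->] := Eab (exist _ y Gy); rewrite /id0 /= cly ?mul0r // => _ [x ->] _.
have [b0 /= E] := Eab (exist _ (F x) (GF x)); move: E b0; rewrite /id0 /= H; last by exists x.
by move/esym/eqP; rewrite mulf_eq0 invr_eq0 => /orP [/eqP //|->].
Qed.

Lemma actV_pimage k m (M : 'M[int]_(k, m)) (V : pset K (m + m)) : psubset V (inG m) ->
  actV M V = zclosure (inG k) (pimage (fun x : {x | V x} => act M (sval x))).
Proof.
move=> VG; apply: zclosure_eq.
- by move=> _ [x [/VG Gx ->]]; apply: inG_act.
- by move=> _ [[x Vx] ->]; apply: inG_act; apply: VG.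
move=> p; split=> H; [move=> _ [[x Vx] ->]|move=> _ [x [Vx ->]]]; apply: H; first by exists x.
by exists (exist _ x Vx).
Qed.

Lemma proj_a_closure X (F : X -> 'I_(1 + 1) -> K) : (forall x, inG 1 (F x)) ->
  proj_a (zclosure (inG 1) (pimage F)) = zclosure (@Ga_univ K) (pimage (fun x => Gz (F x))).
Proof.
move=> GF; apply: zclosure_eq => //.
move=> p; split=> H; [move=> _ [x ->]|move=> _ [y [[Gy cly] ->]]].
  by apply: H; exists (F x); split=> //; split=> [|q]; [|apply=> //; exists x].
pose p' := psubst (fun i => 'X_(lshift 1 i)) p; have E y0 : p'.@[y0] = p.@[Gz y0].
  by rewrite psubst_eval; apply: meval_eq => i; rewrite mevalXU.
by rewrite -E; apply: cly => _ [x ->] _; rewrite E; apply: H; exists x.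
Qed.

Lemma proj_m_closure X (F : X -> 'I_(1 + 1) -> K) : (forall x, inG 1 (F x)) ->
  proj_m (zclosure (inG 1) (pimage F)) = zclosure (@Gm_univ K) (pimage (fun x => Gw (F x))).
Proof.
move=> GF; apply: zclosure_eq.
- by move=> _ [x [[Gx _] ->]].
- by move=> _ [x ->]; apply: GF.
move=> p; split=> H; [move=> _ [x ->]|move=> _ [y [[Gy cly] ->]]].
  by apply: H; exists (F x); split=> //; split=> [|q]; [|apply=> //; exists x].
pose p' := psubst (fun i => 'X_(rshift 1 i)) p; have E y0 : p'.@[y0] = p.@[Gw y0].
  by rewrite psubst_eval; apply: meval_eq => i; rewrite mevalXU.
by rewrite -E; apply: cly => _ [x ->] _; rewrite E; apply: H; exists x.
Qed.

End Closures.

(** * Nonconstant functions and dimension one *)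

Section Constants.
Variable K : closedFieldType.
Hypothesis char0 : [pchar K] =i pred0.

Lemma trdeg_pimage X Y d (F : X -> 'I_d -> K) (G : Y -> 'I_d -> K) k :
  (forall x, exists y, F x = G y) -> trdeg_ge (polyfun F) k -> trdeg_ge (polyfun G) k.
Proof.
rewrite !trdeg_polyfunP => FG [f aif]; exists f; apply: indep_on_sub aif => _ [x ->].
by have [y ->] := FG x; exists y.
Qed.

(** Over an algebraically closed field the polynomial splits into linear factors, and in a domain
    one of them vanishes identically at [phi]. *)
Lemma const_of_poly_zero X (A : (X -> K) -> Prop) phi (p : {poly K}) :
  X -> subalg A -> dom A -> A phi -> p != 0 -> (forall x, p.[phi x] = 0) ->
  exists c, forall x, phi x = c.
Proof.
move=> x0 sA dA Aphi p0; have [r ->] := closed_field_poly_normal p => H.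
have {}H x : \prod_(z <- r) (phi x - z) = 0.
  have := H x; rewrite hornerZ horner_prod => /eqP.
  rewrite mulf_eq0 lead_coef_eq0 (negPf p0) /= => /eqP <-.
  by apply: eq_bigr => z _; rewrite hornerXsubC.
elim: r H => [|z r IH] H; first by have /eqP := H x0; rewrite big_nil oner_eq0.
have Az y : A (fun x => phi x - y) by apply: (subalgD sA Aphi (subalgC sA (- y))).
have [x|E|/IH //] := dA _ _ (Az z) (subalg_prod sA r Az); first by rewrite -[RHS](H x) big_cons.
by exists z => x; apply/eqP; rewrite -subr_eq0 E.
Qed.

Lemma trdeg_ge1 X (F : X -> 'I_1 -> K) : X -> dom (polyfun F) ->
  ~ (exists c, forall x, F x ord0 = c) -> trdeg_ge (polyfun F) 1.
Proof.
move=> x0 dF nc; exists F; split=> [i|P HP]; first exact: polyfun_coord.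
have [G EG] := of_poly_surj P; pose b : 'I_0 -> K := fun=> 0.
have FE x : F x = fcons (F x ord0) b.
  by apply: functional_extensionality => i; rewrite ord1 fcons0.
have G0 : map_poly (meval b) G = 0.
  apply/eqP/negPn/negP => Gn; apply: nc.
  apply: (const_of_poly_zero x0 (subalg_polyfun F) dF (polyfun_coord F ord0) Gn) => x.
  by rewrite -[LHS]/(ev2 G b _) -of_poly_eval EG -FE HP.
rewrite -EG (_ : G = 0); first by rewrite /of_poly rmorph0 horner0.
apply/polyP => i; rewrite coef0; apply: (mpoly_zero char0) => y.
have /polyP /(_ i) := G0; rewrite coef_map coef0 /= => <-.
by apply: meval_eq => -[].
Qed.

Lemma dim_eq1_image (U : pset K 1) X (F : X -> 'I_1 -> K) : principal U -> X -> dom (polyfun F) ->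
  (forall x, U (F x)) -> ~ (exists c, forall x, F x ord0 = c) ->
  dim_eq U (zclosure U (pimage F)) 1.
Proof.
move=> pU x0 dF FU nc; split.
  by apply/(dim_ge_image char0) => //; apply: trdeg_ge1.
move/(dim_ge_image char0 pU _ (inhabits x0) dF FU); exact: trdeg_polyfun_bound.
Qed.

Lemma dim_ge1_nonconst d (U A : pset K d) : dim_ge U A 1 -> ~ (forall x y, A x -> A y -> x = y).
Proof.
case=> C [irr str] H; have [_ n01] := str 0%N isT; apply: n01 => x C1x.
have [/zirredP [_ [[y C0y] _]] C0A] := irr 0%N isT; have [_ C1A] := irr 1%N isT.
by rewrite (H x y) //; [apply: C1A|apply: C0A].
Qed.

End Constants.

(** * Ranks of integer matrices *)

Section IntegerRank.

Local Notation QM := (map_mx (intr : int -> rat)).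

Lemma rankZE k m (M : 'M[int]_(k, m)) : rankZ M = \rank (QM M).
Proof. by []. Qed.

Lemma clear_denominators a b (A : 'M[rat]_(a, b)) : exists (c : nat) (A' : 'M[int]_(a, b)),
  (0 < c)%N /\ QM A' = c%:R *: A.
Proof.
pose D (i : 'I_a) (j : 'I_b) := `|denq (A i j)|%N.
have D0 i j : (0 < D i j)%N by rewrite absz_gt0 denq_neq0.
pose c := (\prod_i \prod_j D i j)%N.
have Dc i j : (D i j %| c)%N.
  by rewrite /c (bigD1 i) //= (bigD1 j) //= -mulnA dvdn_mulr.
exists c, (\matrix_(i, j) (numq (A i j) * (c %/ D i j)%N%:Z)); split.
  by apply: prodn_gt0 => i; apply: prodn_gt0 => j.
apply/matrixP => i j; rewrite !mxE rmorphM /= numqE -mulrA mulrC; congr (_ * _).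
rewrite -[denq _]gez0_abs ?denq_ge0 // -/(D i j) -rmorphM /= -PoszM mulnC divnK //.
Qed.

Lemma QM_inj k m (A B : 'M[int]_(k, m)) : QM A = QM B -> A = B.
Proof.
move=> /matrixP E; apply/matrixP => i j; have := E i j; rewrite !mxE.
exact: intr_inj.
Qed.

Lemma rankZ_mul_maxr k l m (A : 'M[int]_(k, l)) (B : 'M[int]_(l, m)) :
  (rankZ (A *m B) <= rankZ A)%N.
Proof. by rewrite !rankZE map_mxM mxrankM_maxl. Qed.

Lemma rankZ_scale k m c (A : 'M[int]_(k, m)) : c != 0 -> rankZ (c *: A) = rankZ A.
Proof.
by move=> c0; rewrite !rankZE map_mxZ mxrank_scale_nz // intr_eq0.
Qed.

Lemma rankZ_eq0 k m (A : 'M[int]_(k, m)) : rankZ A = 0%N -> A = 0.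
Proof.
rewrite rankZE => /eqP; rewrite mxrank_eq0 => /eqP /matrixP E.
by apply/matrixP => i j; have := E i j; rewrite !mxE => /eqP; rewrite intr_eq0 => /eqP.
Qed.

(** Reduces matrices of any height to square ones, the format in which rotundity and simplicity are
    defined. *)
Lemma rankZ_square k m (A : 'M[int]_(k, m)) : exists E : 'M[int]_(m, k), rankZ (E *m A) = rankZ A.
Proof.
have /submxP [D ED] : (<<QM A>> <= QM A)%MS by rewrite genmxE.
have [c [E [c0 EE]]] := clear_denominators D.
exists E; rewrite !rankZE map_mxM EE -scalemxAl -ED mxrank_scale_nz ?genmxE //.
by rewrite pnatr_eq0 -lt0n.
Qed.

Lemma rankZ_left_inverse k m (A : 'M[int]_(k, m)) : rankZ A = m ->
  exists (c : nat) (E : 'M[int]_(m, k)), (0 < c)%N /\ E *m A = (c%:Z)%:M.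
Proof.
move=> rA; have /row_fullP [B BA] : row_full (QM A) by rewrite /row_full -rankZE rA.
have [c [E [c0 EE]]] := clear_denominators B; exists c, E; split=> //.
apply: QM_inj.
by rewrite map_mxM EE -scalemxAl BA scalemx1 map_scalar_mx /= pmulrn.
Qed.

(** The echelon form of (A | B): the rows of [E] span the left kernel of [A] over the rationals, so
    E (A | B) = (0 | E B) are the rows that involve only the second block. *)
Lemma rankZ_row_mx_ker k m (A B : 'M[int]_(k, m)) : exists E : 'M[int]_k,
  E *m A = 0 /\ (rankZ (row_mx A B) <= rankZ A + rankZ (E *m B))%N.
Proof.
pose M := row_mx (QM A) (QM B); pose C : 'M[rat]_(m + m, m) := col_mx 1%:M 0.
have MC : M *m C = QM A by rewrite mul_row_col mulmx1 mulmx0 addr0.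
have [c [E [c0 EE]]] := clear_denominators (kermx (QM A)); exists E; split.
  apply: QM_inj.
  by rewrite map_mxM EE -scalemxAl mulmx_ker scaler0 map_mx0.
(* The rank of (A | B) is that of [A] plus the dimension of the rows with zero first block; such a
   row is v (A | B) with v in the left kernel of [A]. *)
rewrite rankZE map_row_mx -/M -(mxrank_mul_ker M C) MC -rankZE leq_add2l.
rewrite rankZE map_mxM EE -scalemxAl mxrank_scale_nz ?pnatr_eq0 -?lt0n //.
apply: (@leq_trans (\rank (row_mx (0 : 'M_(k, m)) (kermx (QM A) *m QM B)))).
  apply: mxrankS; rewrite -(_ : kermx (QM A) *m M = row_mx 0 _); last first.
    by rewrite mul_mx_row mulmx_ker.
  apply/rV_subP => u; rewrite sub_capmx => /andP [/submxP [v ->]] /sub_kermxP.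
  by rewrite -mulmxA MC => /sub_kermxP vk; apply: submxMr.
by rewrite rank_row_0mx.
Qed.

End IntegerRank.

(** * Sums of two varieties *)

Section SumOfVarieties.
Variable K : closedFieldType.
Hypothesis char0 : [pchar K] =i pred0.
Variables (X Y : Type) (n : nat).
Variables (F1 : X -> 'I_(n + n) -> K) (F2 : Y -> 'I_(n + n) -> K).
Hypotheses (G1 : forall x, inG n (F1 x)) (G2 : forall y, inG n (F2 y)).
Hypotheses (d1 : dom (polyfun F1)) (d2 : dom (polyfun F2)).

Definition pair_map (xy : X * Y) := Gmk (F1 xy.1) (F2 xy.2).

Lemma dom_pair_map : dom (polyfun pair_map).
Proof. exact: dom_pair. Qed.

Lemma regmap_fst : regmap pair_map (fun xy => F1 xy.1).
Proof.
by move=> i; apply: subalg_ext (regmap_id pair_map (lshift _ i)) => xy; rewrite /pair_map Gmk_l.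
Qed.

Lemma regmap_snd : regmap pair_map (fun xy => F2 xy.2).
Proof.
by move=> i; apply: subalg_ext (regmap_id pair_map (rshift _ i)) => xy; rewrite /pair_map Gmk_r.
Qed.

Lemma regmap_slice y : regmap F1 (fun x => pair_map (x, y)).
Proof.
apply: regmap_Gmk; first exact: regmap_id.
by move=> i; apply: (subalgC (subalg_regfun F1) (F2 y i)).
Qed.

Definition sum_map p (A B : 'M[int]_(p, n)) (xy : X * Y) : 'I_(p + p) -> K :=
  gmul (act A (F1 xy.1)) (act B (F2 xy.2)).

Section Fixed.
Variables (p : nat) (A B : 'M[int]_(p, n)).
Local Notation W := (sum_map A B).

Lemma inG_sum_map xy : inG p (W xy).
Proof. by apply: inG_gmul; apply: inG_act. Qed.

Lemma regmap_sum_map : regmap pair_map W.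
Proof.
apply: regmap_gmul; apply: regmap_act => //; [exact: regmap_fst|exact: regmap_snd].
Qed.

Lemma dom_sum_map : dom (polyfun W).
Proof. exact: dom_regmap regmap_sum_map dom_pair_map. Qed.

Lemma regmap_sum_slice y : regmap F1 (fun x => W (x, y)).
Proof.
move=> i; apply: (regfun_pull (pi := fun x => (x, y)) _ (regmap_sum_map i)).
exact: regmap_slice.
Qed.

(** A slice is a translate of the image of [act A], and translating back is regular. *)
Lemma trdeg_sum_slice y k : trdeg_ge (polyfun (fun x => act A (F1 x))) k ->
  trdeg_ge (polyfun (fun x => W (x, y))) k.
Proof.
apply: trdeg_regmap => //; last exact: dom_regmap (regmap_sum_slice y) d1.
pose b := act B (F2 y); have Gb : inG p b by apply: inG_act.
have E x : gmul (W (x, y)) (ginv b) = act A (F1 x).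
  apply: G_ext => i; rewrite /sum_map ?Gz_gmul ?Gw_gmul ?Gz_ginv ?Gw_ginv.
    by rewrite addrK.
  by rewrite mulfK //; apply: Gb.
move=> i; have := @regmap_gmul _ _ _ _ (fun x => W (x, y)) _ (fun=> ginv b) (regmap_id _) _ i.
have Hc : regmap (fun x => W (x, y)) (fun=> ginv b).
  by move=> j; apply: (subalgC (subalg_regfun _) (ginv b j)).
by move/(_ Hc); apply: subalg_ext => x; rewrite E.
Qed.

Definition pcat a b (f : X * Y -> 'I_a -> K) (g : X * Y -> 'I_b -> K) xy (i : 'I_(a + b)) : K :=
  match split i with inl j => f xy j | inr j => g xy j end.

Lemma regfun_pcat a b f g (i : 'I_(a + b)) : (forall j, regfun W (fun xy => f xy j)) ->
  (forall j, regfun W (fun xy => g xy j)) -> regfun W (fun xy => pcat f g xy i).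
Proof. by move=> Hf Hg; rewrite /pcat; case: (split i). Qed.

Lemma fcons_pcat a b (phi : X * Y -> K) (f : X * Y -> 'I_a -> K) (g : X * Y -> 'I_b -> K) xy :
  fcons (phi xy) (pcat f g xy) = pcat (fun z => fcons (phi z) (f z)) g xy.
Proof.
apply: functional_extensionality => i; rewrite /fcons /pcat.
case: (unliftP (ord0 : 'I_(a + b).+1) i) => [j|] -> /=.
  rewrite -(splitK j); case: (split j) => l /=; rewrite (unsplitK (inl l)) || rewrite (unsplitK (inr l)).
    rewrite (_ : lift ord0 (lshift b l) = lshift b (lift ord0 l)); last exact: val_inj.
    by rewrite (unsplitK (inl (lift ord0 l))) liftK.
  rewrite (_ : lift ord0 (rshift a l) = rshift a.+1 l); last exact: val_inj.
  by rewrite (unsplitK (inr l)).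
rewrite (_ : ord0 = lshift b ord0); last exact: val_inj.
by rewrite (unsplitK (inl ord0)) unlift_none.
Qed.

(* Extend g, which only depends on y, to a transcendence basis (f, g) of W. For generic y0 the
   coordinates of W(-, y0) stay algebraic over f(-, y0), so f has at least k1 members. *)
Theorem trdeg_sum q (E : 'M[int]_(q, p)) k1 k2 : E *m A = 0 ->
  trdeg_ge (polyfun (fun x => act A (F1 x))) k1 ->
  trdeg_ge (polyfun (fun y => act (E *m B) (F2 y))) k2 ->
  trdeg_ge (polyfun W) (k1 + k2).
Proof.
move=> EA tr1 tr2; have [x1] := trdeg_ge_inhabited tr1; have [y1] := trdeg_ge_inhabited tr2.
have [g [Hg aig]] := tr2; pose gg (xy : X * Y) := g xy.2.
have regg i : regfun W (fun xy => gg xy i).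
  have [r Er] := Hg i; have H : regmap W (fun xy => act E (W xy)).
    by apply: regmap_act => [xy|]; [exact: inG_sum_map|exact: regmap_id].
  apply: subalg_ext (polyfun_regmap H (polyfun_eval _ r)) => -[x y] /=.
  by rewrite /sum_map act_gmul !act_mul // EA act0_gmul /gg Er.
(* [g] is kept fixed while [f] is enlarged as far as possible; this stops because [W] has only p + p
   coordinates. *)
pose P r := exists f : X * Y -> 'I_r -> K,
  (forall i, regfun W (fun xy => f xy i)) /\ alg_indep (pcat f gg).
have Ptr r : P r -> trdeg_ge (polyfun W) (r + k2).
  case=> f [Wf aif]; apply: (trdeg_regfun char0 dom_sum_map); exists (pcat f gg); split=> // i.
  exact: regfun_pcat.
have P0 : P 0%N.
  exists (fun=> fun=> 0); split=> [[]//|Q HQ]; apply: aig => y; rewrite -[RHS](HQ (x1, y)).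
  apply: meval_eq => i; rewrite /pcat (_ : split (i : 'I_(0 + k2)) = inr i) //.
  by rewrite -(unsplitK (inr i)); congr split; apply: val_inj.
have [r [Pr nPr]] : exists r, P r /\ ~ P r.+1.
  apply: NNPP => H; have Pall r : P r.
    by elim: r => // r IH; apply: NNPP => nP; apply: H; exists r.
  by apply: (trdeg_polyfun_bound dom_sum_map); apply: (trdeg_ge_le char0 _ (Ptr _ (Pall (p + p).+1))); lia.
case: (leqP k1 r) => [kr|rk]; first by apply: (trdeg_ge_le char0 _ (Ptr _ Pr)); lia.
have [f [Wf aif]] := Pr; exfalso.
have over j : algebraic_over (pcat f gg) (fun xy => W xy j).
  apply: (algebraic_over_of_dependent aif) => ai; apply: nPr.
  exists (fun xy => fcons (W xy j) (f xy)); split=> [i|].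
    by rewrite /fcons; case: unliftP => [l _|_] /=; [exact: Wf|exact: regmap_id].
  move: ai; congr alg_indep; apply: functional_extensionality => xy; exact: fcons_pcat.
have /choice [R HR] := over; have {HR} HR j := HR j.
have /choice [l Hl] : forall j, exists l, exists xy, ((R j)`_l).@[pcat f gg xy] != 0.
  by move=> j; have [[l [xy Hl]] _] := HR j; exists l, xy.
(* At [y0] one nonzero coefficient of each relation survives, so all the relations stay nontrivial
   on the slice. *)
have [[x0 y0] Hxy] : exists xy, (\prod_j (R j)`_(l j)).@[pcat f gg xy] != 0.
  apply: (dom_prod (subalg_regfun W) (dom_regfun dom_sum_map) _ (x1, y1) Hl) => i.
  exact: regfun_pcat.
pose f0 x := f (x, y0); pose W0 x := W (x, y0).
have over0 j : algebraic_over f0 (fun x => W0 x j).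
  pose s (i : 'I_(r + k2)) : {mpoly K[r]} :=
    match split i with inl i => 'X_i | inr i => (g y0 i)%:MP end.
  have sE x Q : (psubst s Q).@[f0 x] = Q.@[pcat f gg (x, y0)].
    rewrite psubst_eval; apply: meval_eq => i; rewrite /s /pcat.
    by case: (split i) => a; rewrite ?mevalXU ?mevalC.
  exists (map_poly (psubst s) (R j)); split.
    exists (l j), x0; rewrite coef_map /= sE.
    by move: Hxy; rewrite rmorph_prod => /prodf_neq0 /(_ j isT).
  move=> x; have [_ H] := HR j; rewrite -[RHS](H (x, y0)) /ev2 -map_poly_comp.
  by congr (_.[_]); apply: eq_map_poly => Q /=; rewrite sE.
have tr0 := trdeg_ge_le char0 rk (trdeg_sum_slice y0 tr1).
have [h [Hh aih]] := tr0.
(* The slice carries r + 1 independent functions, although its coordinates are algebraic over the r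
   functions [f0]. *)
apply: (alg_dependent_of_algebraic (subalg_regfun F1) (dom_regfun d1) _ _ over0 Hh aih).
  move=> i; apply: (regfun_pull (pi := fun x => (x, y0)) _ (regfun_regmap regmap_sum_map (Wf i))).
  exact: regmap_slice.
exact: regmap_sum_slice.
Qed.

Section FullRank.
Hypothesis tr1 : trdeg_ge (polyfun (fun x => act A (F1 x))) p.
Hypothesis trW : ~ trdeg_ge (polyfun W) p.+1.

(** The slice has transcendence degree p, as much as [W] can have, so it is dense in [W]. *)
Lemma vanish_of_slice y0 (f : {mpoly K[p + p]}) :
  (forall x, f.@[W (x, y0)] = 0) -> forall xy, f.@[W xy] = 0.
Proof.
move=> H; apply: NNPP => Hn; apply: trW.
have /trdeg_polyfunP [q /indep_on_imageP aiq] := trdeg_sum_slice y0 tr1.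
exists (fun xy => fcons f.@[W xy] (fun i => (q i).@[W xy])); split.
  by move=> i; rewrite /fcons; case: unliftP => [j _|_] /=; apply: polyfun_eval.
apply: (alg_indep_fcons (iota := fun x => (x, y0)) (subalg_polyfun W) dom_sum_map
   (fun i => polyfun_eval W (q i)) (polyfun_eval W f) aiq) => //.
Qed.

Definition shift_pt y0 y1 := gmul (act B (F2 y1)) (ginv (act B (F2 y0))).

(** On the slice over [y0] the translated polynomial takes the values of [f] on the slice over [y1],
    which are zero; density of the slice does the rest. *)
Lemma vanish_shift y0 y1 (f : {mpoly K[p + p]}) :
  (forall xy, f.@[W xy] = 0) -> forall xy, f.@[gmul (W xy) (shift_pt y0 y1)] = 0.
Proof.
move=> H; set t := shift_pt y0 y1.
pose f' : {mpoly K[p + p]} := psubst (fun j => match split j with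
  | inl i => 'X_(lshift p i) + (Gz t i)%:MP
  | inr i => 'X_(rshift p i) * (Gw t i)%:MP end) f.
have f'E a : f'.@[a] = f.@[gmul a t].
  rewrite psubst_eval; apply: meval_eq => j; rewrite /gmul /Gmk; case: (split j) => i.
    by rewrite mevalD mevalXU mevalC.
  by rewrite mevalM mevalXU mevalC.
move=> xy; rewrite -f'E; apply: (vanish_of_slice (y0 := y0)) => x.
rewrite f'E -[RHS](H (x, y1)); congr (_.@[_]); rewrite /t /shift_pt /sum_map.
have Gb : inG p (act B (F2 y0)) by apply: inG_act.
apply: G_ext => i; rewrite ?Gz_gmul ?Gw_gmul ?Gz_ginv ?Gw_ginv /=.
  by ring.
have := Gb i; move: (Gw (act B (F2 y0)) i) => z z0; by field.
Qed.

Hypothesis Gw_nonconst : forall nu : 'M[int]_(1, p), nu != 0 ->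
  ~ exists c, forall y, Gw (act (nu *m B) (F2 y)) ord0 = c.

(** If two monomials agreed on all shifts, the character given by the difference of their exponents
    would be constant on the second summand. *)
Lemma exists_separating_shift (mu0 mu1 : 'X_{1..p}) : mu0 != mu1 -> exists y0 y1,
  \prod_i Gw (shift_pt y0 y1) i ^+ mu0 i != \prod_i Gw (shift_pt y0 y1) i ^+ mu1 i.
Proof.
move=> ne; pose nu : 'M[int]_(1, p) := \row_i ((mu0 i)%:Z - (mu1 i)%:Z).
have nu0 : nu != 0.
  apply/eqP => /rowP E; case/eqP: ne; apply/mnmP => i.
  by have := E i; rewrite !mxE => /eqP; rewrite subr_eq0 => /eqP [].
apply: NNPP => H; apply: (Gw_nonconst nu0).
case: (classic (inhabited Y)) => [[y0]|Y0]; last by exists 0 => y; case: Y0.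
exists (Gw (act (nu *m B) (F2 y0)) ord0) => y.
have Gs : inG p (shift_pt y0 y).
  move=> i; rewrite Gw_gmul Gw_ginv mulf_neq0 ?invr_eq0 //; exact: inG_act.
have E : Gw (act nu (shift_pt y0 y)) ord0 = 1.
  rewrite Gw_act; under eq_bigr => i _ do rewrite mxE expfzDr ?Gs //.
  rewrite big_split /=; apply/eqP; rewrite -[X in _ == X](@mulfV _ (\prod_i Gw (shift_pt y0 y) i ^+ mu1 i)); last first.
    by apply/prodf_neq0 => i _; rewrite expf_neq0 ?Gs.
  apply/eqP; congr (_ * _).
    by apply/eqP/negPn/negP => Hn; apply: H; exists y0, y.
  by rewrite -prodfV; apply: eq_bigr => i _; rewrite exprnN.
rewrite -!act_mul //; have Gb : inG p (act B (F2 y0)) by apply: inG_act.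
have -> : act B (F2 y) = gmul (shift_pt y0 y) (act B (F2 y0)).
  apply: G_ext => i; rewrite /shift_pt ?Gz_gmul ?Gw_gmul ?Gz_ginv ?Gw_ginv.
    by rewrite subrK.
  by rewrite mulfVK //; apply: Gb.
by rewrite act_gmul Gw_gmul E mul1r.
Qed.

Variables (x0 : X) (y0 : Y) (i0 : 'I_p).
Hypothesis Gz_nonconst : ~ exists c, forall x, Gz (act A (F1 x)) i0 = c.

Section Support.
Variable s : seq 'X_{1..p}.
Hypothesis us : uniq s.

(** An exponential polynomial: characters of the multiplicative part with coefficients polynomial in
    one additive coordinate. Its vanishing is handled as in the proof of linear independence of
    characters. *)
Definition expsum (c : 'X_{1..p} -> {poly K}) (a : 'I_(p + p) -> K) : K :=
  \sum_(mu <- s) (c mu).[Gz a i0] * \prod_i Gw a i ^+ mu i.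

Lemma polyfun_expsum c : exists f : {mpoly K[p + p]}, forall a, f.@[a] = expsum c a.
Proof.
pose Z := 'I_(p + p) -> K; pose id0 (a : Z) := a.
suff [f Ef] : polyfun id0 (expsum c) by exists f => a; rewrite Ef.
apply: (subalg_sum (subalg_polyfun id0)) => mu; apply: (subalgM (subalg_polyfun id0)).
  have H : polyfun id0 (fun a => \sum_(l <- iota 0 (size (c mu))) (c mu)`_l * Gz a i0 ^+ l).
    apply: (subalg_sum (subalg_polyfun id0)) => l; apply: (subalg_scale (subalg_polyfun id0)).
    exact: (subalg_exp (subalg_polyfun id0) _ (polyfun_coord id0 (lshift p i0))).
  apply: subalg_ext H => a; rewrite horner_coef.
  by rewrite -(big_mkord xpredT (fun l => (c mu)`_l * Gz a i0 ^+ l)) /index_iota subn0.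
apply: (subalg_prod (subalg_polyfun id0)) => i.
exact: (subalg_exp (subalg_polyfun id0) _ (polyfun_coord id0 (rshift p i))).
Qed.

(* Translating by a separating shift and subtracting a multiple lowers the degree of one coefficient
   while keeping another one nonzero. *)
Lemma expsum_zero c : (forall xy, expsum c (W xy) = 0) -> forall mu, mu \in s -> c mu = 0.
Proof.
have [N leN] := ubnP (\sum_(mu <- s) size (c mu))%N; elim: N c leN => // N IH c leN Hc mu1 s1.
apply/eqP/negPn/negP => c1.
case: (classic (exists mu0, [/\ mu0 \in s, mu0 != mu1 & c mu0 != 0])) => [[mu0 [s0 ne c0]]|H].
  have [ya [yb Hb]] := exists_separating_shift ne; pose t := shift_pt ya yb.
  pose b (mu : 'X_{1..p}) := \prod_i Gw t i ^+ mu i.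
  pose sh (q : {poly K}) := q \Po ('X + (Gz t i0)%:P).
  have szsh q : size (sh q) = size q by rewrite size_comp_poly2 // size_XaddC.
  have lcsh q : lead_coef (sh q) = lead_coef q.
    by rewrite lead_coef_comp ?size_XaddC // lead_coefXaddC expr1n mulr1.
  (* Translation multiplies the monomial mu by [b mu] and keeps leading coefficients. The leading
     term at [mu0] cancels, while the one at [mu1] is scaled by b mu1 - b mu0, which is nonzero. *)
  pose c' mu := b mu *: sh (c mu) - b mu0 *: c mu.
  have szc' mu : (size (c' mu) <= size (c mu))%N.
    rewrite (leq_trans (size_polyD _ _)) // size_polyN geq_max.
    by rewrite !(leq_trans (size_scale_leq _ _)) ?szsh.
  have szc'0 : (size (c' mu0) < size (c mu0))%N.
    rewrite -(prednK (n := size (c mu0))) ?size_poly_gt0 // ltnS; apply/leq_sizeP => l.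
    rewrite leq_eqVlt => /orP [/eqP <-|ltl].
      by rewrite coefB !coefZ -{1}(szsh (c mu0)) -!lead_coefE lcsh subrr.
    by rewrite nth_default // (leq_trans (szc' _)) // (polySpred c0).
  have c'1 : c' mu1 != 0.
    apply/eqP => /polyP /(_ (size (c mu1)).-1).
    rewrite coefB !coefZ -{1}(szsh (c mu1)) -!lead_coefE lcsh coef0 -mulrBl => /eqP.
    by rewrite mulf_eq0 lead_coef_eq0 (negPf c1) orbF subr_eq0 eq_sym (negPf Hb).
  have Hc' xy : expsum c' (W xy) = 0.
    have [f Ef] := polyfun_expsum c.
    have Hf : forall xy, f.@[W xy] = 0 by move=> z; rewrite Ef Hc.
    have := vanish_shift ya yb Hf xy; rewrite -/t Ef /expsum => E.
    transitivity (\sum_(mu <- s) (c mu).[Gz (gmul (W xy) t) i0] * (\prod_i Gw (gmul (W xy) t) i ^+ mu i)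
       - b mu0 * \sum_(mu <- s) (c mu).[Gz (W xy) i0] * (\prod_i Gw (W xy) i ^+ mu i)).
      rewrite mulr_sumr -sumrB; apply: eq_bigr => mu _.
      rewrite hornerD hornerN !hornerZ horner_comp hornerD hornerX hornerC Gz_gmul.
      rewrite (_ : \prod_i Gw (gmul _ _) i ^+ _ = (\prod_i Gw (W xy) i ^+ mu i) * b mu); first by ring.
      by rewrite -big_split; apply: eq_bigr => i _ /=; rewrite Gw_gmul exprMn.
    by rewrite E -/(expsum c (W xy)) Hc mulr0 subrr.
  have lt' : (\sum_(mu <- s) size (c' mu) < N)%N.
    rewrite -ltnS; apply: leq_trans leN; rewrite ltnS.
    rewrite (big_rem mu0) //= [X in (_ < X)%N](big_rem mu0) //= -addSn leq_add //.
    by apply: leq_sum => mu _.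
  by move: c'1; rewrite (IH c' lt' Hc' mu1 s1) eqxx.
(* Only [mu1] is left. Its monomial is invertible, so the additive coordinate is a root of [c mu1]
   everywhere and must be constant. *)
apply: Gz_nonconst.
have [cz Hz] : exists cz, forall xy : X * Y, Gz (W xy) i0 = cz.
  apply: (const_of_poly_zero (x0, y0) (subalg_polyfun W) dom_sum_map (polyfun_coord W (lshift p i0)) c1).
  move=> xy; have := Hc xy; rewrite /expsum (bigD1_seq mu1) //= [X in _ + X]big1_seq => [/eqP|mu /andP [ne smu]].
    rewrite addr0 mulf_eq0 => /orP [/eqP //|/eqP E].
    have /prodf_neq0 : forall i, true -> Gw (W xy) i ^+ mu1 i != 0.
      by move=> i _; rewrite expf_neq0 // inG_sum_map.
    by rewrite E eqxx.
  have -> : c mu = 0; last by rewrite horner0 mul0r.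
  by apply/eqP/negPn/negP => cmu; apply: H; exists mu.
exists (cz - Gz (act B (F2 y0)) i0) => x.
by rewrite -(Hz (x, y0)) Gz_gmul /= addrK.
Qed.

End Support.

Lemma meval_supp (q : {mpoly K[p]}) (s : seq 'X_{1..p}) (w : 'I_p -> K) : uniq s ->
  {subset msupp q <= s} -> q.@[w] = \sum_(mu <- s) q@_mu * \prod_i w i ^+ mu i.
Proof.
move=> us sub; rewrite mevalE [RHS](bigID (fun mu => mu \in msupp q)) /=.
rewrite [X in _ = _ + X]big1 ?addr0 => [|mu /memN_msupp_eq0 ->]; last by rewrite mul0r.
rewrite -[RHS]big_filter; apply: perm_big; apply: uniq_perm; rewrite ?filter_uniq ?msupp_uniq //.
by move=> mu; rewrite mem_filter; apply/idP/andP => [H|[]//]; split=> //; apply: sub.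
Qed.

(** One additive and all p multiplicative coordinates are p + 1 independent functions on [W],
    against the bound p. A relation is regrouped by multiplicative monomials, with coefficients
    polynomial in the additive coordinate. *)
Theorem sum_map_not_full : False.
Proof.
apply: trW; exists (fun xy => fcons (Gz (W xy) i0) (Gw (W xy))); split.
  by move=> i; rewrite /fcons; case: unliftP => [j _|_] /=; apply: polyfun_coord.
move=> P HP; have [G EG] := of_poly_surj P.
pose s := undup (flatten [seq msupp q : seq 'X_{1..p} | q <- (G : seq {mpoly K[p]})]).
have sub l : {subset msupp G`_l <= s}.
  move=> mu Hmu; rewrite mem_undup; apply/flattenP; exists (msupp G`_l) => //.
  apply: map_f; apply: mem_nth; rewrite ltnNge; apply/negP => H.
  by move: Hmu; rewrite nth_default // msupp0.
pose c mu := \poly_(l < size G) (G`_l)@_mu.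
have us : uniq s by apply: undup_uniq.
have E xy : expsum s c (W xy) = 0.
  rewrite -[RHS](HP xy) -EG of_poly_eval ev2E /expsum.
  under eq_bigr => mu _ do rewrite horner_poly mulr_suml.
  rewrite exchange_big /=; apply: eq_bigr => l _; rewrite (meval_supp _ us (sub l)) mulr_suml.
  by apply: eq_bigr => mu _; rewrite mulrAC.
have c0 := expsum_zero us E.
rewrite -EG (_ : G = 0); first by rewrite /of_poly rmorph0 horner0.
apply/polyP => l; rewrite coef0; apply/mpolyP => mu; rewrite mcoeff0.
case: (boolP (mu \in s)) => [Hmu|Hmu]; last first.
  by apply: memN_msupp_eq0; apply: contra Hmu; apply: sub.
have /polyP /(_ l) := c0 mu Hmu; rewrite coef_poly coef0; case: ltnP => // H _.
by rewrite nth_default // mcoeff0.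
Qed.

End FullRank.
End Fixed.
End SumOfVarieties.

(** * The restriction of scalars *)

Section RealiseAction.
Variable K : closedFieldType.
Hypothesis two0 : (2 : K) != 0.

(** Doubling clears the halves in the additive part, and the square of (uv)^a (u/v)^b is (u^2)^(a+b)
    (v^2)^(a-b), so that only points of [V] and of its conjugate remain. *)
Lemma act_realise n p (M : 'M[int]_(p, n + n)) (x y : 'I_(n + n) -> K) : inG n x -> inG n y ->
  pw 2 (act M (realise x y)) =
  gmul (act (lsubmx M + rsubmx M) (sqw x)) (act (lsubmx M - rsubmx M) (sqw y)).
Proof.
move=> Gx Gy; apply: G_ext => i.
  rewrite /pw Gz_Gmk Gz_gmul !Gz_act big_split_ord /= mulrDr !mulr_sumr -!big_split /=.
  apply: eq_bigr => j _; rewrite /realise /sqw !Gz_Gmk Gmk_l Gmk_r !mxE.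
  move: (Gz x j) (Gz y j) (M i (lshift n j)) (M i (rshift n j)) => s t a b.
  have mz (z : K) c : z *~ c = z * c%:~R by rewrite mulrzr.
  rewrite (mz ((s + t) / 2) a) (mz ((s - t) / 2) b) (mz s (a + b)) (mz t (a - b)) rmorphD rmorphB /=.
  by move: (a%:~R) (b%:~R) => {}a {}b; field.
rewrite /pw Gw_Gmk Gw_gmul !Gw_act big_split_ord /= -!big_split -prodrXl /=.
apply: eq_bigr => j _; rewrite /realise /sqw !Gw_Gmk Gmk_l Gmk_r !mxE.
have u0 := Gx j; have v0 := Gy j; move: (Gw x j) (Gw y j) u0 v0 => u v u0 v0.
move: (M i (lshift n j)) (M i (rshift n j)) => a b.
rewrite !expfzMl exprz_inv !expfzDr ?expf_neq0 // -!invr_expz.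
by rewrite expr2; ring.
Qed.

End RealiseAction.

(** * Rank bounds for sums and the ranks occurring in the extremal case *)

Section GenericRanks.
Variable K : closedFieldType.
Hypothesis char0 : [pchar K] =i pred0.

(** Rotundity and simplicity as bounds on transcendence degrees, for matrices of any height. In this
    form they pass to the conjugate variety, so the two summands can be treated alike. *)
Definition rank_bounds X n (F : X -> 'I_(n + n) -> K) :=
  (forall p (N : 'M[int]_(p, n)), trdeg_ge (polyfun (fun x => act N (F x))) (rankZ N)) /\
  (forall p (N : 'M[int]_(p, n)), (0 < rankZ N < n)%N ->
     trdeg_ge (polyfun (fun x => act N (F x))) (rankZ N).+1).

Lemma rank_bounds_square X n (F : X -> 'I_(n + n) -> K) :
  (forall x, inG n (F x)) -> dom (polyfun F) ->
  (forall N : 'M[int]_n, trdeg_ge (polyfun (fun x => act N (F x))) (rankZ N)) ->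
  (forall N : 'M[int]_n, (0 < rankZ N < n)%N ->
     trdeg_ge (polyfun (fun x => act N (F x))) (rankZ N).+1) -> rank_bounds F.
Proof.
move=> GF dF H1 H2.
have mono p (N : 'M[int]_(p, n)) (E : 'M[int]_(n, p)) k :
    trdeg_ge (polyfun (fun x => act (E *m N) (F x))) k -> trdeg_ge (polyfun (fun x => act N (F x))) k.
  apply: (trdeg_regmap char0) => [i|].
    have := regmap_act E (fun x => inG_act N (GF x)) (regmap_id (fun x => act N (F x))) i.
    by apply: subalg_ext => x; rewrite act_mul.
  by apply: dom_regmap dF; apply: regmap_act => //; apply: regmap_id.
split=> p N; have [E <-] := rankZ_square N; first by apply: mono.
by move=> HN; apply: mono; apply: H2.
Qed.

(** A left inverse up to a scalar c recovers [pw c F] from [act A F], and [pw c] loses no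
    transcendence degree. *)
Lemma trdeg_of_left_inverse X n p (F : X -> 'I_(n + n) -> K) (A : 'M[int]_(p, n)) k :
  (forall x, inG n (F x)) -> dom (polyfun F) -> rankZ A = n ->
  trdeg_ge (polyfun F) k -> trdeg_ge (polyfun (fun x => act A (F x))) k.
Proof.
move=> GF dF rA trF; have [c [T [c0 TA]]] := rankZ_left_inverse rA.
have := trdeg_pw char0 c0 dF trF; apply: (trdeg_regmap char0) => [i|].
  have := regmap_act T (fun x => inG_act A (GF x)) (regmap_id (fun x => act A (F x))) i.
  by apply: subalg_ext => x; rewrite act_mul // TA act_scalar.
by apply: dom_regmap dF; apply: regmap_act => //; apply: regmap_id.
Qed.

Section Pair.
Variables (X Y : Type) (n : nat).
Variables (F1 : X -> 'I_(n + n) -> K) (F2 : Y -> 'I_(n + n) -> K).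
Hypotheses (G1 : forall x, inG n (F1 x)) (G2 : forall y, inG n (F2 y)).
Hypotheses (d1 : dom (polyfun F1)) (d2 : dom (polyfun F2)).
Hypotheses (rb1 : rank_bounds F1) (rb2 : rank_bounds F2).

Lemma trdeg_sum_rank p (A B : 'M[int]_(p, n)) :
  trdeg_ge (polyfun (sum_map F1 F2 A B)) (rankZ (row_mx A B)).
Proof.
have [E [EA le]] := rankZ_row_mx_ker A B; apply: (trdeg_ge_le char0 le).
by apply: (trdeg_sum char0 G1 G2 d1 d2 EA); [apply: rb1.1|apply: rb2.1].
Qed.

(** Rotundity forces rank(E B) = p - rank A, so the lower bounds for base and fibre add up to
    exactly p. Any surplus in either one, from an intermediate rank or from a dimension above n at
    rank n, would exceed p. *)
Lemma extremal_ranks p (A B : 'M[int]_(p, n)) : rankZ (row_mx A B) = p ->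
  ~ trdeg_ge (polyfun (sum_map F1 F2 A B)) p.+1 ->
  [/\ rankZ A = 0%N \/ rankZ A = n, (p - rankZ A = 0)%N \/ (p - rankZ A = n)%N,
      rankZ A = n -> ~ trdeg_ge (polyfun F1) n.+1 &
      (p - rankZ A = n)%N -> ~ trdeg_ge (polyfun F2) n.+1].
Proof.
move=> rM trW; have [E [EA le]] := rankZ_row_mx_ker A B; rewrite rM in le.
have notW k1 k2 : trdeg_ge (polyfun (fun x => act A (F1 x))) k1 ->
    trdeg_ge (polyfun (fun y => act (E *m B) (F2 y))) k2 -> (p < k1 + k2)%N -> False.
  move=> t1 t2 lt; apply: trW; apply: (trdeg_ge_le char0 lt).
  exact: (trdeg_sum char0 G1 G2 d1 d2 EA t1 t2).
have rA : (rankZ A <= n)%N by rewrite rankZE rank_leq_col.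
have rEB : (rankZ (E *m B) <= n)%N by rewrite rankZE rank_leq_col.
have r2 : (p - rankZ A)%N = rankZ (E *m B).
  apply/eqP; rewrite eqn_leq leq_subLR le /= leqNgt; apply/negP => H.
  by apply: (notW _ _ (rb1.1 _ A) (rb2.1 _ (E *m B))); lia.
have ple : (p <= rankZ A + rankZ (E *m B))%N by [].
rewrite r2; split.
- case: (posnP (rankZ A)) => [->|r0]; first by left.
  case: (ltngtP (rankZ A) n) rA => // [rn|->] _; last by right.
  have h : (0 < rankZ A < n)%N by rewrite r0.
  by case: (notW _ _ (rb1.2 _ A h) (rb2.1 _ (E *m B))); lia.
- case: (posnP (rankZ (E *m B))) => [->|r0]; first by left.
  case: (ltngtP (rankZ (E *m B)) n) rEB => // [rn|->] _; last by right.
  have h : (0 < rankZ (E *m B) < n)%N by rewrite r0.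
  by case: (notW _ _ (rb1.1 _ A) (rb2.2 _ (E *m B) h)); lia.
- move=> rAn tr; have := trdeg_of_left_inverse G1 d1 rAn tr.
  by move=> t1; apply: (notW _ _ t1 (rb2.1 _ (E *m B))); lia.
- move=> rBn tr; have := trdeg_of_left_inverse G2 d2 rBn tr.
  by move=> t2; apply: (notW _ _ (rb1.1 _ A) t2); lia.
Qed.

Lemma trdeg_sum_swap p (A B : 'M[int]_(p, n)) k :
  trdeg_ge (polyfun (sum_map F2 F1 B A)) k -> trdeg_ge (polyfun (sum_map F1 F2 A B)) k.
Proof.
apply: trdeg_pimage => -[y x]; exists (x, y); apply: G_ext => i.
  by rewrite !Gz_gmul addrC.
by rewrite !Gw_gmul mulrC.
Qed.

End Pair.
End GenericRanks.

Lemma rankZ_row_mx_swap p n (A B : 'M[int]_(p, n)) : rankZ (row_mx A B) = rankZ (row_mx B A).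
Proof.
suff le (C D : 'M[int]_(p, n)) : (rankZ (row_mx C D) <= rankZ (row_mx D C))%N.
  by apply/eqP; rewrite eqn_leq !le.
have <- : row_mx D C *m block_mx 0 1%:M 1%:M 0 = row_mx C D.
  by rewrite mul_row_block !mulmx0 !mulmx1 addr0 add0r.
exact: rankZ_mul_maxr.
Qed.

(** Twice [M] is recovered from the sum and difference of its blocks by an integer block matrix. *)
Lemma rankZ_sum_diff p n (M : 'M[int]_(p, n + n)) :
  (rankZ M <= rankZ (row_mx (lsubmx M + rsubmx M) (lsubmx M - rsubmx M)))%N.
Proof.
rewrite -(rankZ_scale (c := 2) M) //.
have -> : 2 *: M = row_mx (lsubmx M + rsubmx M) (lsubmx M - rsubmx M) *m
    block_mx 1%:M 1%:M 1%:M (- 1%:M).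
  rewrite mul_row_block !mulmx1 !mulmxN !mulmx1 -[in LHS](hsubmxK M) scale_row_mx.
  by congr row_mx; rewrite scaler_nat mulr2n; [rewrite addrACA subrr addr0|
     rewrite opprB addrC addrA subrK].
exact: rankZ_mul_maxr.
Qed.

(** * The restriction of scalars of a simple variety *)

Section Main.
Variable K : closedFieldType.
Variable sigma : {rmorphism K -> K}.
Hypothesis sigmaK : forall x, sigma (sigma x) = x.
Hypothesis sigma_nontriv : exists x, sigma x != x.
Hypothesis char0 : [pchar K] =i pred0.
Variables (n : nat) (V : pset K (n + n)).
Hypotheses (V_irred : zirred (inG n) V) (V_simple : simple V).

Let X := {x | V x}.
Let F1 (x : X) : 'I_(n + n) -> K := sval x.
Let F2 : X -> 'I_(n + n) -> K := conjf sigma F1.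

Lemma V_sub_G : psubset V (inG n).
Proof. by have /zirredP [/zclosedP []] := V_irred. Qed.

Lemma F1_G x : inG n (F1 x).
Proof. by apply: V_sub_G; case: x. Qed.

Lemma F2_G x : inG n (F2 x).
Proof. by move=> i; rewrite /Gw /F2 /conjf fmorph_eq0; apply: F1_G. Qed.

Lemma F1_dom : dom (polyfun F1).
Proof. by apply: prime_set_dom; have /zirredP [] := V_irred. Qed.

Lemma F2_dom : dom (polyfun F2).
Proof. exact: dom_conj F1_dom. Qed.

Lemma X_inhabited : inhabited X.
Proof. by have [_ [x Vx] _] := V_irred; exact: (inhabits (exist _ x Vx)). Qed.

Lemma F2_act p (N : 'M[int]_(p, n)) x : act N (F2 x) = conjf sigma (fun x => act N (F1 x)) x.
Proof.
apply: G_ext => i; rewrite /conjf /F2.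
  by rewrite Gz_act -[RHS]/(sigma (Gz _ i)) Gz_act rmorph_sum; apply: eq_bigr => j _ /=; rewrite rmorphMz.
rewrite Gw_act -[RHS]/(sigma (Gw _ i)) Gw_act rmorph_prod; apply: eq_bigr => j _ /=.
by rewrite fmorphXz.
Qed.

Lemma F1_rank_bounds : rank_bounds F1.
Proof.
have [_ rotV simV] := V_simple.
apply: (rank_bounds_square char0 F1_G F1_dom) => [N|N HN].
  have := rotV N; rewrite (actV_pimage _ V_sub_G) (dim_ge_image char0) //.
  - exact: principal_inG.
  - exact: X_inhabited.
  - by apply: dom_regmap F1_dom; apply: regmap_act; [exact: F1_G|exact: regmap_id].
  - by move=> x; apply: inG_act; apply: F1_G.
have := simV N HN; rewrite (actV_pimage _ V_sub_G) (dim_ge_image char0) //.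
- exact: principal_inG.
- exact: X_inhabited.
- by apply: dom_regmap F1_dom; apply: regmap_act; [exact: F1_G|exact: regmap_id].
- by move=> x; apply: inG_act; apply: F1_G.
Qed.

Lemma F2_rank_bounds : rank_bounds F2.
Proof.
have E p (N : 'M[int]_(p, n)) : (fun x => act N (F2 x)) = conjf sigma (fun x => act N (F1 x)).
  by apply: functional_extensionality => x; rewrite F2_act.
have [H1 H2] := F1_rank_bounds; split=> p N; rewrite E => *; apply: (trdeg_conj char0 sigmaK).
  exact: H1.
exact: H2.
Qed.

Lemma F1_Gz_nonconst (M : 'M[int]_(1, n)) : M != 0 ->
  ~ exists c, forall x, Gz (act M (F1 x)) ord0 = c.
Proof.
move=> M0 [c Hc]; have [/(_ M M0) [[d1 _] _] _ _] := V_simple; move: d1.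
rewrite (actV_pimage _ V_sub_G) proj_a_closure; last by move=> x; apply: inG_act; apply: F1_G.
move/dim_ge1_nonconst; apply=> a b Ha Hb.
suff H z : zclosure (@Ga_univ K) (pimage (fun x => Gz (act M (F1 x)))) z -> z ord0 = c.
  by apply: functional_extensionality => i; rewrite ord1 !H.
case=> _ /(_ ('X_ord0 - c%:MP)); rewrite mevalB mevalXU mevalC => H.
by apply/eqP; rewrite -subr_eq0 H // => _ [x ->] _; rewrite mevalB mevalXU mevalC Hc subrr.
Qed.

Lemma F1_Gw_nonconst (M : 'M[int]_(1, n)) : M != 0 ->
  ~ exists c, forall x, Gw (act M (F1 x)) ord0 = c.
Proof.
move=> M0 [c Hc]; have [/(_ M M0) [_ [d1 _]] _ _] := V_simple; move: d1.
rewrite (actV_pimage _ V_sub_G) proj_m_closure; last by move=> x; apply: inG_act; apply: F1_G.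
move/dim_ge1_nonconst; apply=> a b Ha Hb.
suff H z : zclosure (@Gm_univ K) (pimage (fun x => Gw (act M (F1 x)))) z -> z ord0 = c.
  by apply: functional_extensionality => i; rewrite ord1 !H.
case=> _ /(_ ('X_ord0 - c%:MP)); rewrite mevalB mevalXU mevalC => H.
by apply/eqP; rewrite -subr_eq0 H // => _ [x ->] _; rewrite mevalB mevalXU mevalC Hc subrr.
Qed.

Lemma F2_Gz_nonconst (M : 'M[int]_(1, n)) : M != 0 ->
  ~ exists c, forall x, Gz (act M (F2 x)) ord0 = c.
Proof.
move=> M0 [c Hc]; apply: (F1_Gz_nonconst M0); exists (sigma c) => x.
by rewrite -(Hc x) F2_act -[RHS]/(sigma (sigma _)) sigmaK.
Qed.

Lemma F2_Gw_nonconst (M : 'M[int]_(1, n)) : M != 0 ->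
  ~ exists c, forall x, Gw (act M (F2 x)) ord0 = c.
Proof.
move=> M0 [c Hc]; apply: (F1_Gw_nonconst M0); exists (sigma c) => x.
by rewrite -(Hc x) F2_act -[RHS]/(sigma (sigma _)) sigmaK.
Qed.

(** As [F2] is the conjugate of [F1], the diagonal of X * X parametrises the graph of sigma, which
    is dense in the product. *)
Lemma regfun_diagonal phi : regfun (pair_map F1 F2) phi -> (forall x, phi (x, x) = 0) ->
  forall xy, phi xy = 0.
Proof.
case=> a [b Eab] H [[x Vx] [y Vy]]; have [_ ->] := Eab (exist _ x Vx, exist _ y Vy).
have /zirredP [clV prV] := V_irred.
rewrite (conj_graph_dense char0 sigmaK sigma_nontriv (principal_inG K n) clV prV _ Vx Vy) ?mul0r //.
move=> z Vz; have := H (exist _ z Vz); have [b0 ->] := Eab (exist _ z Vz, exist _ z Vz).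
by move/eqP; rewrite mulf_eq0 invr_eq0 (negPf b0) orbF => /eqP.
Qed.

Section Cover.
Variable V1 : pset K (n + n).
Hypotheses (V1_irred : zirred (inG n) V1) (V1_V : forall x, V1 x -> V (sqw x)).
Hypothesis V_V1 : forall y, V y -> exists x, V1 x /\ y = sqw x.

Let X1 := {x | V1 x}.
Let R (x : X1) := realise (sval x) (conj_pt sigma (sval x)).

Lemma V1_sub_G : psubset V1 (inG n).
Proof. by have /zirredP [/zclosedP []] := V1_irred. Qed.

Lemma X1_G (x : X1) : inG n (sval x) /\ inG n (conj_pt sigma (sval x)).
Proof.
have Gx : inG n (sval x) by apply: V1_sub_G; case: x.
by split=> // i; rewrite /Gw /conj_pt fmorph_eq0; apply: Gx.
Qed.

Lemma R_G x : inG (n + n) (R x).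
Proof.
have [Gx Gy] := X1_G x; move=> i; rewrite /R /realise Gw_Gmk; elim/Gmk_ind: i => i.
  by rewrite Gmk_l mulf_neq0.
by rewrite Gmk_r mulf_neq0 ?invr_eq0.
Qed.

(** Density, applied to the irreducible cover, identifies the functions of (x, sigma(x)) with those
    on the product of [V1] and its conjugate, which form a domain; [realise] is regular in these
    coordinates. *)
Lemma R_dom : dom (polyfun R).
Proof.
pose D (x : X1) := Gmk (sval x) (conj_pt sigma (sval x)).
have dD : dom (polyfun D).
  move=> phi psi [p Ep] [q Eq] H.
  have /zirredP [clV prV] := V1_irred; have dF := prime_set_dom prV.
  have [xy|E|E] := dom_pair dF (dom_conj sigmaK dF) (polyfun_eval _ p) (polyfun_eval _ q).
  - rewrite -mevalM; case: xy => [[x Vx] [y Vy]].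
    apply: (conj_graph_dense char0 sigmaK sigma_nontriv (principal_inG K n) clV prV _ Vx Vy) => z Vz.
    by have := H (exist _ z Vz); rewrite Ep Eq mevalM.
  - by left=> x; rewrite Ep; apply: (E (x, x)).
  - by right=> x; rewrite Eq; apply: (E (x, x)).
have D1 : regmap D (fun x => sval x).
  by move=> i; apply: subalg_ext (regmap_id D (lshift _ i)) => x; rewrite /D Gmk_l.
have D2 : regmap D (fun x => conj_pt sigma (sval x)).
  by move=> i; apply: subalg_ext (regmap_id D (rshift _ i)) => x; rewrite /D Gmk_r.
have sD := subalg_regfun D.
apply: dom_regmap dD; apply: regmap_Gmk; apply: regmap_Gmk => i.
- have := subalg_scale sD 2^-1 (subalgD sD (regmap_Gz D1 i) (regmap_Gz D2 i)).
  by apply: subalg_ext => x; rewrite mulrC.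
- have := subalg_scale sD 2^-1 (subalgD sD (regmap_Gz D1 i) (subalg_scale sD (-1) (regmap_Gz D2 i))).
  by apply: subalg_ext => x; rewrite mulN1r mulrC.
- exact: (subalgM sD (regmap_Gw D1 i) (regmap_Gw D2 i)).
apply: (subalgM sD (regmap_Gw D1 i)); apply: regfun_inv; last exact: regmap_Gw.
by move=> x; have [_] := X1_G x.
Qed.

Lemma X1_inhabited : inhabited X1.
Proof. by have [_ [x V1x] _] := V1_irred; exact: (inhabits (exist _ x V1x)). Qed.

Lemma Vcheck_image : Vcheck sigma V = zclosure (inG (n + n)) (pimage R).
Proof. exact: (Vcheck_cover char0 sigmaK sigma_nontriv V1_sub_G V1_V V_V1). Qed.

Section Matrix.
Variables (p : nat) (M : 'M[int]_(p, n + n)).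
Let A := lsubmx M + rsubmx M.
Let B := lsubmx M - rsubmx M.
Let W := sum_map F1 F2 A B.

Lemma act_R (x : X1) : pw 2 (act M (R x)) = W (exist _ _ (V1_V (svalP x)), exist _ _ (V1_V (svalP x))).
Proof.
have [Gx Gy] := X1_G x; rewrite act_realise ?char0_two // /W /sum_map /=.
congr gmul; congr act; apply: functional_extensionality; apply: Gmk_ind => i.
  by rewrite /sqw /F2 /conjf /F1 /= !Gmk_l.
by rewrite /sqw /F2 /conjf /F1 /= !Gmk_r /Gw /conj_pt rmorphXn.
Qed.

Lemma act_R_surj x : exists x1, W (x, x) = pw 2 (act M (R x1)).
Proof.
case: x => x Vx; have [x1 [V1x1 Ex]] := V_V1 Vx; exists (exist _ x1 V1x1); rewrite act_R.
by congr (W (_, _)); apply: eq_sig_hprop => // *; apply: proof_irrelevance.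
Qed.

Lemma act_R_dom : dom (polyfun (fun x => act M (R x))).
Proof. by apply: dom_regmap R_dom; apply: regmap_act; [exact: R_G|exact: regmap_id]. Qed.

(** Doubling preserves transcendence degree and turns [act M (R x)] into the diagonal values of [W];
    by density a relation on the diagonal holds on the whole product. *)
Lemma trdeg_act_R k :
  trdeg_ge (polyfun (fun x => act M (R x))) k <-> trdeg_ge (polyfun W) k.
Proof.
split=> [tr|[f [/choice [q Eq] aif]]].
  have := trdeg_pw char0 (isT : (0 < 2)%N) act_R_dom tr.
  by apply: trdeg_pimage => x; rewrite act_R; eexists.
apply: (trdeg_regmap char0 (G := fun x => pw 2 (act M (R x))) _ act_R_dom).
  by apply: regmap_pw; apply: regmap_id.
apply: (trdeg_pimage (F := fun x => W (x, x)) act_R_surj).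
exists (fun x => f (x, x)); split=> [i|P HP]; first by exists (q i).
apply: aif; apply: regfun_diagonal => //.
apply: polyfun_regmap (regmap_sum_map F1_G F2_G A B) _.
exists (psubst q P) => xy; rewrite psubst_eval; apply: meval_eq => i; exact: Eq.
Qed.

Lemma dim_actV_Vcheck k :
  dim_ge (inG p) (actV M (Vcheck sigma V)) k <-> trdeg_ge (polyfun W) k.
Proof.
rewrite Vcheck_image actV_closure; last exact: R_G.
rewrite (dim_ge_image char0); first exact: trdeg_act_R.
- exact: principal_inG.
- exact: X1_inhabited.
- exact: act_R_dom.
- by move=> x; apply: inG_act; apply: R_G.
Qed.

End Matrix.

Lemma sum_diff_eq0 p (M : 'M[int]_(p, n + n)) :
  lsubmx M + rsubmx M = 0 -> lsubmx M - rsubmx M = 0 -> M = 0.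
Proof.
move=> /eqP; rewrite addr_eq0 => /eqP E1 /eqP; rewrite subr_eq0 => /eqP E2.
have r0 : rsubmx M = 0.
  apply/matrixP => i j; have /matrixP /(_ i j) := E2; rewrite E1 !mxE; lia.
by rewrite -[M]hsubmxK E2 r0 row_mx0.
Qed.

(** A constant coordinate would, by density, be constant on the whole product. Freezing one factor
    makes it constant on the other, and since [M] is nonzero one of [A] and [B] is nonzero,
    contradicting freeness of [V]. *)
Lemma R_Gz_nonconst (M : 'M[int]_(1, n + n)) : M != 0 ->
  ~ exists c, forall x, Gz (act M (R x)) ord0 = c.
Proof.
move=> M0 [c Hc]; set A := lsubmx M + rsubmx M; set B := lsubmx M - rsubmx M.
pose W := sum_map F1 F2 A B; have rW := regmap_sum_map F1_G F2_G A B.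
have HW xy : Gz (W xy) ord0 = 2%:R * c.
  apply/eqP; rewrite -subr_eq0; apply/eqP; move: xy; apply: regfun_diagonal.
    by apply: (subalgD (subalg_regfun _)); [exact: rW|exact: subalgC (subalg_regfun _) _].
  by move=> x; have [x1 Ex] := act_R_surj M x; rewrite [W _]Ex /pw Gz_Gmk Hc subrr.
have [x0] := X_inhabited.
have [A0|A0] := eqVneq A 0; last first.
  apply: (F1_Gz_nonconst A0); exists (2%:R * c - Gz (act B (F2 x0)) ord0) => x.
  by rewrite -(HW (x, x0)) Gz_gmul addrK.
have [B0|B0] := eqVneq B 0; first by case/eqP: M0; apply: sum_diff_eq0.
apply: (F2_Gz_nonconst B0); exists (2%:R * c - Gz (act A (F1 x0)) ord0) => y.
by rewrite -(HW (x0, y)) Gz_gmul addrAC subrr add0r.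
Qed.

Lemma R_Gw_nonconst (M : 'M[int]_(1, n + n)) : M != 0 ->
  ~ exists c, forall x, Gw (act M (R x)) ord0 = c.
Proof.
move=> M0 [c Hc]; set A := lsubmx M + rsubmx M; set B := lsubmx M - rsubmx M.
pose W := sum_map F1 F2 A B; have rW := regmap_sum_map F1_G F2_G A B.
have HW xy : Gw (W xy) ord0 = c ^+ 2.
  apply/eqP; rewrite -subr_eq0; apply/eqP; move: xy; apply: regfun_diagonal.
    by apply: (subalgD (subalg_regfun _)); [exact: rW|exact: subalgC (subalg_regfun _) _].
  by move=> x; have [x1 Ex] := act_R_surj M x; rewrite [W _]Ex /pw Gw_Gmk Hc subrr.
have [x0] := X_inhabited.
have GA x : Gw (act A (F1 x)) ord0 != 0 by apply: inG_act; apply: F1_G.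
have GB y : Gw (act B (F2 y)) ord0 != 0 by apply: inG_act; apply: F2_G.
have [A0|A0] := eqVneq A 0; last first.
  apply: (F1_Gw_nonconst A0); exists (c ^+ 2 / Gw (act B (F2 x0)) ord0) => x.
  by rewrite -(HW (x, x0)) Gw_gmul mulfK.
have [B0|B0] := eqVneq B 0; first by case/eqP: M0; apply: sum_diff_eq0.
apply: (F2_Gw_nonconst B0); exists (c ^+ 2 / Gw (act A (F1 x0)) ord0) => y.
by rewrite -(HW (x0, y)) Gw_gmul mulrAC mulfV ?mul1r.
Qed.

Lemma abs_free_Vcheck : abs_free (Vcheck sigma V).
Proof.
move=> M M0; have [x0] := X1_inhabited.
have GM x : inG 1 (act M (R x)) by apply: inG_act; apply: R_G.
have rz : regmap (fun x => act M (R x)) (fun x => Gz (act M (R x))).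
  by apply: regmap_Gz; apply: regmap_id.
have rw : regmap (fun x => act M (R x)) (fun x => Gw (act M (R x))).
  by apply: regmap_Gw; apply: regmap_id.
rewrite Vcheck_image actV_closure; last exact: R_G.
split; [rewrite proj_a_closure // | rewrite proj_m_closure //].
  have H := (@dim_eq1_image K char0 (@Ga_univ K) _ (fun x => Gz (act M (R x))) _ x0
    (dom_regmap rz (@act_R_dom 1 M)) (fun x => I) (R_Gz_nonconst M0)). apply: H.
  by exists 1 => x; rewrite meval1 oner_eq0.
apply: (@dim_eq1_image K char0 _ _ (fun x => Gw (act M (R x))) _ x0
  (dom_regmap rw (@act_R_dom 1 M)) GM (R_Gw_nonconst M0)).
exists 'X_ord0 => x; rewrite mevalXU; split=> [|x00 i]; first exact.
by rewrite ord1.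
Qed.

Lemma zirred_Vcheck : zirred (inG (n + n)) (Vcheck sigma V).
Proof.
by rewrite Vcheck_image; apply: zirred_image; [exact: X1_inhabited|exact: R_dom|exact: R_G].
Qed.

Lemma rotund_Vcheck : rotund (Vcheck sigma V).
Proof.
move=> M; apply/dim_actV_Vcheck; apply: (trdeg_ge_le char0 (rankZ_sum_diff M)).
apply: (trdeg_sum_rank char0 F1_G F2_G F1_dom F2_dom F1_rank_bounds F2_rank_bounds).
Qed.

Lemma dim_V k : dim_ge (inG n) V k <-> trdeg_ge (polyfun F1) k.
Proof.
have /zirredP [clV _] := V_irred.
have -> : V = zclosure (inG n) (pimage F1).
  apply: functional_extensionality => x; apply: propositional_extensionality.
  have /zclosedP [VG cl] := clV; split=> [Vx|[Gx H]].
    by split=> [|q]; [exact: VG|apply; [exists (exist _ x Vx)|exact: VG]].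
  by apply: cl => // q vq; apply: H => _ [[y Vy] ->] _; apply: vq.
apply: (dim_ge_image char0).
- exact: principal_inG.
- exact: X_inhabited.
- exact: F1_dom.
- exact: F1_G.
Qed.

Lemma F1_trdeg : trdeg_ge (polyfun F1) n.
Proof.
have := F1_rank_bounds.1 n 1%:M; rewrite rankZE map_mx1 mxrank1.
by congr trdeg_ge; congr polyfun; apply: functional_extensionality => x; rewrite act1.
Qed.

Lemma perfectly_rotund_V : ~ trdeg_ge (polyfun F1) n.+1 -> perfectly_rotund V.
Proof.
by move=> H; split=> //; split; [apply/dim_V; exact: F1_trdeg|move/dim_V].
Qed.

Lemma full_row_mul_neq0 p (A : 'M[int]_(p, n)) (nu : 'M[int]_(1, p)) :
  rankZ A = p -> nu != 0 -> nu *m A != 0.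
Proof.
move=> rA; apply: contra => /eqP E; apply/eqP; apply: QM_inj; rewrite map_mx0.
have fA : row_free (map_mx (intr : int -> rat) A) by rewrite /row_free -rankZE rA.
by apply: (row_free_inj fA); rewrite mul0mx -map_mxM E map_mx0.
Qed.

Lemma extremal_matrix p (M : 'M[int]_(p, n + n)) : (0 < p)%N -> rankZ M = p ->
  dim_eq (inG p) (actV M (Vcheck sigma V)) p ->
  perfectly_rotund V /\
  (p = (n + n)%N \/
   (p = n /\ exists N P : 'M[int]_(p, n), M = row_mx N P /\ rankZ N = n /\ rankZ P = n)).
Proof.
move=> p0 rM [_ ndim]; set A := lsubmx M + rsubmx M; set B := lsubmx M - rsubmx M.
have trW : ~ trdeg_ge (polyfun (sum_map F1 F2 A B)) p.+1 by move/dim_actV_Vcheck.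
have trW' : ~ trdeg_ge (polyfun (sum_map F2 F1 B A)) p.+1.
  by move=> H; apply: trW; apply: trdeg_sum_swap H.
have rAB : rankZ (row_mx A B) = p.
  by apply/eqP; rewrite eqn_leq {1}rankZE rank_leq_row -[X in (X <= _)%N]rM rankZ_sum_diff.
have rBA : rankZ (row_mx B A) = p by rewrite -rankZ_row_mx_swap.
have [rA rA' n1 n2] := extremal_ranks char0 F1_G F2_G F1_dom F2_dom
  F1_rank_bounds F2_rank_bounds rAB trW.
have [rB rB' _ _] := extremal_ranks char0 F2_G F1_G F2_dom F1_dom
  F2_rank_bounds F1_rank_bounds rBA trW'.
have rAp : (rankZ A <= p)%N by rewrite rankZE rank_leq_row.
split.
  (* If [A] has rank 0, then p itself must be n and the dimension bound falls on the conjugate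
     variety; conjugation carries it back to [V]. *)
  apply: perfectly_rotund_V; case: rA => rA; last exact: n1.
  move=> tr; apply: n2; first by lia.
  exact: trdeg_conj.
(* Both rank A and p - rank A lie in {0, n}, and p is positive. *)
have [pn|pn] : p = n \/ p = (n + n)%N by lia.
  right; split=> //; exists (lsubmx M), (rsubmx M); rewrite hsubmxK; split=> //.
  (* When [A] or [B] vanishes, the blocks of [M] agree up to sign and the other combination is twice
     a block, which gives full rank. The remaining case, both of rank n, is contradictory. *)
  case: rA => rA.
    have A0 := rankZ_eq0 rA; have EP : rsubmx M = - lsubmx M.
      by apply/eqP; rewrite -addr_eq0 addrC -/A A0.
    have EB : B = 2 *: lsubmx M by rewrite /B EP opprK scaler_nat mulr2n.
    have rl : rankZ (lsubmx M) = n.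
      rewrite -(rankZ_scale (c := 2)) // -EB; apply: etrans pn; apply: etrans rAB.
      by rewrite A0 !rankZE map_row_mx map_mx0 rank_row_0mx.
    by rewrite EP -[- lsubmx M]scaleN1r rankZ_scale.
  case: rB => rB.
    have B0 := rankZ_eq0 rB; have EP : rsubmx M = lsubmx M.
      by apply/esym/eqP; rewrite -subr_eq0 -/B B0.
    have EA : A = 2 *: lsubmx M by rewrite /A EP scaler_nat mulr2n.
    by rewrite EP -(rankZ_scale (c := 2)) // -EA rA.
  (* With [A] and [B] of full row rank, a nonzero character composed with [B] and the additive row
     [i0] of [A] are nonconstant by freeness of [V], so [sum_map_not_full] applies. *)
  have [x0] := X_inhabited; exfalso; pose i0 : 'I_p := Ordinal p0.
  have frA : rankZ A = p by rewrite rA pn.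
  have frB : rankZ B = p by rewrite rB pn.
  have trA := F1_rank_bounds.1 p A; rewrite frA in trA.
  apply: (sum_map_not_full char0 F1_G F2_G F1_dom F2_dom trA trW _ x0 x0 (i0 := i0)).
    by move=> nu nu0; apply: F2_Gw_nonconst; apply: full_row_mul_neq0.
  have d0 : (delta_mx 0 i0 : 'M[int]_(1, p)) *m A != 0.
    apply: full_row_mul_neq0 => //; apply/eqP => /matrixP /(_ 0 i0); rewrite !mxE !eqxx.
    by move/eqP; rewrite oner_eq0.
  case=> c Hc; apply: (F1_Gz_nonconst d0); exists c => x; rewrite -(Hc x) !Gz_act.
  by apply: eq_bigr => j _; rewrite -rowE mxE.
by left.
Qed.

End Cover.
End Main.

Theorem theorem9p1 (K : closedFieldType) (sigma : {rmorphism K -> K})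
  (sigma_invol : forall x, sigma (sigma x) = x)
  (sigma_nontriv : exists x, sigma x != x)
  (char0 : [pchar K] =i pred0)
  (n : nat) (V : pset K (n + n))
  (V_irred : zirred (inG n) V) (V_simple : simple V) :
  [/\ abs_free (Vcheck sigma V), zirred (inG (n + n)) (Vcheck sigma V)
    & rotund (Vcheck sigma V)] /\
  (forall (p : nat) (M : 'M[int]_(p, n + n)),
     (0 < p)%N -> rankZ M = p ->
     dim_eq (inG p) (actV M (Vcheck sigma V)) p ->
     perfectly_rotund V /\
     (p = (n + n)%N \/
      (p = n /\ exists N P : 'M[int]_(p, n),
          M = row_mx N P /\ rankZ N = n /\ rankZ P = n))).
Proof.
have [V1 [V1_irred V1_V V_V1]] := multiplicative_sq_cover V_irred.
split; last by move=> p M; apply: (extremal_matrix sigma_invol sigma_nontriv char0 V_irred V_simple V1_irred).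
split.
- exact: (abs_free_Vcheck sigma_invol sigma_nontriv char0 V_irred V_simple V1_irred).
- exact: (zirred_Vcheck sigma_invol sigma_nontriv char0 V1_irred).
- exact: (rotund_Vcheck sigma_invol sigma_nontriv char0 V_irred V_simple V1_irred).
Qed.
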